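(* For a greedy policy and an alternating policy applied to the same label sequences, with match counts $M_{\mathbf G}(n)$ and $M_{\mathbf A}(n)$, $$\frac{M_{\mathbf G}(n)-M_{\mathbf A}(n)}{n^{5/4}}\xrightarrow{d}\mathbf F\qquad(n\to\infty),$$ where $\mathbf F=\int \mathrm N(0,\sigma^2)\,dG(\sigma^2)$ is the scale mixture of centered normals in which the mixing distribution $G$ of the variance $\sigma^2$ is the law of $|W|$ with $W\sim\mathrm N\bigl(0,\frac{(\sigma_{\mathbf R}^2+\sigma_{\mathbf S}^2)^3}{128\mu^2}\bigr)$.
   Context: Let $(r_i)_{i\ge1}$, $(s_i)_{i\ge1}$ be probability vectors on the positive integers with $\mu:=\sum_i r_is_i>0$. Let $\{L_{\mathbf R}(n)\}_{n\ge1}$, $\{L_{\mathbf S}(n)\}_{n\ge1}$ be independent i.i.d. sequences with $\Pr(L_{\mathbf R}(1)=i)=r_i$, $\Pr(L_{\mathbf S}(1)=i)=s_i$. For $m\ge0$ let $\tilde N_{\mathbf R}(m)$ be the vector with entries $N_{\mathbf R}(m,i)=\sum_{j=1}^m\mathbf 1\{L_{\mathbf R}(j)=i\}$, and $\tilde N_{\mathbf S}(m)$ analogously. Put $X_{\mathbf R}(n)=s_{L_{\mathbf R}(n)}$, $X_{\mathbf S}(n)=r_{L_{\mathbf S}(n)}$ (common mean $\mu$, variances $\sigma_{\mathbf R}^2,\sigma_{\mathbf S}^2$; standing assumption $\sigma_{\mathbf R}+\sigma_{\mathbf S}>0$), $\Gamma_{\mathbf R}[m]=\sum_{j=1}^mX_{\mathbf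 R}(j)$, $\Gamma_{\mathbf S}[m]=\sum_{j=1}^mX_{\mathbf S}(j)$. A reading policy is a $\{0,1\}$-valued process $C(n)$ ($C(n)=1$ iff the $n$-th record is read from $\mathbf R$), $R(n)=\sum_{j\le n}C(j)$, $S(n)=n-R(n)$, with $C(n)$ being $\mathcal F_{n-1}$-measurable where $\mathcal F_n=\mathcal F_0\vee\sigma(L_{\mathbf R}(1),\dots,L_{\mathbf R}(R(n));L_{\mathbf S}(1),\dots,L_{\mathbf S}(S(n)))$ and $\mathcal F_0$ (randomization, for both policies) is independent of the labels. Matches: $M(n)=\tilde N_{\mathbf R}(R(n))\cdot\tilde N_{\mathbf S}(S(n))$. An alternating policy is $\mathcal F_0$-measurable with $R(2n)=n$ for all $n$. A greedy policy satisfies, for $n\ge1$, $C(n+1)=1$ if $\Gamma_{\mathbf S}[S(n)]>\Gamma_{\mathbf R}[R(n)]$ and $C(n+1)=0$ if $\Gamma_{\mathbf S}[S(n)]<\Gamma_{\mathbf R}[R(n)]$ (ties arbitrary). *)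

(* Defs.v *)
From HB Require Import structures.
From mathcomp Require Import all_boot all_order all_algebra.
From mathcomp Require Import all_classical all_reals all_analysis.
Set Implicit Arguments. Unset Strict Implicit. Unset Printing Implicit Defensive.
Import Order.TTheory GRing.Theory Num.Def Num.Theory.
Import numFieldNormedType.Exports.
Local Open Scope classical_set_scope.
Local Open Scope ring_scope.

(* Indexing convention: all sequences are 0-indexed, i.e. [L j] is the
   paper's L(j+1) and [C k] is the paper's C(k+1). Labels are natural
   numbers; a probability vector on the positive integers has r 0 = 0. *)

Section Defs.
Variable R : realType.

Definition prob_vec (r : nat -> R) : Prop :=
  [/\ r 0%N = 0, (forall i, 0 <= r i) & series r @ \oo --> (1 : R)].

Definition mu (r s : nat -> R) : R := limn (series (fun i => r i * s i)).

(** variance of X_R(1) = s_{L_R(1)} : sum_i r_i (s_i - mu)^2 *)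
Definition varR (r s : nat -> R) : R :=
  limn (series (fun i => r i * (s i - mu r s) ^+ 2)).

(** variance of X_S(1) = r_{L_S(1)} : sum_i s_i (r_i - mu)^2 *)
Definition varS (r s : nat -> R) : R :=
  limn (series (fun i => s i * (r i - mu r s) ^+ 2)).

Variables (d : measure_display) (T : measurableType d).

Definition Rcount (C : nat -> T -> bool) (n : nat) (w : T) : nat :=
  (\sum_(k < n) (C k w : nat))%N.

Definition Scount (C : nat -> T -> bool) (n : nat) (w : T) : nat :=
  (n - Rcount C n w)%N.

Definition first_labels (L : nat -> T -> nat) (m : nat) (w : T) : seq nat :=
  [seq L j w | j <- iota 0 m].

Definition Ncount (L : nat -> T -> nat) (m i : nat) (w : T) : nat :=
  count_mem i (first_labels L m w).

Definition read_history (LR LS : nat -> T -> nat) (C : nat -> T -> bool) (n : nat)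
  (w : T) : seq nat * seq nat :=
  (first_labels LR (Rcount C n w) w, first_labels LS (Scount C n w) w).

Definition read_filtration (F0 : set (set T)) (LR LS : nat -> T -> nat)
  (C : nat -> T -> bool) (n : nat) : set (set T) :=
  <<s F0 `|` [set (read_history LR LS C n) @^-1` B | B in [set: set (seq nat * seq nat)]] >>.

Definition reading_policy (F0 : set (set T)) (LR LS : nat -> T -> nat)
  (C : nat -> T -> bool) : Prop :=
  forall n, read_filtration F0 LR LS C n [set w | C n w].

Definition Gamma (L : nat -> T -> nat) (x : nat -> R) (m : nat) (w : T) : R :=
  \sum_(j < m) x (L j w).

Definition greedy_policy (r s : nat -> R) (LR LS : nat -> T -> nat)
  (C : nat -> T -> bool) : Prop :=
  forall n w, (0 < n)%N ->
    (Gamma LR s (Rcount C n w) w < Gamma LS r (Scount C n w) w -> C n w = true) /\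
    (Gamma LS r (Scount C n w) w < Gamma LR s (Rcount C n w) w -> C n w = false).

Definition alternating_policy (F0 : set (set T)) (C : nat -> T -> bool) : Prop :=
  (forall n, F0 [set w | C n w]) /\ (forall n w, Rcount C (2 * n) w = n).

(** M(n) = N_R(R(n)) . N_S(S(n)) (only labels occurring among the first R(n)
    R-labels contribute non-zero terms to the dot product) *)
Definition match_count (LR LS : nat -> T -> nat) (C : nat -> T -> bool) (n : nat)
  (w : T) : nat :=
  (\sum_(i <- undup (first_labels LR (Rcount C n w) w))
     Ncount LR (Rcount C n w) i w * Ncount LS (Scount C n w) i w)%N.

(** Probabilistic setting: L_R, L_S are label-valued random variables,
    (L_R(n))_n i.i.d. with law r, (L_S(n))_n i.i.d. with law s, the two
    sequences independent, and the randomization sigma-algebra F_0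
    independent of all labels. This is expressed through the joint law of
    every finite cylinder, intersected with any event of F_0. *)
Definition labels_model (P : probability T R) (F0 : set (set T))
  (LR LS : nat -> T -> nat) (r s : nat -> R) : Prop :=
  [/\ sigma_algebra setT F0, F0 `<=` measurable,
      (forall j i, measurable [set w | LR j w = i]),
      (forall j i, measurable [set w | LS j w = i]) &
      (forall A, F0 A -> forall (k : nat) (a b : nat -> nat),
        P (A `&` [set w | forall j, (j < k)%N -> LR j w = a j /\ LS j w = b j])
        = (P A * (\prod_(j < k) (r (a j) * s (b j)))%:E)%E)].

(** convergence in distribution of real random variables to a probability
    measure F on R: CDF convergence at every continuity point of the CDF
    of F (i.e. every x with F {x} = 0). *)
Definition cvg_dist (P : probability T R) (Z : nat -> T -> R)
  (F : set R -> \bar R) : Prop :=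
  forall x : R, F [set x] = 0%E ->
    (fun n => P [set w | Z n w <= x]) @ \oo --> F [set y : R | y <= x].

End Defs.

Definition tau2 {R : realType} (r s : nat -> R) : R :=
  (varR r s + varS r s) ^+ 3 / (128%:R * mu r s ^+ 2).

(** F = int N(0, v) dG(v), G = law of |W|, W ~ N(0, tau2).
    (normal_prob m sd takes the standard deviation.) *)
Definition mixtureF {R : realType} (r s : nat -> R) : set R -> \bar R :=
  fun A => (\int[normal_prob 0 (Num.sqrt (tau2 r s))]_w
              normal_prob 0 (Num.sqrt `|w|) A)%E.

(* Main.v *)
Require Import Defs.
From HB Require Import structures.
From mathcomp Require Import all_boot all_order all_algebra.
From mathcomp Require Import all_classical all_reals all_analysis.
From mathcomp Require Import measurable_realfun ring lra zify.
Import Order.TTheory GRing.Theory Num.Def Num.Theory.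
Import numFieldNormedType.Exports.
Set Implicit Arguments. Unset Strict Implicit. Unset Printing Implicit Defensive.
Local Open Scope classical_set_scope.
Local Open Scope ring_scope.

(* The kernel 1{a = b} equals mu plus the centred scores s_a - mu and r_b - mu plus a
   degenerate kernel, so after reading m R-records and n S-records the match count is
   mu m n + n W_R[m] + m W_S[n] + U(m, n), with W_R, W_S centred random walks and
   E U^2 = O(m n). Let rho be the number of R-records read by the greedy policy at time
   2h. The greedy rule keeps |Gamma_R - Gamma_S| <= 1, and the difference of the two match
   counts reduces to h T(rho) up to negligible terms, where
   T(x) = W_R[x] - W_R[h] + W_S[2h - x] - W_S[h].
   Up to o(h^(1/2)), rho is a function of the labels read before time 2(h - 2b),
   b = o(h), namely h + (W_S - W_R)[h - 2b] / (2 mu). Those labels are independent of the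
   ones entering T, so T(rho) is conditionally a sum of |rho - h| scores of each kind,
   close to N(0, (sigma_R^2 + sigma_S^2) |rho - h|), while rho - h is itself close to a
   normal variable of variance of order h: this is the mixture. Both central limit steps
   are Lindeberg replacements for test functions with a cubic Taylor remainder; the profile
   E f(sqrt|x| N) met in the second step is only Holder continuous, and is first
   approximated by sums of spline steps. *)

(** * Expectations of bounded functions *)

(** The obstacle is that the greedy count depends on the very labels that enter T, so no central
    limit theorem applies to T(rho) directly. Discarding the last labels from the prediction
    restores independence, but T must then be compared at two random indices. Only second moments
    serve for this: Chebyshev's inequality at grid points, a union bound, and a deterministic
    Lipschitz bound between them. The exponents come from this scheme. With q about h^(1/16), T(rho)
    has order h^(1/4) = q^4, so errors o(q^4) are allowed. The half-width b = q^9 exceeds the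
    fluctuations of rho, of order q^8, and is o(h). The discarded labels move rho by about q^(9/2),
    which is below q^5. Over a distance q^5 the variance of T is O(q^5), so each grid point fails
    with probability O(q^5 / q^8), and a mesh q^3 needs only about q^2 points: the total is O(1/q),
    with Lipschitz error O(q^3). For U, about q^6 points at mesh q^3 cover the window, each failing
    with probability O(h^2 / (q^4 h)^2) = O(q^(-8)). *)

Definition bounded_mfun {d} {T : measurableType d} {R : realType} (f : T -> R) :=
  measurable_fun setT f /\ exists M, forall x, `|f x| <= M.

Section bounded_expectation.
Context d (T : measurableType d) (R : realType) (P : probability T R).
Implicit Types f g : T -> R.

Lemma bounded_mfun_integrable f :
  bounded_mfun f -> P.-integrable setT (EFin \o f).
Proof.
move=> [mf [M fM]].
apply: (@le_integrable _ _ _ P _ _ _ (EFin \o cst M)) => //=.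
- exact/measurable_EFinP.
- by move=> x _; rewrite lee_fin (le_trans (fM x)) ?ler_norm.
- exact: finite_measure_integrable_cst.
Qed.

Lemma bounded_mfun_cst (c : R) : bounded_mfun (fun _ : T => c).
Proof. by split; [exact: measurable_cst | exists `|c|]. Qed.

Lemma bounded_mfunD f g :
  bounded_mfun f -> bounded_mfun g -> bounded_mfun (fun x => f x + g x).
Proof.
move=> [mf [M fM]] [mg [N gN]]; split; first exact: measurable_funD.
by exists (M + N) => x; rewrite (le_trans (ler_normD _ _)) ?lerD.
Qed.

Lemma bounded_mfunM f g :
  bounded_mfun f -> bounded_mfun g -> bounded_mfun (fun x => f x * g x).
Proof.
move=> [mf [M fM]] [mg [N gN]]; split; first exact: measurable_funM.
by exists (M * N) => x; rewrite normrM ler_pM.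
Qed.

Lemma bounded_mfunZ (c : R) f :
  bounded_mfun f -> bounded_mfun (fun x => c * f x).
Proof. exact/bounded_mfunM/bounded_mfun_cst. Qed.

Lemma bounded_mfunB f g :
  bounded_mfun f -> bounded_mfun g -> bounded_mfun (fun x => f x - g x).
Proof.
move=> bf bg; have := bounded_mfunD bf (bounded_mfunZ (-1) bg).
by under eq_fun do rewrite mulN1r.
Qed.

Lemma bounded_mfun_norm f :
  bounded_mfun f -> bounded_mfun (fun x => `|f x|).
Proof.
move=> [mf [M fM]]; split; first exact: measurableT_comp.
by exists M => x; rewrite normr_id.
Qed.

Lemma bounded_mfun_sum (I : Type) (s : seq I) (F : I -> T -> R) :
  (forall i, bounded_mfun (F i)) -> bounded_mfun (fun x => \sum_(i <- s) F i x).
Proof.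
move=> bF; elim: s => [|a s IH].
  by under eq_fun do rewrite big_nil; exact: bounded_mfun_cst.
by under eq_fun do rewrite big_cons; exact: bounded_mfunD.
Qed.

Lemma RintT_cst (c : R) : \int[P]_x c = c.
Proof.
by rewrite Rintegral_cst// [X in fine X](_ : _ = 1%E) ?mulr1//; exact: probability_setT.
Qed.

Lemma RintTD f g : bounded_mfun f -> bounded_mfun g ->
  \int[P]_x (f x + g x) = \int[P]_x f x + \int[P]_x g x.
Proof. by move=> bf bg; rewrite RintegralD//; exact: bounded_mfun_integrable. Qed.

Lemma RintTB f g : bounded_mfun f -> bounded_mfun g ->
  \int[P]_x (f x - g x) = \int[P]_x f x - \int[P]_x g x.
Proof. by move=> bf bg; rewrite RintegralB//; exact: bounded_mfun_integrable. Qed.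

Lemma RintTZ c f : bounded_mfun f -> \int[P]_x (c * f x) = c * \int[P]_x f x.
Proof. by move=> bf; rewrite RintegralZl//; exact: bounded_mfun_integrable. Qed.

Lemma RintT_sum (I : Type) (s : seq I) (F : I -> T -> R) :
  (forall i, bounded_mfun (F i)) ->
  \int[P]_x (\sum_(i <- s) F i x) = \sum_(i <- s) \int[P]_x F i x.
Proof.
move=> bF; elim: s => [|a s IH].
  by under eq_Rintegral do rewrite big_nil; rewrite RintT_cst big_nil.
under eq_Rintegral do rewrite big_cons; rewrite RintTD// ?IH ?big_cons//.
exact: bounded_mfun_sum.
Qed.

Lemma le_RintT f g : bounded_mfun f -> bounded_mfun g ->
  (forall x, f x <= g x) -> \int[P]_x f x <= \int[P]_x g x.
Proof. by move=> bf bg fg; apply: le_Rintegral => //; exact: bounded_mfun_integrable. Qed.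

Lemma RintT_ge0 f : (forall x, 0 <= f x) -> 0 <= \int[P]_x f x.
Proof. by move=> f0; apply: Rintegral_ge0. Qed.

Lemma RintT_norm_le f c : bounded_mfun f -> (forall x, `|f x| <= c) ->
  `|\int[P]_x f x| <= c.
Proof.
move=> bf fc; rewrite (le_trans (le_normr_Rintegral _ _))//.
  exact: bounded_mfun_integrable.
rewrite -[leRHS]RintT_cst; apply: le_RintT => //.
  exact: bounded_mfun_norm.
exact: bounded_mfun_cst.
Qed.

Lemma RintT_dist_le f g h : bounded_mfun f -> bounded_mfun g -> bounded_mfun h ->
  (forall x, `|f x - g x| <= h x) ->
  `|\int[P]_x f x - \int[P]_x g x| <= \int[P]_x h x.
Proof.
move=> bf bg bh fgh; rewrite -RintTB//.
rewrite (le_trans (le_normr_Rintegral _ _))//.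
  exact/bounded_mfun_integrable/bounded_mfunB.
apply: le_RintT => //.
exact/bounded_mfun_norm/bounded_mfunB.
Qed.

Lemma RintT_dist_cst f g c : bounded_mfun f -> bounded_mfun g ->
  (forall x, `|f x - g x| <= c) ->
  `|\int[P]_x f x - \int[P]_x g x| <= c.
Proof.
move=> bf bg fgc; rewrite -[leRHS]RintT_cst; apply: RintT_dist_le => //.
exact: bounded_mfun_cst.
Qed.

End bounded_expectation.

Section bounded_fubini.
Context d1 d2 (T1 : measurableType d1) (T2 : measurableType d2) (R : realType).
Variables (P1 : probability T1 R) (P2 : probability T2 R) (f : T1 * T2 -> R).
Hypothesis bf : bounded_mfun f.

Let intf : (P1 \x P2)%E.-integrable setT (EFin \o f).
Proof. exact: (@bounded_mfun_integrable _ _ _ (P1 \x P2)%E). Qed.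

Lemma bounded_mfun_section1 x : bounded_mfun (fun y => f (x, y)).
Proof.
case: bf => mf [M fM]; split; last by exists M => y.
exact: measurableT_comp.
Qed.

Lemma bounded_mfun_section2 y : bounded_mfun (fun x => f (x, y)).
Proof.
case: bf => mf [M fM]; split; last by exists M => x.
exact: measurableT_comp.
Qed.

Let fin1 x : (\int[P2]_y (f (x, y))%:E)%E = (\int[P2]_y f (x, y))%:E.
Proof.
rewrite fineK//; apply: integrable_fin_num => //.
exact: bounded_mfun_integrable (bounded_mfun_section1 x).
Qed.

Let fin2 y : (\int[P1]_x (f (x, y))%:E)%E = (\int[P1]_x f (x, y))%:E.
Proof.
rewrite fineK//; apply: integrable_fin_num => //.
exact: bounded_mfun_integrable (bounded_mfun_section2 y).
Qed.

Lemma bounded_mfun_Rint1 : bounded_mfun (fun x => \int[P2]_y f (x, y)).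
Proof.
split; last first.
  have [mf [M fM]] := bf; exists M => x; apply: RintT_norm_le => //.
  exact: bounded_mfun_section1.
have := measurable_fubini_F intf; rewrite /fubini_F /=.
by under eq_fun do rewrite fin1; move=> /measurable_EFinP.
Qed.

Lemma bounded_mfun_Rint2 : bounded_mfun (fun y => \int[P1]_x f (x, y)).
Proof.
split; last first.
  have [mf [M fM]] := bf; exists M => x; apply: RintT_norm_le => //.
  exact: bounded_mfun_section2.
have := measurable_fubini_G intf; rewrite /fubini_G /=.
by under eq_fun do rewrite fin2; move=> /measurable_EFinP.
Qed.

Lemma Rint_prod : \int[(P1 \x P2)%E]_z f z = \int[P1]_x \int[P2]_y f (x, y).
Proof.
congr fine; rewrite -(integral12_prod_meas1 intf); apply: eq_integral => x _.
exact: fin1.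
Qed.

Lemma Rint_fubini :
  \int[P1]_x \int[P2]_y f (x, y) = \int[P2]_y \int[P1]_x f (x, y).
Proof.
rewrite -Rint_prod; congr fine; rewrite -(integral21_prod_meas1 intf).
by apply: eq_integral => x _; exact: fin2.
Qed.

End bounded_fubini.

(** * Gaussian integrals *)

Section normal_density_integral.
Context {R : realType}.
Implicit Types (m s : R) (f : R -> R).
Notation leb := (@lebesgue_measure R).

(** The density is recognised as a Radon-Nikodym derivative. The latter is determined only almost
    everywhere, and the two agree there because they have the same integral over every measurable
    set. *)
Lemma integral_normal_prob m s (f : R -> \bar R) :
  (normal_prob m s).-integrable setT f ->
  (\int[normal_prob m s]_x f x = \int[leb]_x (f x * (normal_pdf m s x)%:E))%E.
Proof.
move=> intf.
rewrite -(Radon_Nikodym_change_of_variables (normal_prob_dominates m s))//.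
have mf := measurable_int _ intf.
apply: ae_eq_integral => //.
- apply: emeasurable_funM => //; apply: (measurable_int leb).
  by apply: Radon_Nikodym_integrable; exact: normal_prob_dominates.
- apply: emeasurable_funM => //=; apply/measurable_EFinP.
  exact: measurable_normal_pdf.
- apply: ae_eqe_mul2l => /=.
  rewrite Radon_NikodymE//=; first exact: normal_prob_dominates.
  move=> abmu.
  case: cid => /= h [h1 h2 h3].
  apply: integral_ae_eq => //=.
  + by apply/measurable_EFinP; exact: measurable_normal_pdf.
  + by move=> E E01 mE; rewrite -h3.
Qed.

(** Truncating at n makes the integrand integrable, so the previous lemma applies; monotone
    convergence on both sides removes the truncation and allows infinite values. *)
Lemma ge0_integral_normal_prob m s f : measurable_fun setT f ->
  (forall x, 0 <= f x) ->
  (\int[normal_prob m s]_x (f x)%:E =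
   \int[leb]_x (f x * normal_pdf m s x)%:E)%E.
Proof.
move=> mf f0.
pose g (n : nat) (x : R) := (Num.min (f x) n%:R).
have mg n : measurable_fun setT (g n) by exact: measurable_minr.
have g0 n x : 0 <= g n x by rewrite le_min f0 ler0n.
have ndg x : {homo (fun n => g n x) : a b / (a <= b)%N >-> a <= b}.
  by move=> a b ab; rewrite /g le_min !ge_min lexx ler_nat ab orbT.
have cg x : g n x @[n --> \oo] --> f x.
  apply: cvg_near_cst; near=> n; rewrite /g; apply: min_idPl; near: n.
  exact: nbhs_infty_ger.
have bg n : bounded_mfun (g n).
  split=> //; exists n%:R => x; rewrite ger0_norm//.
  by rewrite /g ge_min lexx orbT.
transitivity (limn (fun n => \int[normal_prob m s]_x (g n x)%:E)%E).
  rewrite -monotone_convergence//; last 3 first.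
    by move=> n /=; apply/measurable_EFinP; exact: mg.
    by move=> n x _; rewrite lee_fin.
    by move=> x _ a b ab; rewrite lee_fin; exact: ndg.
  apply: eq_integral => x _; apply/esym/cvg_lim => //.
  by apply: cvg_EFin; [exact: nearW|exact: cg].
rewrite [X in limn X](_ : _ =
  (fun n => \int[leb]_x (g n x * normal_pdf m s x)%:E)%E).
  rewrite -monotone_convergence//; last 3 first.
    move=> n /=; apply/measurable_EFinP/measurable_funM; first exact: mg.
    exact: measurable_normal_pdf.
    by move=> n x _; rewrite lee_fin mulr_ge0 ?normal_pdf_ge0.
    by move=> x _ a b ab; rewrite lee_fin ler_wpM2r ?normal_pdf_ge0//; exact: ndg.
  apply: eq_integral => x _; apply/cvg_lim => //.
  apply: cvg_EFin; [exact: nearW|apply: cvgM; [exact: cg|exact: cvg_cst]].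
apply/funext => n; rewrite integral_normal_prob//.
exact: (@bounded_mfun_integrable _ _ _ (normal_prob m s) _ (bg n)).
Unshelve. all: by end_near. Qed.

Lemma ge0_integral_normal_affine (a c : R) f : 0 < c -> continuous f ->
  (forall x, 0 <= f x) ->
  (\int[normal_prob 0 1]_y (f (a + c * y))%:E =
   \int[leb]_u (f u * normal_pdf a c u)%:E)%E.
Proof.
move=> c0 cf f0.
have cN0 : c != 0 by rewrite gt_eqF.
pose F (y : R) := a + c * y.
have dF (y : R) : is_derive y 1 F c.
  by rewrite /F; apply: is_derive_eq; rewrite add0r ?scaler0 ?addr0 /GRing.scale /= ?mulr1 ?mulr0 ?addr0 mul1r.
have F'E : F^`()%classic = cst c by apply/funext => y; rewrite derive1E derive_val.
have cF : continuous F.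
  move=> y; apply: differentiable_continuous; apply/derivable1_diffP.
  exact: ex_derive.
have pdfE y : normal_pdf 0 1 y = normal_pdf a c (F y) * c.
  rewrite !normal_pdfE ?oner_eq0// /normal_peak /normal_fun [RHS]mulrAC; congr (_ * _).
    have -> : c ^+ 2 * pi *+ 2 = c ^+ 2 * (1 ^+ 2 * pi *+ 2) :> R.
      by rewrite expr1n mul1r mulrnAr.
    rewrite (@sqrtrM R (c ^+ 2)) ?sqr_ge0// sqrtr_sqr gtr0_norm//.
    by rewrite invfM [RHS]mulrAC mulVf// mul1r.
  have -> : c ^+ 2 *+ 2 = c ^+ 2 * (1 ^+ 2 *+ 2) by rewrite expr1n mulrnAr mulr1.
  rewrite /F addrAC subrr add0r subr0 exprMn !mulNr; congr (expR (- _)).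
  by rewrite invfM mulrACA mulfV ?expf_neq0// mul1r.
rewrite (@ge0_integral_normal_prob 0 1 (fun y => f (a + c * y))); last 2 first.
- by apply: continuous_measurable_fun => y; apply: (continuous_comp (cF y)); exact: cf.
- by move=> y; exact: f0.
rewrite [RHS](@increasing_ge0_integration_by_substitutionT _ F (fun u => f u * normal_pdf a c u)).
- apply: eq_integral => y _; congr EFin; rewrite F'E.
  by rewrite pdfE mulrA.
- by move=> x y xy; rewrite /F ltrD2l ltr_pM2l.
- by rewrite F'E => ?; exact: cvg_cst.
- by rewrite F'E; exact: is_cvg_cst.
- by rewrite F'E; exact: is_cvg_cst.
- by move=> x; exact: ex_derive.
- apply: (@cvg_comp _ _ _ (fun y => c * y) (fun r => a + r)); last exact: cvg_addrl_Ny.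
  by apply/gt0_cvgMrNy => //; exact: cvg_id.
- apply: (@cvg_comp _ _ _ (fun y => c * y) (fun r => a + r)); last exact: cvg_addrl.
  by apply/gt0_cvgMry => //; exact: cvg_id.
- move=> u; apply: cvgM; [exact: cf|exact: continuous_normal_pdf].
- by move=> u; rewrite mulr_ge0 ?normal_pdf_ge0.
Qed.

End normal_density_integral.

(** * Sums of independent centred Gaussians *)

Section gaussian_convolution.
Context {R : realType}.
Implicit Types (x y a b c u : R) (f : R -> R).
Notation leb := (@lebesgue_measure R).
Notation gam := (@normal_prob R 0 1).

Lemma normal_pdf_centerE a c u : c != 0 -> normal_pdf a c u = normal_pdf 0 c (u - a).
Proof. by move=> c0; rewrite !normal_pdfE// normal_fun_center /= /normal_fun !subr0. Qed.

(* Bayes: the joint density of (y, a y + b z) factors as the marginal times the conditional. *)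
Lemma normal_pdf_bayes a b c x y u : 0 < b -> 0 < c -> c ^+ 2 = a ^+ 2 + b ^+ 2 ->
  normal_pdf (x + a * y) b u * normal_pdf 0 1 y =
  normal_pdf x c u * normal_pdf (a * (u - x) / c ^+ 2) (b / c) y.
Proof.
move=> b0 c0 cE.
have bN : b != 0 by rewrite gt_eqF.
have cN : c != 0 by rewrite gt_eqF.
have bcN : b / c != 0 by rewrite mulf_neq0// invr_eq0.
rewrite !normal_pdfE ?oner_eq0//.
rewrite -!mulrA [normal_fun _ _ _ * _]mulrCA [in RHS](mulrCA (normal_fun _ _ _)) !mulrA -[in LHS]mulrA -[in RHS]mulrA.
congr (_ * _); last first.
  rewrite /normal_fun -!expRD; congr expR.
  rewrite !mulr2n.
  have eqc : a ^+ 2 = c ^+ 2 - b ^+ 2 by rewrite cE addrK.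
  apply/eqP; rewrite -subr_eq0; apply/eqP.
  (* The two exponents differ by a multiple of c^2 - a^2 - b^2, which is made explicit because
     [field] works without the relation between a, b and c. *)
  transitivity ((c ^+ 2 - b ^+ 2 - a ^+ 2) * ((y * c) ^+ 2 - (u - x) ^+ 2) / (2 * b ^+ 2 * c ^+ 2)).
    by field; rewrite cN bN -!mulr2n !mulrn_eq0 !sqrf_eq0 bN cN.
  by rewrite -eqc subrr !mul0r.
rewrite /normal_peak -!invfM; congr (_^-1).
rewrite -!sqrtrM ?mulrn_wge0// ?mulr_ge0 ?sqr_ge0 ?pi_ge0 ?ltW//.
congr (Num.sqrt _); rewrite !mulr2n; by field; rewrite ?cN.
Qed.

(** The inner integral is rewritten over the value u of the whole argument. After Tonelli, the Bayes
    factorisation leaves in y only a conditional density, which integrates to 1. Nonnegativity is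
    what Tonelli asks for; [gsmoothD] removes it by adding a constant. *)
Lemma gaussian_convolution_ge0 a b c f x : 0 < a -> 0 < b -> 0 < c ->
  c ^+ 2 = a ^+ 2 + b ^+ 2 -> continuous f -> bounded_mfun f ->
  (forall x, 0 <= f x) ->
  \int[gam]_y \int[gam]_z f (x + a * y + b * z) = \int[gam]_u f (x + c * u).
Proof.
move=> a0 b0 c0 cE cf bf f0.
have bN : b != 0 by rewrite gt_eqF.
have mf : measurable_fun setT f by case: bf.
have bf2 : bounded_mfun (fun yz : R * R => f (x + a * yz.1 + b * yz.2)).
  case: bf => _ [M fM]; split; last by exists M.
  apply: (measurableT_comp mf); apply: measurable_funD.
    apply: measurable_funD => //; apply: measurable_funM => //.
  by apply: measurable_funM.
have bh : bounded_mfun (fun y => \int[gam]_z f (x + a * y + b * z)).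
  exact: (@bounded_mfun_Rint1 _ _ _ _ _ gam gam _ bf2).
have mj : measurable_fun setT (fun yu : R * R =>
    (f yu.2 * normal_pdf (x + a * yu.1) b yu.2 * normal_pdf 0 1 yu.1)%:E).
  apply/measurable_EFinP; apply: measurable_funM; first apply: measurable_funM.
  - exact: measurableT_comp.
  - under eq_fun do rewrite normal_pdf_centerE//.
    apply: (measurableT_comp (@measurable_normal_pdf R 0 b)).
    apply: measurable_funB => //; apply: measurable_funD => //.
    exact: measurable_funM.
  - by apply: (measurableT_comp (@measurable_normal_pdf R 0 1)).
congr fine.
transitivity (\int[gam]_y (\int[gam]_z f (x + a * y + b * z))%:E)%E => //.
rewrite ge0_integral_normal_prob//; last 2 first.
- by case: bh.
- by move=> y; apply: RintT_ge0.
transitivity (\int[leb]_y \int[leb]_u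
    (f u * normal_pdf (x + a * y) b u * normal_pdf 0 1 y)%:E)%E.
  apply: eq_integral => y _.
  have bfy := bounded_mfun_section1 bf2 y.
  rewrite EFinM fineK; last first.
    by apply: integrable_fin_num => //; exact: (@bounded_mfun_integrable _ _ _ gam _ bfy).
  rewrite (@ge0_integral_normal_affine R (x + a * y) b f)//.
  under [RHS]eq_integral do rewrite EFinM.
  rewrite ge0_integralZr//.
  - apply/measurable_EFinP/measurable_funM => //.
    exact: measurable_normal_pdf.
  - by move=> u _; rewrite lee_fin mulr_ge0 ?normal_pdf_ge0.
  - by rewrite lee_fin normal_pdf_ge0.
rewrite (@fubini_tonelli _ _ _ _ _ leb leb _ mj); last first.
  by move=> yu; rewrite lee_fin !mulr_ge0 ?normal_pdf_ge0.
rewrite (@ge0_integral_normal_affine R x c f)//.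
apply: eq_integral => u _ /=.
under eq_integral do rewrite -mulrA (normal_pdf_bayes _ _ _ b0 c0 cE) mulrA EFinM.
rewrite ge0_integralZl ?integral_normal_pdf ?mule1//.
- by apply/measurable_EFinP; exact: measurable_normal_pdf.
- by move=> y _; rewrite lee_fin normal_pdf_ge0.
- by rewrite lee_fin mulr_ge0 ?normal_pdf_ge0.
Qed.

End gaussian_convolution.

Lemma integrable_EFinZ d (T : measurableType d) (R : realType)
    (mu : {measure set T -> \bar R}) (c : R) (f : T -> R) :
  mu.-integrable setT (EFin \o f) -> mu.-integrable setT (EFin \o (fun y => c * f y)).
Proof. by move=> fi; exact: (integrableZl measurableT c fi). Qed.

Lemma integrable_EFinD d (T : measurableType d) (R : realType)
    (mu : {measure set T -> \bar R}) (f g : T -> R) :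
  mu.-integrable setT (EFin \o f) -> mu.-integrable setT (EFin \o g) ->
  mu.-integrable setT (EFin \o (fun y => f y + g y)).
Proof. by move=> fi gi; exact: (integrableD measurableT fi gi). Qed.

Section gaussian_moments.
Context {R : realType}.
Implicit Types (t s y : R) (f : R -> R).
Notation leb := (@lebesgue_measure R).
Notation gam := (@normal_prob R 0 1).

Lemma gaussian_mgf t :
  (\int[gam]_y (expR (t * y))%:E = (expR (t ^+ 2 / 2))%:E)%E.
Proof.
rewrite (@ge0_integral_normal_prob R 0 1 (fun y => expR (t * y))); last 2 first.
- by apply: measurableT_comp => //; exact: measurable_funM.
- by move=> y; exact: expR_ge0.
transitivity (\int[leb]_y ((expR (t ^+ 2 / 2))%:E * (normal_pdf t 1 y)%:E))%E.
  apply: eq_integral => y _; rewrite -EFinM; congr EFin.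
  rewrite !normal_pdfE ?oner_eq0// /normal_fun [LHS]mulrCA [RHS]mulrCA; congr (_ * _).
  by rewrite -!expRD; congr expR; rewrite subr0 expr1n mulr2n; field.
rewrite ge0_integralZl ?integral_normal_pdf ?mule1//.
- by apply/measurable_EFinP; exact: measurable_normal_pdf.
- by move=> y _; rewrite lee_fin normal_pdf_ge0.
Qed.

(** The integrand times the standard density is s times the N(0, s^2) density. Taken at s = sqrt 2
    it gives integrability of polynomials, and near s = 1 it gives the variance. *)
Lemma gaussian_exp_sqr s : 0 < s ->
  (\int[gam]_y (expR ((1 - (s ^+ 2)^-1) / 2 * y ^+ 2))%:E = s%:E)%E.
Proof.
move=> s0; have sN : s != 0 by rewrite gt_eqF.
rewrite (@ge0_integral_normal_prob R 0 1
  (fun y => expR ((1 - (s ^+ 2)^-1) / 2 * y ^+ 2))); last 2 first.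
- apply: measurableT_comp => //; apply: measurable_funM => //.
- by move=> y; exact: expR_ge0.
transitivity (\int[leb]_y (s%:E * (normal_pdf 0 s y)%:E))%E.
  apply: eq_integral => y _; rewrite -EFinM; congr EFin.
  rewrite !normal_pdfE ?oner_eq0// /normal_fun [LHS]mulrCA [RHS]mulrA; congr (_ * _).
    rewrite /normal_peak; have -> : s ^+ 2 * pi *+ 2 = s ^+ 2 * (1 ^+ 2 * pi *+ 2) :> R.
      by rewrite expr1n mul1r mulrnAr.
    rewrite (@sqrtrM R (s ^+ 2)) ?sqr_ge0// sqrtr_sqr gtr0_norm//.
    by rewrite invfM mulrA mulfV// mul1r.
  rewrite -!expRD; congr expR; rewrite subr0 expr1n !mulr2n; field.
  by rewrite sN -mulr2n mulrn_eq0 sqrf_eq0 sN.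
rewrite ge0_integralZl ?integral_normal_pdf ?mule1//.
- by apply/measurable_EFinP; exact: measurable_normal_pdf.
- by move=> y _; rewrite lee_fin normal_pdf_ge0.
- by rewrite lee_fin ltW.
Qed.

Lemma gaussian_integrable_exp_sqr s : 0 < s ->
  gam.-integrable setT (EFin \o (fun y => expR ((1 - (s ^+ 2)^-1) / 2 * y ^+ 2))).
Proof.
move=> s0; apply/integrableP; split.
  apply/measurable_EFinP; apply: measurableT_comp => //; exact: measurable_funM.
under eq_integral do rewrite /= ger0_norm ?expR_ge0//.
by rewrite gaussian_exp_sqr// ltry.
Qed.

Lemma gaussian_integrable_poly f K : measurable_fun setT f ->
  (forall y, `|f y| <= K * (1 + y ^+ 4)) -> gam.-integrable setT (EFin \o f).
Proof.
move=> mf fK.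
have s0 : 0 < Num.sqrt 2 :> R by rewrite sqrtr_gt0.
have K0 : 0 <= K by have := fK 0; rewrite expr0n/= addr0 mulr1; apply: le_trans.
(* For s = sqrt 2 the exponent is y^2 / 4, and exp(y^2 / 4) is at least 1 + (y^2 / 4)^2 / 2 = 1 +
   y^4 / 32. *)
apply: (@le_integrable _ _ _ gam _ _ _ (EFin \o (fun y => K * 32 *
  expR ((1 - (Num.sqrt 2 ^+ 2)^-1) / 2 * y ^+ 2)))) => //.
- exact/measurable_EFinP.
- move=> y _; rewrite lee_fin (le_trans (fK y))// ger0_norm ?mulr_ge0 ?expR_ge0//.
  rewrite -mulrA ler_wpM2l// sqr_sqrtr//.
  have y4 : 0 <= y ^+ 4 by rewrite exprn_even_ge0.
  have y2 : 0 <= (1 - 2^-1) / 2 * y ^+ 2 :> R.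
    by rewrite mulr_ge0 ?sqr_ge0// divr_ge0// subr_ge0 invf_le1 ?ler1n.
  have := expR_ge1Dxn 1 y2; rewrite exprMn -exprM (_ : (1 + 1)`!%:R = 2 :> R)//=.
  have -> : ((1 - 2^-1) / 2) ^+ 2 * y ^+ (2 * 2) / 2 = y ^+ 4 / 32 :> R.
    by rewrite (_ : (2 * 2)%N = 4%N)//; field.
  lra.
- exact: (@integrable_EFinZ _ _ _ gam _ _ (gaussian_integrable_exp_sqr s0)).
Qed.

Lemma norm_expr_le4 y k : (k <= 4)%N -> `|y ^+ k| <= 1 * (1 + y ^+ 4).
Proof.
move=> k4; have -> : y ^+ 4 = `|y| ^+ 4.
  by rewrite -[4%N]/(2 * 2)%N !exprM real_normK ?num_real.
rewrite mul1r normrX; have := normr_ge0 y; set z := `|y| => z0.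
have [z1|z1] := leP z 1.
  by rewrite (le_trans (exprn_ile1 _ _ z1))// lerDl exprn_ge0.
by rewrite (le_trans (ler_weXn2l (ltW z1) k4))// lerDr.
Qed.

(** From 1 + t y <= exp(t y) the mean m satisfies 1 + t m <= exp(t^2 / 2) <= 1 + t^2 for |t| <= 1.
    Taking t = c m with c <= 1/2 small enough gives c m^2 <= c^2 m^2, hence m = 0. *)
Lemma gaussian_mean : \int[gam]_y y = 0 :> R.
Proof.
have iy : gam.-integrable setT (EFin \o (fun y : R => y)).
  by apply: (@gaussian_integrable_poly _ 1) => // y; exact: (@norm_expr_le4 y 1).
have ie t : gam.-integrable setT (EFin \o (fun y : R => expR (t * y))).
  apply/integrableP; split.
    by apply/measurable_EFinP; apply: measurableT_comp => //; exact: measurable_funM.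
  under eq_integral do rewrite /= ger0_norm ?expR_ge0//.
  by rewrite gaussian_mgf ltry.
set m := (X in X = _).
have H t : `|t| <= 1 -> t * m <= t ^+ 2.
  move=> t1.
  have t21 : t ^+ 2 <= 1 by rewrite -real_normK ?num_real// exprn_ile1.
  have : 1 + t * m <= expR (t ^+ 2 / 2).
    rewrite -(RintegralZl _ _ iy)//= -[X in X + _](RintT_cst gam).
    have -> : expR (t ^+ 2 / 2) = \int[gam]_y expR (t * y).
      by rewrite /Rintegral gaussian_mgf.
    have ity : gam.-integrable setT (EFin \o (fun y : R => t * y)).
      exact: integrable_EFinZ.
    have i1 : gam.-integrable setT (EFin \o (fun y : R => 1 : R)).
      exact: (@finite_measure_integrable_cst _ _ _ gam).
    rewrite -RintegralD//; apply: le_Rintegral => //.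
      exact: integrable_EFinD.
    by move=> y _; exact: expR_ge1Dx.
  have : expR (t ^+ 2 / 2) <= 1 + t ^+ 2.
    have := expR_ge1Dx (- (t ^+ 2 / 2)); rewrite expRN => eN.
    have e0 := expR_gt0 (t ^+ 2 / 2).
    have : expR (t ^+ 2 / 2) * (1 - t ^+ 2 / 2) <= 1.
      by rewrite -ler_pdivlMl ?mulr1.
    have t20 : 0 <= t ^+ 2 by exact: sqr_ge0.
    nra.
  lra.
pose c := (2 * (1 + `|m|))^-1.
have d0 : 0 < 2 * (1 + `|m|) by rewrite mulr_gt0// ltr_pwDl.
have c0 : 0 < c by rewrite invr_gt0.
have c1 : c <= 1 / 2.
  by rewrite /c mul1r lef_pV2 ?posrE// ler_peMr// lerDl.
have t1 : `|c * m| <= 1.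
  rewrite normrM gtr0_norm// /c mulrC ler_pdivrMr// mul1r.
  by have := normr_ge0 m; lra.
have := H _ t1; have := sqr_ge0 m; rewrite exprMn -mulrA -expr2 => m0 Hc.
apply/eqP; rewrite -sqrf_eq0 eq_le m0 andbT; nra.
Qed.

(** The tangent inequality 1 + z <= exp z, integrated in [gaussian_exp_sqr], bounds the second
    moment m from above when s = 1 + e and from below when s = 1 - e. After division by e both
    bounds tend to 1, and a concrete small e contradicts m > 1 or m < 1. *)
Lemma gaussian_var : \int[gam]_y y ^+ 2 = 1 :> R.
Proof.
have iy : gam.-integrable setT (EFin \o (fun y : R => y ^+ 2)).
  by apply: (@gaussian_integrable_poly _ 1) => // y; exact: norm_expr_le4.
have iZ c : gam.-integrable setT (EFin \o (fun y : R => c * y ^+ 2)).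
  exact: integrable_EFinZ.
have i1 : gam.-integrable setT (EFin \o (fun y : R => 1 : R)).
  exact: (@finite_measure_integrable_cst _ _ _ gam).
set m := (X in X = _).
have m0 : 0 <= m by apply: RintT_ge0 => y; exact: sqr_ge0.
have H s : 0 < s -> 1 + (1 - (s ^+ 2)^-1) / 2 * m <= s.
  move=> s0; rewrite -(RintegralZl _ _ iy)//= -[X in X + _](RintT_cst gam).
  rewrite [leRHS](_ : _ = \int[gam]_y expR ((1 - (s ^+ 2)^-1) / 2 * y ^+ 2)); last first.
    by rewrite /Rintegral gaussian_exp_sqr.
  rewrite -RintegralD//; apply: le_Rintegral => //.
  - exact: integrable_EFinD.
  - exact: gaussian_integrable_exp_sqr.
  - by move=> y _; exact: expR_ge1Dx.
have H2 s : 0 < s -> (s ^+ 2 - 1) * m <= 2 * s ^+ 2 * (s - 1).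
  move=> s0; have s20 : 0 < s ^+ 2 by rewrite exprn_gt0.
  have := H s s0; rewrite -lerBrDl -(ler_pM2l (mulr_gt0 (ltr0n _ 2) s20)) => Hs.
  rewrite (le_trans _ Hs)// le_eqVlt; apply/orP; left; apply/eqP; field.
  by rewrite gt_eqF.
have Hup e : 0 < e -> (2 + e) * m <= 2 * (1 + e) ^+ 2.
  move=> e0; rewrite -(ler_pM2l e0); have e1 : 0 < 1 + e by rewrite addr_gt0.
  by have := H2 _ e1; nra.
have Hlo e : 0 < e -> e < 1 -> 2 * (1 - e) ^+ 2 <= (2 - e) * m.
  move=> e0 e1; rewrite -(ler_pM2l e0); have e2 : 0 < 1 - e by rewrite subr_gt0.
  by have := H2 _ e2; nra.
apply/eqP; rewrite eq_le; apply/andP; split; rewrite leNgt; apply/negP => m1.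
- pose e := Num.min 1 ((m - 1) / 4).
  have e0 : 0 < e by rewrite lt_min ltr01 divr_gt0// subr_gt0.
  have e1 : e <= 1 by rewrite ge_min lexx.
  have e2 : e <= (m - 1) / 4 by rewrite ge_min lexx orbT.
  have := Hup e e0; nra.
- pose e := Num.min (1 / 2) ((1 - m) / 4).
  have e0 : 0 < e by rewrite lt_min !divr_gt0// subr_gt0.
  have e1 : e <= 1 / 2 by rewrite ge_min lexx.
  have e2 : e <= (1 - m) / 4 by rewrite ge_min lexx orbT.
  have e3 : e < 1 by lra.
  have := Hlo e e0 e3; nra.
Qed.

Lemma gaussian_integrable_cube : gam.-integrable setT (EFin \o (fun y : R => `|y| ^+ 3)).
Proof.
apply: (@gaussian_integrable_poly _ 1) => [|y]; first exact: measurable_funX.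
by rewrite -normrX normr_id; exact: norm_expr_le4.
Qed.

End gaussian_moments.

(** * Lindeberg replacement *)

Definition lip_bounded {R : realType} (f : R -> R) : Prop :=
  (exists M, forall x, `|f x| <= M) /\
  (exists2 L, 0 <= L & forall x y, `|f x - f y| <= L * `|x - y|).

(* [gsmooth v f x] is E f(x + sqrt v N) with N standard normal. *)
Definition gsmooth {R : realType} (v : R) (f : R -> R) (x : R) : R :=
  \int[@normal_prob R 0 1]_y f (x + Num.sqrt v * y).

(** A second-order expansion with cubic remainder at every point, stated without derivatives: this
    suits piecewise cubic splines, whose second derivative is only Lipschitz. *)
Definition taylor3 {R : realType} (K : R) (f : R -> R) : Prop :=
  forall x, exists a b, forall y,
    `|f (x + y) - (f x + a * y + b * y ^+ 2)| <= K * `|y| ^+ 3.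

Section lip_bounded_theory.
Context {R : realType}.
Implicit Types (f g : R -> R).
Notation gam := (@normal_prob R 0 1).

Lemma lip_bounded_continuous f : lip_bounded f -> continuous f.
Proof.
move=> [_ [L L0 fL]] x; apply/cvgrPdist_le => e e0.
have L1 : 0 < L + 1 by rewrite ltr_wpDl.
near=> y.
rewrite (le_trans (fL x y))//.
have : `|x - y| <= e / (L + 1).
  near: y; apply: cvgr_dist_le; first exact: cvg_id.
  exact: divr_gt0.
rewrite ler_pdivlMr// mulrDr mulr1 mulrC.
by have := normr_ge0 (x - y); lra.
Unshelve. all: by end_near. Qed.

Lemma lip_bounded_mfun f : lip_bounded f -> bounded_mfun f.
Proof.
move=> lf; split; last by case: lf.
by apply: continuous_measurable_fun; exact: lip_bounded_continuous.
Qed.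

Lemma lip_bounded_comp d (T : measurableType d) f (X : T -> R) :
  lip_bounded f -> measurable_fun setT X -> bounded_mfun (fun w => f (X w)).
Proof.
move=> lf mX; have [mf [M fM]] := lip_bounded_mfun lf.
by split; [exact: measurableT_comp | exists M].
Qed.

Lemma lip_bounded_expectation d (T : measurableType d) (P : probability T R)
    f (X : T -> R) : lip_bounded f -> measurable_fun setT X ->
  lip_bounded (fun s => \int[P]_w f (s + X w)).
Proof.
move=> lf mX; have bfX s : bounded_mfun (fun w => f (s + X w)).
  by apply: lip_bounded_comp => //; exact: measurable_funD.
have [[M fM] [L L0 fL]] := lf; split.
  by exists M => x; apply: RintT_norm_le.
exists L => // x y; apply: RintT_dist_cst => // w.
by rewrite (le_trans (fL _ _))// opprD addrACA subrr addr0.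
Qed.

Lemma gsmooth_arg_mfun (c : R) : measurable_fun setT (fun y : R => c * y).
Proof. exact: measurable_funM. Qed.

Lemma lip_bounded_gsmooth v f : lip_bounded f -> lip_bounded (gsmooth v f).
Proof.
move=> lf; apply: (@lip_bounded_expectation _ _ gam f (fun y => Num.sqrt v * y) lf).
exact: gsmooth_arg_mfun.
Qed.

Lemma gsmooth0 f x : gsmooth 0 f x = f x.
Proof.
rewrite /gsmooth sqrtr0; under eq_Rintegral do rewrite mul0r addr0.
exact: (RintT_cst gam).
Qed.

Lemma gsmoothD v w f x : lip_bounded f -> 0 <= v -> 0 <= w ->
  gsmooth v (gsmooth w f) x = gsmooth (v + w) f x.
Proof.
move=> lf; rewrite le_eqVlt => /predU1P[<- _|v0].
  by rewrite gsmooth0 add0r.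
rewrite le_eqVlt => /predU1P[<-|w0].
  by rewrite addr0; congr (Rintegral _ _ _); apply/funext => y; rewrite gsmooth0.
have [[M fM] [L L0 fL]] := lf.
(* Adding the bound M makes the function nonnegative and shifts both sides of the identity by the
   same constant. *)
pose g y := f y + M.
have g0 y : 0 <= g y.
  by rewrite /g -lerBlDr sub0r; have := fM y; rewrite ler_norml => /andP[].
have lg : lip_bounded g.
  split; first by exists (M + M) => y; rewrite (le_trans (ler_normD _ _))// lerD// ger0_norm// (le_trans _ (fM 0)).
  by exists L => // y z; rewrite /g opprD addrACA subrr addr0.
have sg u y : gsmooth u g y = gsmooth u f y + M.
  rewrite /gsmooth (@RintTD _ _ _ gam).
  - by rewrite (RintT_cst gam).
  - by apply: lip_bounded_comp => //; apply: measurable_funD => //; exact: gsmooth_arg_mfun.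
  - exact: bounded_mfun_cst.
suff : gsmooth v (gsmooth w g) x = gsmooth (v + w) g x.
  rewrite sg (_ : gsmooth v (gsmooth w g) x = gsmooth v (gsmooth w f) x + M).
    by move/addIr.
  rewrite [LHS](_ : _ = \int[gam]_y (gsmooth w f (x + Num.sqrt v * y) + M)).
    rewrite (@RintTD _ _ _ gam).
    - by rewrite (RintT_cst gam).
    - apply: lip_bounded_comp; first exact: lip_bounded_gsmooth.
      by apply: measurable_funD => //; exact: gsmooth_arg_mfun.
    - exact: bounded_mfun_cst.
  by congr (Rintegral _ _ _); apply/funext => y; rewrite sg.
apply: gaussian_convolution_ge0 => //; rewrite ?sqrtr_gt0 ?addr_gt0//.
- by rewrite !sqr_sqrtr// ltW// addr_gt0.
- exact: lip_bounded_continuous.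
- exact: lip_bounded_mfun.
Qed.

Lemma bounded_mfun_gaussian f : bounded_mfun f -> gam.-integrable setT (EFin \o f).
Proof. exact: (@bounded_mfun_integrable _ _ _ gam). Qed.

(** Both sides use the same normal variable Y, so the difference is at most L |sqrt v - sqrt w|
    E|Y|; and E|Y| <= 1 because |y| <= (1 + y^2) / 2. *)
Lemma gsmooth_dist f L v w x : lip_bounded f ->
  (forall x y, `|f x - f y| <= L * `|x - y|) -> 0 <= L ->
  `|gsmooth v f x - gsmooth w f x| <= L * `|Num.sqrt v - Num.sqrt w| .
Proof.
move=> lf fL L0.
have iy c : gam.-integrable setT (EFin \o (fun y : R => c * `|y|)).
  apply: integrable_EFinZ; apply: (@gaussian_integrable_poly _ _ 1) => // y.
  by rewrite normr_id; exact: (@norm_expr_le4 _ y 1).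
have bf (c : R) : bounded_mfun (fun y : R => f (x + c * y)).
  by apply: lip_bounded_comp => //; apply: measurable_funD => //; exact: gsmooth_arg_mfun.
rewrite /gsmooth -(@RintTB _ _ _ gam); [|exact: bf|exact: bf].
rewrite (le_trans (le_normr_Rintegral _ _))//.
  by apply: bounded_mfun_gaussian; exact: bounded_mfunB.
apply: (@le_trans _ _ (\int[gam]_y (L * `|Num.sqrt v - Num.sqrt w| * `|y|))).
  apply: le_Rintegral => //.
    by apply: bounded_mfun_gaussian; apply: bounded_mfun_norm; exact: bounded_mfunB.
  move=> y _; rewrite (le_trans (fL _ _))// -mulrA ler_wpM2l//.
  by rewrite opprD addrACA subrr add0r -mulrBl normrM.
rewrite (@RintegralZl _ _ _ gam)//; last by have := iy 1; under eq_fun do rewrite mul1r.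
rewrite -[leRHS]mulr1 ler_wpM2l ?mulr_ge0//.
have i1 : gam.-integrable setT (EFin \o (fun y : R => `|y|)).
  by have := iy 1; under eq_fun do rewrite mul1r.
have q (y : R) : `|2^-1 + 2^-1 * y ^+ 2| <= 1 * (1 + y ^+ 4).
  have y4 : 0 <= y ^+ 4 by rewrite exprn_even_ge0.
  have y2 := sqr_ge0 y.
  have := @norm_expr_le4 _ y 2 isT; rewrite ger0_norm// mul1r => y24.
  by rewrite ger0_norm; lra.
have i2 : gam.-integrable setT (EFin \o (fun y : R => 2^-1 + 2^-1 * y ^+ 2)).
  apply: (@gaussian_integrable_poly _ _ 1) => //.
  by apply: measurable_funD => //; apply: measurable_funM => //.
have iq : gam.-integrable setT (EFin \o (fun y : R => y ^+ 2)).
  by apply: (@gaussian_integrable_poly _ _ 1) => // y; exact: norm_expr_le4.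
rewrite [leRHS](_ : _ = \int[gam]_y (2^-1 + 2^-1 * y ^+ 2)); last first.
  rewrite (@RintegralD _ _ _ gam)//.
  - by rewrite (RintT_cst gam) (@RintegralZl _ _ _ gam)// gaussian_var; field.
  - exact: (@finite_measure_integrable_cst _ _ _ gam).
  - exact: integrable_EFinZ.
apply: le_Rintegral => // y _.
have := sqr_ge0 (`|y| - 1); rewrite sqrrB real_normK ?num_real// expr1n mulr1 mulr2n; lra.
Qed.

End lip_bounded_theory.

Section lindeberg.
Context d (T : measurableType d) (R : realType) (P : probability T R).
Implicit Types (f : R -> R) (X : T -> R).
Notation gam := (@normal_prob R 0 1).

Lemma Rint_dist_le d' (T' : measurableType d') (mu : {measure set T' -> \bar R})
    (f g h : T' -> R) :
  mu.-integrable setT (EFin \o f) -> mu.-integrable setT (EFin \o g) ->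
  mu.-integrable setT (EFin \o h) -> (forall x, `|f x - g x| <= h x) ->
  `|\int[mu]_x f x - \int[mu]_x g x| <= \int[mu]_x h x.
Proof.
move=> fi gi hi fgh; rewrite -RintegralB//.
have fg : mu.-integrable setT (EFin \o (fun x => f x - g x)).
  exact: (integrableB measurableT fi gi).
rewrite (le_trans (le_normr_Rintegral _ fg))//; apply: le_Rintegral => //.
exact: (integrable_abse fg).
Qed.

Definition gaussian_abs3 : R := \int[gam]_y (`|y| ^+ 3).

Lemma gaussian_abs3_ge0 : 0 <= gaussian_abs3.
Proof. by apply: RintT_ge0 => y; rewrite exprn_ge0. Qed.

(** X and the Gaussian share mean and variance, so the quadratic parts of the two expansions cancel
    and only cubic remainders stay. Each is controlled by B^3, since v <= B^2. *)
Lemma taylor3_expectation K f X (v B s : R) : lip_bounded f -> taylor3 K f -> 0 <= K ->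
  measurable_fun setT X -> (forall w, `|X w| <= B) ->
  \int[P]_w X w = 0 -> \int[P]_w (X w ^+ 2) = v ->
  `|\int[P]_w f (s + X w) - gsmooth v f s| <= K * (1 + gaussian_abs3) * B ^+ 3.
Proof.
move=> lf /(_ s)[a [b fab]] K0 mX XB EX EX2.
have bX : bounded_mfun X by split => //; exists B.
have bX2 : bounded_mfun (fun w => X w ^+ 2) by exact: bounded_mfunM.
have B0 : 0 <= B by rewrite (le_trans _ (XB point)).
have v0 : 0 <= v by rewrite -EX2; apply: RintT_ge0 => w; exact: sqr_ge0.
have vB : v <= B ^+ 2.
  rewrite -EX2 -[leRHS](RintT_cst P); apply: le_RintT => //.
    exact: bounded_mfun_cst.
  by move=> w; rewrite -real_normK ?num_real// ler_sqr ?nnegrE.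
have svB : Num.sqrt v <= B by rewrite -(ger0_norm B0) -sqrtr_sqr ler_wsqrtr.
have H1 : `|\int[P]_w f (s + X w) - (f s + b * v)| <= K * B ^+ 3.
  rewrite (_ : f s + b * v = \int[P]_w (f s + a * X w + b * X w ^+ 2)); last first.
    rewrite !RintTD ?RintT_cst ?RintTZ ?EX ?EX2 ?mulr0 ?addr0//.
    - exact: bounded_mfun_cst.
    - exact: bounded_mfunZ.
    - by apply: bounded_mfunD; [exact: bounded_mfun_cst|exact: bounded_mfunZ].
    - exact: bounded_mfunZ.
  apply: RintT_dist_cst.
  - by apply: lip_bounded_comp => //; exact: measurable_funD.
  - apply: bounded_mfunD; last exact: bounded_mfunZ.
    by apply: bounded_mfunD; [exact: bounded_mfun_cst|exact: bounded_mfunZ].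
  - by move=> w; rewrite (le_trans (fab _))// ler_wpM2l// lerXn2r ?nnegrE.
have H2 : `|gsmooth v f s - (f s + b * v)| <= K * gaussian_abs3 * B ^+ 3.
  pose c := Num.sqrt v.
  have i1 : gam.-integrable setT (EFin \o (fun y : R => y)).
    by apply: (@gaussian_integrable_poly _ _ 1) => // y; exact: (@norm_expr_le4 _ y 1).
  have i2 : gam.-integrable setT (EFin \o (fun y : R => y ^+ 2)).
    by apply: (@gaussian_integrable_poly _ _ 1) => // y; exact: norm_expr_le4.
  have ic : gam.-integrable setT (EFin \o (fun y : R => f s)).
    exact: (@finite_measure_integrable_cst _ _ _ gam).
  have i12 : gam.-integrable setT (EFin \o (fun y : R => f s + a * c * y)).
    by apply: (integrable_EFinD ic); exact: integrable_EFinZ.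
  have i3 : gam.-integrable setT (EFin \o (fun y : R => b * v * y ^+ 2)).
    exact: integrable_EFinZ.
  rewrite (_ : f s + b * v = \int[gam]_y (f s + a * c * y + b * v * y ^+ 2)); last first.
    rewrite (@RintegralD _ _ _ gam)// (@RintegralD _ _ _ gam)//; last exact: integrable_EFinZ.
    rewrite (RintT_cst gam) !(@RintegralZl _ _ _ gam)// gaussian_var.
    by rewrite gaussian_mean mulr0 addr0 mulr1.
  apply: (@le_trans _ _ (\int[gam]_y (K * c ^+ 3 * `|y| ^+ 3))).
    apply: Rint_dist_le.
    - apply: (@bounded_mfun_integrable _ _ _ gam); apply: lip_bounded_comp => //.
      by apply: measurable_funD => //; exact: gsmooth_arg_mfun.
    - exact: integrable_EFinD.
    - apply: integrable_EFinZ; exact: gaussian_integrable_cube.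
    - move=> y; rewrite -/c; have := fab (c * y).
      by rewrite normrM (ger0_norm (sqrtr_ge0 v)) !exprMn sqr_sqrtr// !mulrA.
  rewrite (@RintegralZl _ _ _ gam)//; last exact: gaussian_integrable_cube.
  rewrite -/gaussian_abs3 mulrAC ler_wpM2l ?mulr_ge0 ?gaussian_abs3_ge0//.
  by rewrite lerXn2r ?nnegrE ?sqrtr_ge0.
rewrite mulrDr mulr1 mulrDl (le_trans _ (lerD H1 H2))//.
by rewrite [X in _ <= _ + X]distrC; exact: ler_distD.
Qed.

(* The class of test functions for which one summand can be replaced by a Gaussian
   of variance [v] at cost [delta]; it is stable under Gaussian smoothing. *)
Definition swap_class X (v delta : R) f :=
  forall s, `|\int[P]_w f (s + X w) - gsmooth v f s| <= delta.

(** Smoothing averages f over translates, and the swap cost is uniform in the translation s. Fubini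
    and the semigroup law [gsmoothD] then give the same cost for the smoothed function. *)
Lemma swap_class_gsmooth X v delta u f : lip_bounded f -> measurable_fun setT X ->
  0 <= u -> 0 <= v ->
  swap_class X v delta f -> swap_class X v delta (gsmooth u f).
Proof.
move=> lf mX u0 v0 Hf s; rewrite gsmoothD// (addrC v) -gsmoothD//.
have bf2 : bounded_mfun (fun wy : T * R => f (s + X wy.1 + Num.sqrt u * wy.2)).
  apply: lip_bounded_comp => //; apply: measurable_funD; last exact: measurable_funM.
  by apply: measurable_funD => //; exact: measurableT_comp.
have -> : gsmooth u (gsmooth v f) s =
  \int[gam]_y gsmooth v f (s + Num.sqrt u * y) by [].
rewrite [X in `|X - _|](_ : _ = \int[gam]_y \int[P]_w f (s + X w + Num.sqrt u * y));
  last exact: (@Rint_fubini _ _ _ _ _ P gam _ bf2).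
apply: (@RintT_dist_cst _ _ _ gam).
- exact: (@bounded_mfun_Rint2 _ _ _ _ _ P gam _ bf2).
- apply: lip_bounded_comp; first exact: lip_bounded_gsmooth.
  by apply: measurable_funD => //; exact: gsmooth_arg_mfun.
- move=> y; have := Hf (s + Num.sqrt u * y).
  by under eq_Rintegral do rewrite addrAC.
Qed.

Lemma lindeberg (X : nat -> T -> R) (v delta : R) (N : nat) f : 0 <= v ->
  (forall i, bounded_mfun (X i)) ->
  (forall i g, (i < N)%N -> lip_bounded g ->
     \int[P]_w g (\sum_(j < i) X j w + X i w) =
     \int[P]_w \int[P]_w' g (\sum_(j < i) X j w + X i w')) ->
  lip_bounded f -> (forall i, (i < N)%N -> swap_class (X i) v delta f) ->
  `|\int[P]_w f (\sum_(j < N) X j w) - gsmooth (N%:R * v) f 0| <= N%:R * delta.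
Proof.
move=> v0 bX indep.
have mX i : measurable_fun setT (X i) by case: (bX i).
have mS i : measurable_fun setT (fun w => \sum_(j < i) X j w).
  by apply: measurable_sum => j.
(* The test function must vary in the induction: replacing the last summand by a Gaussian turns g
   into [gsmooth v g], which is then tested against the remaining sum at the same cost per swap. *)
suff H n g : (n <= N)%N -> lip_bounded g ->
    (forall i, (i < N)%N -> swap_class (X i) v delta g) ->
    `|\int[P]_w g (\sum_(j < n) X j w) - gsmooth (n%:R * v) g 0| <= n%:R * delta.
  by move=> lf Hf; exact: H.
elim: n g => [g _ lg _|n IH {}f nN lf Hf].
  rewrite !mul0r gsmooth0; under eq_Rintegral do rewrite big_ord0.
  by rewrite RintT_cst subrr normr0.
have lg : lip_bounded (gsmooth v f) by exact: lip_bounded_gsmooth.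
have := IH _ (ltnW nN) lg; have nN' : (n < N)%N := nN.
move=> /(_ (fun i iN => swap_class_gsmooth lf (mX i) v0 v0 (Hf i iN))) IHn.
rewrite -natr1 mulrDl mul1r mulrDl mul1r.
rewrite -gsmoothD ?mulr_ge0// in IHn *.
under eq_Rintegral do rewrite big_ord_recr /=.
rewrite indep//.
apply: le_trans (ler_distD (\int[P]_w gsmooth v f (\sum_(j < n) X j w)) _ _) _.
rewrite addrC lerD//.
apply: RintT_dist_cst.
- apply: (@lip_bounded_comp _ _ _ (fun s => \int[P]_w f (s + X n w))) => //.
  exact: lip_bounded_expectation.
- exact: lip_bounded_comp.
- by move=> w; exact: Hf.
Qed.

End lindeberg.

(** * Discrete random variables and i.i.d. labels *)

Definition fibers_measurable d (T : measurableType d) (I : Type) (X : T -> I) :=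
  forall i, measurable [set w | X w = i].

(** Factoring through a countable type makes every preimage measurable without a sigma-algebra on U.
    This allows U to be a type of sequences or of whole paths [nat -> R]. *)
Definition discrete_rv d (T : measurableType d) (U : Type) (F : T -> U) : Prop :=
  exists (I : countType) (X : T -> I) (h : I -> U),
    fibers_measurable X /\ forall w, F w = h (X w).

Section discrete_rv_theory.
Context d (T : measurableType d).

Lemma fibers_measurable_preimage (I : countType) (X : T -> I) (A : set I) :
  fibers_measurable X -> measurable (X @^-1` A).
Proof.
move=> mX; rewrite (_ : _ @^-1` _ = \bigcup_(i in A) [set w | X w = i]); last first.
  by apply/seteqP; split => [w Aw|w [i Ai /= Xi]]; [exists (X w)|rewrite /= Xi].
rewrite bigcup_mkcond; apply: countable_bigcupT_measurable; first exact: countableP.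
by move=> i; case: ifP => _; [exact: mX|exact: measurable0].
Qed.

Lemma discrete_rv_preimage (U : Type) (F : T -> U) (A : set U) :
  discrete_rv F -> measurable (F @^-1` A).
Proof.
move=> [I [X [h [mX Fh]]]].
rewrite (_ : _ @^-1` _ = X @^-1` (h @^-1` A)); first exact: fibers_measurable_preimage.
by apply/seteqP; split => w /=; rewrite Fh.
Qed.

Lemma discrete_rv_bool (b : T -> bool) : discrete_rv b -> measurable [set w | b w].
Proof. by move=> db; exact: (discrete_rv_preimage [set x : bool | x] db). Qed.

Lemma discrete_rv_mfun (R : realType) (F : T -> R) :
  discrete_rv F -> measurable_fun setT F.
Proof. by move=> dF _ A _; rewrite setTI; exact: discrete_rv_preimage. Qed.

Lemma discrete_rv_fibers (I : countType) (X : T -> I) :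
  fibers_measurable X -> discrete_rv X.
Proof. by move=> mX; exists I, X, id. Qed.

Lemma discrete_rv_measurable_set (A : T -> bool) :
  measurable [set w | A w] -> discrete_rv A.
Proof.
move=> mA; apply: discrete_rv_fibers => -[].
  by [].
by rewrite (_ : mkset _ = ~` [set w | A w]); [exact: measurableC|apply/seteqP; split => w /=; [move=> ->|move/negP/negbTE]].
Qed.

Lemma discrete_rv_cst (U : Type) (c : U) : discrete_rv (fun _ : T => c).
Proof.
exists unit, (fun=> tt), (fun=> c); split => // -[].
by rewrite (_ : mkset _ = setT)//; apply/seteqP.
Qed.

Lemma discrete_rv_comp (U V : Type) (g : U -> V) (F : T -> U) :
  discrete_rv F -> discrete_rv (fun w => g (F w)).
Proof.
move=> [I [X [h [mX Fh]]]]; exists I, X, (fun i => g (h i)); split => // w.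
by rewrite Fh.
Qed.

Lemma discrete_rv_comp2 (U V W : Type) (g : U -> V -> W) (F : T -> U) (G : T -> V) :
  discrete_rv F -> discrete_rv G -> discrete_rv (fun w => g (F w) (G w)).
Proof.
move=> [I [X [h [mX Fh]]]] [J [Y [k [mY Gk]]]].
exists (I * J)%type, (fun w => (X w, Y w)), (fun ij => g (h ij.1) (k ij.2)); split.
  move=> [i j]; rewrite (_ : mkset _ = [set w | X w = i] `&` [set w | Y w = j]).
    exact: measurableI.
  by apply/seteqP; split => w /= [-> ->].
by move=> w; rewrite Fh Gk.
Qed.

Lemma discrete_rv_seq (U : Type) (F : nat -> T -> U) (n : nat) :
  (forall i, (i < n)%N -> discrete_rv (F i)) -> discrete_rv (fun w => [seq F i w | i <- iota 0 n]).
Proof.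
elim: n => [_|n IH dF]; first exact: discrete_rv_cst.
under eq_fun do rewrite -addn1 iotaD map_cat /=.
apply: (discrete_rv_comp2 (fun s x => s ++ [:: x])); last exact: dF.
by apply: IH => i iN; apply: dF; rewrite ltnS ltnW.
Qed.

Lemma discrete_rv_bigop (U : Type) (idx : U) (op : U -> U -> U) (F : nat -> T -> U) (n : nat) :
  (forall i, (i < n)%N -> discrete_rv (F i)) ->
  discrete_rv (fun w => \big[op/idx]_(i < n) F i w).
Proof.
move=> dF; under eq_fun do rewrite -(big_mkord xpredT (fun i => F i _)) -[X in \big[_/_]_(_ <- X | _) _]/(iota 0 (n - 0)) subn0 -(big_map (fun i => F i _) xpredT id).
apply: (discrete_rv_comp (fun s : seq U => \big[op/idx]_(i <- s) i)).
exact: discrete_rv_seq.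
Qed.

End discrete_rv_theory.

Section discrete_laws.
Context (R : realType).

Lemma probability_total d (T : measurableType d) (P : probability T R)
    (I : countType) (X : T -> I) (B : set T) : fibers_measurable X -> measurable B ->
  (P B = \sum_(0 <= n <oo) P (B `&` [set w | pickle (X w) = n]))%E.
Proof.
move=> mX mB.
have mpX n : measurable [set w | pickle (X w) = n].
  exact: (fibers_measurable_preimage [set i | pickle i = n] mX).
rewrite -measure_semi_bigcup.
- congr (P _); rewrite -setI_bigcupr (_ : \bigcup_i _ = setT) ?setIT//.
  by apply/seteqP; split => // w _; exists (pickle (X w)).
- by move=> i; exact: measurableI.
- by apply/trivIsetP => i j _ _ ij; apply/seteqP; split => // w [[_ /= E1] [_ /= E2]]; rewrite -E1 -E2 eqxx in ij.
- by apply: bigcup_measurable => i _; exact: measurableI.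
Qed.

(** The scalars allow laws to be compared up to proportionality; normalising constants are then
    recovered from the total mass, with no series to evaluate. *)
Lemma probability_total_eq d1 d2 (T1 : measurableType d1) (T2 : measurableType d2)
   (P1 : probability T1 R) (P2 : probability T2 R) (I : countType)
   (X1 : T1 -> I) (X2 : T2 -> I) (B1 : set T1) (B2 : set T2) (c1 c2 : R) :
  fibers_measurable X1 -> fibers_measurable X2 -> measurable B1 -> measurable B2 ->
  (forall i, c1%:E * P1 (B1 `&` [set w | X1 w = i]) = c2%:E * P2 (B2 `&` [set w | X2 w = i]))%E ->
  (c1%:E * P1 B1 = c2%:E * P2 B2)%E.
Proof.
move=> mX1 mX2 mB1 mB2 H.
rewrite (probability_total P1 mX1 mB1) (probability_total P2 mX2 mB2).
rewrite -!nneseriesZl//.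
apply: eq_eseriesr => n _.
have [[i <-]|nn] := pselect (exists i : I, pickle i = n).
  have E e (T : measurableType e) (X : T -> I) : [set w | pickle (X w) = pickle i] = [set w | X w = i].
    by apply/seteqP; split => w /= [] => [|->//]; exact: (pcan_inj pickleK).
  by rewrite !E H.
have E e (T : measurableType e) (X : T -> I) : [set w | pickle (X w) = n] = set0.
  by apply/seteqP; split => w //= Xn; case: nn; exists (X w).
by rewrite !E !setI0 !measure0 !mule0.
Qed.

Lemma discrete_law_expectation d1 d2 (T1 : measurableType d1) (T2 : measurableType d2)
   (P1 : probability T1 R) (P2 : probability T2 R) (I : countType)
   (X1 : T1 -> I) (X2 : T2 -> I) (h : I -> R) (M : R) :
  fibers_measurable X1 -> fibers_measurable X2 ->
  (forall i, P1 [set w | X1 w = i] = P2 [set w | X2 w = i]) ->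
  (forall w, `|h (X1 w)| <= M) -> (forall w, `|h (X2 w)| <= M) ->
  \int[P1]_w h (X1 w) = \int[P2]_w h (X2 w).
Proof.
move=> mX1 mX2 HP h1 h2.
(* h is transported to the codes in [nat], where every function is measurable. The default values 0
   are never met on the ranges of X1 and X2. *)
pose k (n : nat) : R :=
  if pickle_inv n is Some i then (if `|h i| <= M then h i else 0) else 0.
have k1 w : k (pickle (X1 w)) = h (X1 w) by rewrite /k pickleK_inv h1.
have k2 w : k (pickle (X2 w)) = h (X2 w) by rewrite /k pickleK_inv h2.
pose Z1 w := pickle (X1 w); pose Z2 w := pickle (X2 w).
have mZ1 : measurable_fun setT Z1.
  by move=> _ A _; rewrite setTI; exact: (fibers_measurable_preimage [set i | A (pickle i)] mX1).
have mZ2 : measurable_fun setT Z2.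
  by move=> _ A _; rewrite setTI; exact: (fibers_measurable_preimage [set i | A (pickle i)] mX2).
have mk : measurable_fun setT (EFin \o k) by [].
have b1 : bounded_mfun (k \o Z1).
  split; last by exists M => w /=; rewrite k1.
  exact: measurableT_comp.
have b2 : bounded_mfun (k \o Z2).
  split; last by exists M => w /=; rewrite k2.
  exact: measurableT_comp.
transitivity (\int[P1]_w (k \o Z1) w); first by apply: eq_Rintegral => w _ /=; rewrite k1.
transitivity (\int[P2]_w (k \o Z2) w); last by apply: eq_Rintegral => w _ /=; rewrite k2.
congr fine.
transitivity (\int[pushforward P1 Z1]_y (EFin \o k) y)%E.
  rewrite integral_pushforward//.
  exact: (bounded_mfun_integrable P1 b1).
transitivity (\int[pushforward P2 Z2]_y (EFin \o k) y)%E; last first.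
  rewrite integral_pushforward//.
  exact: (bounded_mfun_integrable P2 b2).
apply: eq_measure_integral => A mA _; rewrite /pushforward /=.
rewrite -[LHS]mul1e -[RHS]mul1e; apply: (probability_total_eq mX1 mX2).
- by have := mZ1 measurableT _ mA; rewrite setTI.
- by have := mZ2 measurableT _ mA; rewrite setTI.
- move=> i; rewrite !mul1e.
  have E e (T : measurableType e) (X : T -> I) :
    ((fun w => pickle (X w)) @^-1` A `&` [set w | X w = i]) =
    if `[< A (pickle i) >] then [set w | X w = i] else set0.
    case: asboolP => Ai; apply/seteqP; split => w //=.
    - by case.
    - by move=> Xi; split => //; rewrite Xi.
    - by move=> [Aw Xi]; apply: Ai; rewrite -Xi.
  by rewrite !E; case: ifP => _; rewrite ?HP ?measure0.
Qed.

End discrete_laws.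

(** Independence in Fubini form: the first argument may be frozen while the second is integrated.
    This is how conditioning on the past is carried out below, and it needs no sigma-algebra on U or
    V. *)
Definition indep_rv d (T : measurableType d) (R : realType) (P : probability T R)
    (U V : Type) (F : T -> U) (G : T -> V) : Prop :=
  forall (H : U -> V -> R) (M : R), (forall w w', `|H (F w) (G w')| <= M) ->
    \int[P]_w H (F w) (G w) = \int[P]_w \int[P]_w' H (F w) (G w').

Section independence.
Context d (T : measurableType d) (R : realType) (P : probability T R).

(** The factors f and g need not be normalised. Summing over j shows that the law of X is
    proportional to f, and total mass 1 fixes the constant. *)
Lemma factor_indep (I J : countType) (X : T -> I) (Y : T -> J) (f : I -> R) (g : J -> R) :
  fibers_measurable X -> fibers_measurable Y ->
  (forall i j, P ([set w | X w = i] `&` [set w | Y w = j]) = (f i * g j)%:E) ->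
  forall i j, (P ([set w | X w = i] `&` [set w | Y w = j]) =
    P [set w | X w = i] * P [set w | Y w = j])%E.
Proof.
move=> mX mY fgE i j.
have step i' : ((f i * g j)%:E * P [set w | X w = i'] =
                (f i' * g j)%:E * P [set w | X w = i])%E.
  apply: (probability_total_eq mY mY) => // j'.
  by rewrite !fgE -!EFinM; congr EFin; ring.
have PX : (P [set w | X w = i] = (fine (P [set w | X w = i]))%:E)%E.
  by rewrite fineK// fin_num_measure.
have := @probability_total_eq R _ _ _ _ P P I X X setT [set w | Y w = j]
  (f i * g j) (fine (P [set w | X w = i])) mX mX measurableT (mY j).
rewrite probability_setT mule1 fgE -PX => -> // i'.
by rewrite setTI setIC fgE step muleC.
Qed.

(** The pair (X w, Y w) under P has the law of (X w, Y w') under the product of P with itself, and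
    on the product space the expectation is an iterated integral. *)
Lemma factor_indep_rv (I J : countType) (X : T -> I) (Y : T -> J) (f : I -> R) (g : J -> R) :
  fibers_measurable X -> fibers_measurable Y ->
  (forall i j, P ([set w | X w = i] `&` [set w | Y w = j]) = (f i * g j)%:E) ->
  indep_rv P X Y.
Proof.
move=> mX mY fgE H M HM.
have mXY : fibers_measurable (fun w => (X w, Y w)).
  move=> [i j]; rewrite (_ : mkset _ = [set w | X w = i] `&` [set w | Y w = j]).
    exact: measurableI.
  by apply/seteqP; split => w /= [-> ->].
have m2E i j : [set w : T * T | (X w.1, Y w.2) = (i, j)] =
    [set w | X w = i] `*` [set w | Y w = j].
  by apply/seteqP; split => w /= [-> ->].
have mXY2 : fibers_measurable (fun w : T * T => (X w.1, Y w.2)).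
  by move=> [i j]; rewrite m2E; exact: measurableX.
rewrite (@discrete_law_expectation R _ _ _ _ P (P \x P)%E _ (fun w => (X w, Y w))
  (fun w : T * T => (X w.1, Y w.2)) (fun ij => H ij.1 ij.2) M)//=.
  apply: (@Rint_prod _ _ _ _ _ P P (fun w : T * T => H (X w.1) (Y w.2))).
  split; last by exists M.
  apply: discrete_rv_mfun.
  exact: (discrete_rv_comp (fun ij => H ij.1 ij.2) (discrete_rv_fibers mXY2)).
move=> [i j]; rewrite m2E product_measure1E//.
rewrite -(factor_indep mX mY fgE); congr (P _).
by apply/seteqP; split => w /= [-> ->].
Qed.

Lemma indep_rv_comp (U U' V V' : Type) (F : T -> U) (G : T -> V) (h : U -> U') (k : V -> V')
  (F' : T -> U') (G' : T -> V') :
  indep_rv P F G -> F' =1 h \o F -> G' =1 k \o G -> indep_rv P F' G'.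
Proof.
move=> FG FE GE H M HM; have -> : F' = h \o F by apply/funext.
have -> : G' = k \o G by apply/funext.
by apply: (FG (fun u v => H (h u) (k v)) M) => w w'; have := HM w w'; rewrite FE GE.
Qed.

End independence.

Section iid_labels.
Context d (T : measurableType d) (R : realType) (P : probability T R).

(* [lab true] and [lab false] are the two label sequences, [p true] and [p false] their laws. *)
Definition iid_labels (lab : bool -> nat -> T -> nat) (p : bool -> nat -> R) : Prop :=
  [/\ (forall b j, fibers_measurable (lab b j)), (forall b i, 0 <= p b i),
      (forall b, series (p b) @ \oo --> (1 : R)) &
      (forall N (c : bool -> nat -> nat),
         P [set w | forall b j, (j < N)%N -> lab b j w = c b j] =
         (\prod_(bj : bool * 'I_N) p bj.1 (c bj.1 bj.2))%:E)].

(** Measurability with respect to the labels at the positions (b, j) of A, phrased as pointwise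
    dependence. Independence of two statistics is thereby reduced to disjointness of their sets of
    positions. *)
Definition depends_on (lab : bool -> nat -> T -> nat) (U : Type)
    (A : bool -> nat -> bool) (F : T -> U) : Prop :=
  forall w w', (forall b j, A b j -> lab b j w = lab b j w') -> F w = F w'.

Variables (lab : bool -> nat -> T -> nat) (p : bool -> nat -> R).
Hypothesis L : iid_labels lab p.

(** Positions outside A are frozen at 0, so that the configurations for different sets A share one
    countable type. *)
Let config N (A : bool -> nat -> bool) (w : T) : {ffun bool * 'I_N -> nat} :=
  [ffun bj : bool * 'I_N => if A bj.1 bj.2 then lab bj.1 bj.2 w else 0%N].

Let configP N (A : bool -> nat -> bool) w w' : (forall b j, A b j -> (j < N)%N) ->
  config N A w = config N A w' -> forall b j, A b j -> lab b j w = lab b j w'.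
Proof.
move=> AN /ffunP E b j Abj; have := E (b, Ordinal (AN _ _ Abj)).
by rewrite !ffunE /= Abj.
Qed.

Let config_fibers N A : fibers_measurable (config N A).
Proof.
move=> c; rewrite (_ : mkset _ = \bigcap_(bj in [set: bool * 'I_N])
    [set w | (if A bj.1 bj.2 then lab bj.1 bj.2 w else 0%N) = c bj]).
  apply: fin_bigcap_measurable => // -[b j] _ /=; case: (A b j).
    by case: L => mL _ _ _; exact: mL.
  have [->|c0] := eqVneq (c (b, j)) 0%N.
    by rewrite (_ : mkset _ = setT)//; apply/seteqP.
  by rewrite (_ : mkset _ = set0)//; apply/seteqP; split => // w /= /esym/eqP; rewrite (negbTE c0).
apply/seteqP; split => w /=; first by move=> <- [b j] _; rewrite /= ffunE.
by move=> H; apply/ffunP => bj; rewrite ffunE; apply: H.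
Qed.

Let depends_config N (A : bool -> nat -> bool) (U : Type) (F : T -> U) : (forall b j, A b j -> (j < N)%N) ->
  depends_on lab A F -> exists h, F =1 h \o config N A.
Proof.
move=> AN dF.
exists (fun c => if pselect (exists w, config N A w = c) is left e
  then F (projT1 (cid e)) else F point).
move=> w /=; case: pselect => [e|]; last by case; exists w.
case: (cid e) => w' /= E; apply: dF => b j Abj; apply/esym.
exact: (configP AN E).
Qed.

Lemma depends_discrete N (A : bool -> nat -> bool) (U : Type) (F : T -> U) : (forall b j, A b j -> (j < N)%N) ->
  depends_on lab A F -> discrete_rv F.
Proof.
move=> AN dF; have [h Fh] := depends_config AN dF.
by exists {ffun bool * 'I_N -> nat}, (config N A), h; split; [exact: config_fibers|].
Qed.

(** The indicators discard configurations that are nonzero at a frozen position; on the others the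
    joint law is a product over all positions, which splits along A and its complement. *)
Let config_factor N (A : bool -> nat -> bool) (x y : {ffun bool * 'I_N -> nat}) :
  P ([set w | config N A w = x] `&` [set w | config N (fun b j => ~~ A b j) w = y]) =
  (([forall bj : bool * 'I_N, ~~ A bj.1 bj.2 ==> (x bj == 0%N)]%:R *
     \prod_(bj : bool * 'I_N | A bj.1 bj.2) p bj.1 (x bj)) *
   ([forall bj : bool * 'I_N, A bj.1 bj.2 ==> (y bj == 0%N)]%:R *
     \prod_(bj : bool * 'I_N | ~~ A bj.1 bj.2) p bj.1 (y bj)))%:E.
Proof.
have [Hx|/forallPn[bj]] := boolP [forall bj : bool * 'I_N, ~~ A bj.1 bj.2 ==> (x bj == 0%N)]; last first.
  rewrite negb_imply => /andP[nA xbj]; rewrite !mul0r.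
  rewrite (_ : _ `&` _ = set0) ?measure0//; apply/seteqP; split => // w [/= E _].
  by move: xbj; rewrite -E ffunE (negbTE nA) eqxx.
have [Hy|/forallPn[bj]] := boolP [forall bj : bool * 'I_N, A bj.1 bj.2 ==> (y bj == 0%N)]; last first.
  rewrite negb_imply => /andP[nA xbj]; rewrite !(mul0r, mulr0).
  rewrite (_ : _ `&` _ = set0) ?measure0//; apply/seteqP; split => // w [/= _ E].
  by move: xbj; rewrite -E ffunE nA eqxx.
rewrite !mul1r.
pose c b j := if insub j is Some i then (if A b j then x (b, i) else y (b, i)) else 0%N.
have cE b (j : 'I_N) : c b j = if A b j then x (b, j) else y (b, j) by rewrite /c valK.
rewrite (_ : _ `&` _ = [set w | forall b j, (j < N)%N -> lab b j w = c b j]); last first.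
  apply/seteqP; split => w /=.
    move=> [/ffunP Ex /ffunP Ey] b j jN; rewrite -[j]/(val (Ordinal jN)) cE.
    have := Ex (b, Ordinal jN); have := Ey (b, Ordinal jN); rewrite !ffunE /=.
    by case: (A b j).
  move=> H; split; apply/ffunP => -[b j]; rewrite ffunE /=.
    case: ifP => Abj; first by rewrite H// cE Abj.
    by apply/esym/eqP; have /forallP/(_ (b, j)) := Hx; rewrite /= Abj.
  case: ifP => Abj; first by rewrite H// cE (negbTE Abj).
  by apply/esym/eqP; have /forallP/(_ (b, j)) := Hy; rewrite /= (negbFE Abj).
case: L => _ _ _ ->; congr EFin.
rewrite (bigID (fun bj : bool * 'I_N => A bj.1 bj.2)) /=; congr (_ * _).
  by apply: eq_bigr => -[b j] /= Abj; rewrite cE Abj.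
by apply: eq_bigr => -[b j] /= Abj; rewrite cE (negbTE Abj).
Qed.

Lemma depends_indep N (U V : Type) (A B : bool -> nat -> bool) (F : T -> U) (G : T -> V) :
  (forall b j, A b j -> (j < N)%N) -> (forall b j, B b j -> (j < N)%N) ->
  (forall b j, A b j -> ~~ B b j) ->
  depends_on lab A F -> depends_on lab B G -> indep_rv P F G.
Proof.
move=> AN BN AB dF dG.
have [h Fh] := depends_config AN dF.
pose A' b j := ~~ A b j && (j < N)%N.
have dG' : depends_on lab A' G.
  move=> w w' E; apply: dG => b j Bbj; apply: E; rewrite /A' (BN _ _ Bbj) andbT.
  by apply: contraTN Bbj; exact: AB.
have [k Gk] := depends_config (fun b j => @proj2 _ _ \o elimT (@andP _ _) : A' b j -> (j < N)%N) dG'.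
apply: (indep_rv_comp _ Fh Gk).
have -> : config N A' = config N (fun b j => ~~ A b j).
  by apply/funext => w; apply/ffunP => -[b j]; rewrite !ffunE /A' /= ltn_ord andbT.
apply: factor_indep_rv; [exact: config_fibers|exact: config_fibers|].
exact: config_factor.
Qed.

Lemma law_sum b : (\sum_(0 <= n <oo) (p b n)%:E = 1)%E.
Proof.
case: L => _ _ /(_ b) cp _.
apply/cvg_lim => //; rewrite (_ : (fun n => _) = EFin \o series (p b)).
  by apply: cvg_EFin; [exact: nearW|exact: cp].
by apply/funext => n; rewrite /series /= sumEFin.
Qed.

(** The label is separated from all other labels of index at most j. Summing the joint law over the
    label gives the law of the others, because [p b] has mass 1; the total mass of the others then
    leaves [p b n]. *)
Lemma label_law b j n : P [set w | lab b j w = n] = (p b n)%:E.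
Proof.
pose A (b' : bool) (j' : nat) := ~~ ((b' == b) && (j' == j)).
have mlab : fibers_measurable (lab b j) by case: L.
pose X := config j.+1 A.
pose f (x : {ffun bool * 'I_j.+1 -> nat}) : R :=
  [forall bj : bool * 'I_j.+1, ~~ A bj.1 bj.2 ==> (x bj == 0%N)]%:R *
     \prod_(bj : bool * 'I_j.+1 | A bj.1 bj.2) p bj.1 (x bj).
have XY x m : P ([set w | X w = x] `&` [set w | lab b j w = m]) = (f x * p b m)%:E.
  pose y : {ffun bool * 'I_j.+1 -> nat} :=
    [ffun bj : bool * 'I_j.+1 => if A bj.1 bj.2 then 0%N else m].
  have -> : [set w | lab b j w = m] = [set w | config j.+1 (fun b j => ~~ A b j) w = y].
    apply/seteqP; split => w /=.
      move=> E; apply/ffunP => -[b' j']; rewrite !ffunE /=; case: (boolP (A b' j')) => //=.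
      by rewrite negbK => /andP[/eqP -> /eqP ->].
    move=> /ffunP/(_ (b, ord_max)); rewrite !ffunE /=.
    by rewrite /A !eqxx.
  rewrite config_factor; congr (_ * _)%:E.
  rewrite (_ : [forall bj, _] = true) ?mul1r; last first.
    by apply/forallP => bj; apply/implyP => Abj; rewrite ffunE Abj.
  rewrite (big_pred1 (b, ord_max)) => [|[b' j']].
    by rewrite ffunE /= /A !eqxx.
  by rewrite /= /A negbK -[(b', j') == _]/((b' == b) && (j' == ord_max)).
have Xf x : P [set w | X w = x] = (f x)%:E.
  rewrite (probability_total P mlab); last exact: config_fibers.
  rewrite (eq_eseriesr (g := fun m => ((f x)%:E * (p b m)%:E)%E)); last first.
    by move=> m _; rewrite -EFinM -XY.
  rewrite nneseriesZl ?law_sum ?mule1// => m _; rewrite lee_fin.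
  by case: L => _ + _ _; apply.
have := @probability_total_eq R _ _ _ _ P P _ X X [set w | lab b j w = n] setT 1 (p b n)
  (config_fibers _) (config_fibers _) (mlab n) measurableT.
rewrite mul1e probability_setT mule1; apply => x.
by rewrite mul1e setTI setIC XY Xf -EFinM mulrC.
Qed.

Lemma label_expectation b j (h : nat -> R) M : (forall n, 0 <= h n <= M) ->
  \int[P]_w h (lab b j w) = limn (series (fun i => p b i * h i)).
Proof.
move=> hM.
have mlab : fibers_measurable (lab b j) by case: L.
have p0 n : 0 <= p b n by case: L.
have lab_cover : setT = \bigcup_n [set w | lab b j w = n].
  by apply/seteqP; split => // w _; exists (lab b j w).
have mh : measurable_fun setT (fun w => h (lab b j w)).
  exact/discrete_rv_mfun/discrete_rv_comp/discrete_rv_fibers.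
have bh : bounded_mfun (fun w => h (lab b j w)).
  by split => //; exists M => w; have /andP[h0 h1] := hM (lab b j w); rewrite ger0_norm.
have E : (\int[P]_w (h (lab b j w))%:E = \sum_(0 <= n <oo) (p b n * h n)%:E)%E.
  rewrite lab_cover ge0_integral_bigcup//.
  - apply: eq_eseriesr => n _.
    rewrite (eq_integral (fun=> (h n)%:E)).
      by rewrite integral_cst// EFinM -(label_law b j) muleC.
    by move=> w; rewrite inE => <-.
  - by rewrite -lab_cover; exact/measurable_EFinP.
  - by move=> w _; rewrite lee_fin; have /andP[] := hM (lab b j w).
  - by apply/trivIsetP => i k _ _ ik; apply/seteqP; split => // w [/= E1 E2]; rewrite -E1 -E2 eqxx in ik.
have fE : (\sum_(0 <= n <oo) (p b n * h n)%:E \is a fin_num)%E.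
  by rewrite -E; apply: integrable_fin_num => //; exact: (bounded_mfun_integrable P bh).
rewrite /Rintegral E.
apply/esym/cvg_lim => //.
have ph0 n : (0 <= (p b n * h n)%:E)%E.
  by rewrite lee_fin mulr_ge0//; have /andP[] := hM n.
have c : (\sum_(0 <= i < n) (p b i * h i)%:E)%E @[n --> \oo] -->
    (\sum_(0 <= n <oo) (p b n * h n)%:E)%E.
  by apply: is_cvg_nneseries => n _ _; exact: ph0.
rewrite (_ : series _ = fine \o (fun n => (\sum_(0 <= i < n) (p b i * h i)%:E)%E)); last first.
  by apply/funext => n; rewrite /series /= sumEFin.
by move: c; rewrite -{1}(fineK fE) => /fine_cvg.
Qed.

End iid_labels.

(** * Score walks and the Hoeffding decomposition *)

Section label_statistics.
Context d (T : measurableType d) (R : realType).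
Variables (p : bool -> nat -> R) (lab : bool -> nat -> T -> nat).

Definition label_mean : R := limn (series (fun i => p true i * p false i)).

Definition score (b : bool) (n : nat) : R := p (~~ b) n - label_mean.

Definition score_var (b : bool) : R :=
  limn (series (fun i => p b i * score b i ^+ 2)).

Definition walk (b : bool) (m : nat) (w : T) : R :=
  \sum_(j < m) score b (lab b j w).

(* Degenerate part of the matching kernel [a == b] in its Hoeffding decomposition. *)
Definition match_kernel (a b : nat) : R :=
  (a == b)%:R - score true a - score false b - label_mean.

Definition match_ustat (m n : nat) (w : T) : R :=
  \sum_(i < m) \sum_(j < n) match_kernel (lab true i w) (lab false j w).

Lemma walk0 b w : walk b 0 w = 0.
Proof. by rewrite /walk big_ord0. Qed.

Lemma walkD b m k w : walk b (m + k) w = walk b m w + \sum_(i < k) score b (lab b (m + i) w).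
Proof. by rewrite /walk big_split_ord. Qed.

End label_statistics.

Definition prb d (T : measurableType d) (R : realType) (P : probability T R)
  (b : T -> bool) : R := \int[P]_w (b w)%:R.

Section expectations.
Context d (T : measurableType d) (R : realType) (P : probability T R).

Lemma chebyshev_le (Z : T -> R) (t : R) : 0 < t -> bounded_mfun Z -> discrete_rv Z ->
  prb P (fun w => t <= `|Z w|) <= \int[P]_w (Z w ^+ 2) / t ^+ 2.
Proof.
move=> t0 bZ dZ.
have t20 : 0 < t ^+ 2 by rewrite exprn_gt0.
have b1 : bounded_mfun (fun w => (t <= `|Z w|)%R%:R : R).
  split; last by exists 1 => w; case: (t <= _); rewrite ?normr1 ?normr0.
  exact/discrete_rv_mfun/(discrete_rv_comp (fun z => (t <= `|z|)%R%:R : R)).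
rewrite ler_pdivlMr// mulrC -RintTZ//; apply: le_RintT.
- exact: bounded_mfunZ.
- exact: bounded_mfunM.
- move=> w; have [tZ|_] := leP t `|Z w|; last by rewrite mulr0 sqr_ge0.
  by rewrite mulr1 -[leRHS]real_normK ?num_real// ler_sqr ?nnegrE// ltW.
Qed.

Lemma orthogonal_sum_le (I : finType) (Z : I -> T -> R) (c : R) :
  (forall i, bounded_mfun (Z i)) -> (forall i w, `|Z i w| <= c) ->
  (forall i j, i != j -> \int[P]_w (Z i w * Z j w) = 0) ->
  \int[P]_w ((\sum_i Z i w) ^+ 2) <= c ^+ 2 * #|I|%:R.
Proof.
move=> bZ Zc Z0.
under eq_Rintegral do rewrite expr2 mulr_suml.
rewrite RintT_sum; last first.
  by move=> i; apply: bounded_mfunM => //; exact: bounded_mfun_sum.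
rewrite mulrC mulr_natl -sumr_const; apply: ler_sum => i _.
under eq_Rintegral do rewrite mulr_sumr.
rewrite RintT_sum; last by move=> j; exact: bounded_mfunM.
rewrite (bigD1 i)//= big1 ?addr0; last by move=> j ij; rewrite Z0// eq_sym.
rewrite -[leRHS](RintT_cst P); apply: le_RintT.
- exact: bounded_mfunM.
- exact: bounded_mfun_cst.
- move=> w; rewrite -expr2 -real_normK ?num_real// lerXn2r ?nnegrE//.
  exact: le_trans (Zc i w).
Qed.

(** Freezing F leaves a factor of mean 0. Letting b depend on F covers the degenerate kernel, which
    is centred in one label for each value of the other. *)
Lemma indep_centered (U V : Type) (F : T -> U) (G : T -> V) (a : U -> R)
    (b : U -> V -> R) (M N : R) : indep_rv P F G -> discrete_rv G ->
  (forall w, `|a (F w)| <= M) -> (forall w w', `|b (F w) (G w')| <= N) ->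
  (forall w, \int[P]_w' b (F w) (G w') = 0) ->
  \int[P]_w (a (F w) * b (F w) (G w)) = 0.
Proof.
move=> FG dG aM bN b0.
rewrite (FG (fun u v => a u * b u v) (M * N)); last first.
  by move=> w w'; rewrite normrM ler_pM.
under eq_Rintegral => w _.
  rewrite RintTZ; last first.
    by split; [exact/discrete_rv_mfun/discrete_rv_comp|exists N].
  by rewrite b0 mulr0; over.
by rewrite RintT_cst.
Qed.

Lemma indep_rv_le (U V : Type) (F : T -> U) (G : T -> V) (H : U -> V -> R) (M c : R) :
  indep_rv P F G -> discrete_rv F -> discrete_rv G ->
  (forall w w', `|H (F w) (G w')| <= M) ->
  (forall w, \int[P]_w' H (F w) (G w') <= c) ->
  \int[P]_w H (F w) (G w) <= c.
Proof.
move=> FG dF dG HM Hc; rewrite (FG H M HM) -[leRHS](RintT_cst P).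
have bH w : bounded_mfun (fun w' => H (F w) (G w')).
  by split; [exact/discrete_rv_mfun/(discrete_rv_comp (H (F w)))|exists M].
apply: le_RintT => //; last exact: bounded_mfun_cst.
split; last by exists M => w; exact: RintT_norm_le.
apply: discrete_rv_mfun.
exact: (discrete_rv_comp (fun u => \int[P]_w' H u (G w')) dF).
Qed.

End expectations.

Section score_moments.
Context d (T : measurableType d) (R : realType) (P : probability T R).
Variables (p : bool -> nat -> R) (lab : bool -> nat -> T -> nat).
Hypothesis L : iid_labels P lab p.
Notation m := (label_mean p).
Notation score := (score p).
Notation walk := (walk p lab).
Notation ker := (match_kernel p).

Lemma law_ge0 b n : 0 <= p b n. Proof. by case: L. Qed.

Lemma law_le1 b n : p b n <= 1.
Proof. rewrite -lee_fin -(label_law L b 0); apply: probability_le1; case: L => mL _ _ _; exact: mL. Qed.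

Lemma label_discrete b j : discrete_rv (lab b j).
Proof. by apply: discrete_rv_fibers; case: L. Qed.

Lemma discrete_bounded (U : Type) (F : T -> U) (h : U -> R) (M : R) :
  discrete_rv F -> (forall w, `|h (F w)| <= M) -> bounded_mfun (fun w => h (F w)).
Proof. by move=> dF hM; split; [exact/discrete_rv_mfun/discrete_rv_comp|exists M]. Qed.

Lemma label_meanE b j : \int[P]_w p (~~ b) (lab b j w) = m.
Proof.
rewrite (@label_expectation _ _ _ _ _ _ L b j (p (~~ b)) 1); last first.
  by move=> n; rewrite law_ge0 law_le1.
by case: b => //=; rewrite /label_mean; under eq_fun do rewrite mulrC.
Qed.

Lemma label_mean01 : 0 <= m <= 1.
Proof.
rewrite -(label_meanE true 0) RintT_ge0 => [|w]; last exact: law_ge0.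
rewrite -[leRHS](RintT_cst P); apply: le_RintT.
- apply: (discrete_bounded (M := 1)); first exact: label_discrete.
  by move=> w; rewrite ger0_norm ?law_ge0 ?law_le1.
- exact: bounded_mfun_cst.
- by move=> w; exact: law_le1.
Qed.

Lemma score_le1 b n : `|score b n| <= 1.
Proof.
have /andP[m0 m1] := label_mean01.
have := law_ge0 (~~ b) n; have := law_le1 (~~ b) n.
by rewrite /score ler_norml; lra.
Qed.

Lemma score_bounded b j : bounded_mfun (fun w => score b (lab b j w)).
Proof.
by apply: (discrete_bounded (M := 1)); [exact: label_discrete|move=> w; exact: score_le1].
Qed.

Lemma score_mean b j : \int[P]_w score b (lab b j w) = 0.
Proof.
rewrite /score RintTB ?RintT_cst ?label_meanE ?subrr//.
  apply: (discrete_bounded (M := 1)); first exact: label_discrete.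
  by move=> w; rewrite ger0_norm ?law_ge0 ?law_le1.
exact: bounded_mfun_cst.
Qed.

Lemma score_var_mean b j : \int[P]_w (score b (lab b j w) ^+ 2) = score_var p b.
Proof.
rewrite (@label_expectation _ _ _ _ _ _ L b j (fun n => score b n ^+ 2) 1)// => n.
rewrite sqr_ge0 -real_normK ?num_real//= expr_le1//; exact: score_le1.
Qed.

Lemma score_var_ge0 b : 0 <= score_var p b.
Proof. by rewrite -(score_var_mean b 0); apply: RintT_ge0 => w; exact: sqr_ge0. Qed.

Lemma label_depends b j : depends_on lab (fun b' j' => (b' == b) && (j' == j)) (lab b j).
Proof. by move=> w w' E; apply: E; rewrite !eqxx. Qed.

Lemma score_orthogonal b i j : i != j ->
  \int[P]_w (score b (lab b i w) * score b (lab b j w)) = 0.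
Proof.
move=> ij.
apply: (@indep_centered _ _ _ P nat nat (lab b i) (lab b j) (score b) (fun _ => score b) 1 1).
- apply: (@depends_indep _ _ _ P lab p L (maxn i j).+1 _ _ _ _ _ _ _ _ _ (@label_depends b i) (@label_depends b j)).
  + by move=> b' j' /andP[_ /eqP ->]; rewrite ltnS leq_maxl.
  + by move=> b' j' /andP[_ /eqP ->]; rewrite ltnS leq_maxr.
  + by move=> b' j' /andP[_ /eqP ->]; rewrite negb_and ij orbT.
- exact: label_discrete.
- by move=> w; exact: score_le1.
- by move=> _ w; exact: score_le1.
- by move=> _; exact: score_mean.
Qed.

Lemma walk_bounded b k : bounded_mfun (walk b k).
Proof. by apply: bounded_mfun_sum => i; exact: score_bounded. Qed.

Lemma walk_discrete b k : discrete_rv (walk b k).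
Proof.
apply: (@discrete_rv_bigop _ _ _ 0 +%R (fun i w => score b (lab b i w)) k) => i _.
exact: (discrete_rv_comp (score b) (label_discrete b i)).
Qed.

Lemma walk_dist_moment b k l :
  \int[P]_w ((walk b k w - walk b l w) ^+ 2) <= `|k%:R - l%:R|.
Proof.
wlog kl : k l / (l <= k)%N => [H|].
  have [|/ltnW] := leqP l k; first exact: H.
  move=> kl; rewrite distrC; under eq_Rintegral do rewrite -sqrrN opprB.
  exact: H.
rewrite -natrB// normr_nat -[k in walk _ k](subnKC kl).
under eq_Rintegral do rewrite walkD addrC addKr.
rewrite -[leRHS]mul1r -[X in X * _](expr1n _ 2) -[X in X%:R](card_ord (k - l)).
apply: orthogonal_sum_le.
- by move=> i; exact: score_bounded.
- by move=> i w; exact: score_le1.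
- by move=> i j ij; apply: score_orthogonal; rewrite eqn_add2l.
Qed.

Lemma walk_dist_le b k l w : `|walk b k w - walk b l w| <= `|k%:R - l%:R|.
Proof.
wlog kl : k l / (l <= k)%N => [H|].
  have [|/ltnW kl] := leqP l k; first exact: H.
  by rewrite distrC (distrC k%:R); exact: H.
rewrite -natrB// normr_nat -[k in walk _ k](subnKC kl) walkD addrC addKr.
rewrite (le_trans (ler_norm_sum _ _ _))// -[X in _ <= X%:R](card_ord (k - l)) -sumr_const.
by apply: ler_sum => i _; exact: score_le1.
Qed.

Lemma walk_dist_depends h N b k l : (h <= k <= N)%N -> (h <= l <= N)%N ->
  depends_on lab (fun _ j => h <= j < N)%N (fun w => walk b k w - walk b l w).
Proof.
move=> /andP[hk kN] /andP[hl lN] w w' E.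
have H n v : (h <= n)%N -> walk b n v = walk b h v + \sum_(i < n - h) score b (lab b (h + i) v).
  by move=> hn; rewrite -walkD subnKC.
rewrite !(H k)// !(H l)//.
have Q (x y z : R) : (z + x) - (z + y) = x - y by ring.
rewrite !Q.
congr (_ - _); apply: eq_bigr => i _; rewrite E// leq_addr.
  by rewrite (leq_trans _ kN)// -ltn_subRL.
by rewrite (leq_trans _ lN)// -ltn_subRL.
Qed.

Lemma walk_depends b k : depends_on lab (fun _ j => j < k)%N (walk b k).
Proof. by move=> w w' E; apply: eq_bigr => i _; rewrite E. Qed.

Lemma match_kernel_le a b : `|ker a b| <= 4.
Proof.
have /andP[m0 m1] := label_mean01.
have := score_le1 true a; have := score_le1 false b.
rewrite /match_kernel !ler_norml => /andP[? ?] /andP[? ?].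
by case: (a == b); rewrite /= ?mulr1n ?mulr0n; lra.
Qed.

(** Degeneracy: the indicator averages to [p b c], which is the mean plus the score of c in the
    other sequence, so the terms of the kernel cancel. *)
Lemma match_kernel_mean (b : bool) j c :
  \int[P]_w (if b then ker (lab b j w) c else ker c (lab b j w)) = 0.
Proof.
have E : \int[P]_w (lab b j w == c)%:R = p b c.
  rewrite /Rintegral (_ : (\int[P]_w _)%E = P [set w | lab b j w = c]); first by rewrite (label_law L).
  have mc : measurable [set w | lab b j w = c] by case: L => mL _ _ _; exact: mL.
  transitivity (P ([set w | lab b j w = c] `&` setT)); last by rewrite setIT.
  rewrite -integral_indic//; apply: eq_integral => w _.
  rewrite indicE; congr ((nat_of_bool _)%:R%:E).
  by apply/idP/idP; [move=> /eqP E|]; rewrite inE//= => ->.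
have bl : bounded_mfun (fun w => (lab b j w == c)%:R : R).
  apply: (discrete_bounded (h := fun n => (n == c)%:R) (M := 1)); first exact: label_discrete.
  by move=> w; case: eqP; rewrite ?normr1 ?normr0.
have -> : \int[P]_w (if b then ker (lab b j w) c else ker c (lab b j w)) =
          \int[P]_w ((lab b j w == c)%:R - score b (lab b j w) - p b c).
  apply: eq_Rintegral => w _; rewrite /match_kernel /score.
  by case: (b); rewrite /= 1?eq_sym; ring.
rewrite RintTB; [|exact: (bounded_mfunB bl (score_bounded b j))|exact: bounded_mfun_cst].
rewrite RintTB; [|exact: bl|exact: score_bounded].
by rewrite E score_mean RintT_cst subr0 subrr.
Qed.

End score_moments.

(** * Second moment of the degenerate part, and Gaussian replacement for paired scores *)

Section ustat_and_lindeberg.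
Context d (T : measurableType d) (R : realType) (P : probability T R).
Variables (p : bool -> nat -> R) (lab : bool -> nat -> T -> nat).
Hypothesis L : iid_labels P lab p.
Notation score := (score p).
Notation ker := (match_kernel p).
Notation ustat := (match_ustat p lab).

Let Z (i j : nat) (w : T) : R := ker (lab true i w) (lab false j w).

Let Z_le i j w : `|Z i j w| <= 4.
Proof. exact: (match_kernel_le L). Qed.

Let Z_discrete i j : discrete_rv (Z i j).
Proof. exact: (discrete_rv_comp2 ker (label_discrete L true i) (label_discrete L false j)). Qed.

Let Z_bounded i j : bounded_mfun (Z i j).
Proof. by split; [exact: discrete_rv_mfun|exists 4 => w; exact: Z_le]. Qed.

(** Distinct pairs differ in some coordinate. The label that the second pair has there does not
    occur in the first pair, and averaging it out kills the product. *)
Let Z_orthogonal i j i' j' : (i, j) != (i', j') -> \int[P]_w (Z i j w * Z i' j' w) = 0.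
Proof.
move=> ij.
pose N := (maxn (maxn i i') (maxn j j')).+1.
have [jj|jj] := eqVneq j j'.
- have ii : i != i' by apply: contraNneq ij => ->; rewrite jj.
  apply: (@indep_centered _ _ _ P (R * nat) nat (fun w => (Z i j w, lab false j' w))
    (lab true i') (fun u => u.1) (fun u n => ker n u.2) 4 4).
  + apply: (@depends_indep _ _ _ P lab p L N _ _
      (fun b k => if b then k == i else (k == j) || (k == j'))
      (fun b k => (b == true) && (k == i')) _ _ _ _ _ _ (@label_depends _ _ lab true i')).
    * by move=> [] k; rewrite /N; lia.
    * by move=> [] k; rewrite /N; lia.
    * by move=> [] k //= /eqP ->.
    * by move=> w w' E; rewrite /Z (E true)// ?(E false)//= ?eqxx ?orbT.
  + exact: (label_discrete L).
  + by move=> w /=.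
  + by move=> w w'; exact: (match_kernel_le L).
  + by move=> w /=; exact: (match_kernel_mean L true).
- apply: (@indep_centered _ _ _ P (R * nat) nat (fun w => (Z i j w, lab true i' w))
    (lab false j') (fun u => u.1) (fun u n => ker u.2 n) 4 4).
  + apply: (@depends_indep _ _ _ P lab p L N _ _
      (fun b k => if b then (k == i) || (k == i') else k == j)
      (fun b k => (b == false) && (k == j')) _ _ _ _ _ _ (@label_depends _ _ lab false j')).
    * by move=> [] k; rewrite /N; lia.
    * by move=> [] k; rewrite /N; lia.
    * by move=> [] k //= /eqP ->.
    * by move=> w w' E; rewrite /Z (E false)// ?(E true)//= ?eqxx ?orbT.
  + exact: (label_discrete L).
  + by move=> w /=.
  + by move=> w w'; exact: (match_kernel_le L).
  + by move=> w /=; exact: (match_kernel_mean L false).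
Qed.

Lemma ustat_discrete m n : discrete_rv (ustat m n).
Proof.
apply: (@discrete_rv_bigop _ _ _ 0 +%R (fun i w => \sum_(j < n) Z i j w) m) => i _.
exact: (@discrete_rv_bigop _ _ _ 0 +%R (fun j w => Z i j w) n).
Qed.

Lemma ustat_bounded m n : bounded_mfun (ustat m n).
Proof. by apply: bounded_mfun_sum => i; apply: bounded_mfun_sum => j; exact: Z_bounded. Qed.

Lemma ustat_moment m n : \int[P]_w (ustat m n w ^+ 2) <= 16 * (m%:R * n%:R).
Proof.
rewrite /match_ustat; under eq_Rintegral do rewrite pair_bigA /=.
have -> : 16 * (m%:R * n%:R) = 4 ^+ 2 * #|{: 'I_m * 'I_n}|%:R :> R.
  by rewrite card_prod !card_ord natrM; ring.
apply: orthogonal_sum_le => //.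
- by move=> [i j]; exact: Z_bounded.
- by move=> [i j] w; exact: Z_le.
- by move=> [i j] [i' j'] ij; apply: Z_orthogonal; apply: contraNneq ij => -[/val_inj -> /val_inj ->].
Qed.

Definition total_var : R := score_var p true + score_var p false.

Lemma total_var_ge0 : 0 <= total_var.
Proof. by rewrite addr_ge0// (score_var_ge0 L). Qed.

(** Each summand pairs a score of one sequence with a score of the other, so all have variance
    [c ^+ 2 * total_var]; injectivity of the index maps makes the pairs independent. The flag b and
    the index maps allow one statement to serve the excess on either side of h and the early
    drift. *)
Lemma paired_lindeberg (b : bool) (alpha beta : nat -> nat) (c K : R) (N : nat) f :
  {in gtn N &, injective alpha} -> {in gtn N &, injective beta} ->
  lip_bounded f -> taylor3 K f -> 0 <= K ->
  `|\int[P]_w f (c * \sum_(i < N) (score b (lab b (alpha i) w) -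
       score (~~ b) (lab (~~ b) (beta i) w))) -
    gsmooth (N%:R * (c ^+ 2 * total_var)) f 0|
  <= N%:R * (K * (1 + gaussian_abs3 R) * (2 * `|c|) ^+ 3).
Proof.
move=> ia ib lf tf K0.
pose X i w := c * (score b (lab b (alpha i) w) - score (~~ b) (lab (~~ b) (beta i) w)).
have bs b' i := score_bounded L b' i.
have bX i : bounded_mfun (X i).
  by apply: bounded_mfunZ; apply: bounded_mfunB; exact: bs.
have dX i : discrete_rv (X i).
  exact: (discrete_rv_comp2 (fun x y => c * (score b x - score (~~ b) y))
    (label_discrete L b (alpha i)) (label_discrete L (~~ b) (beta i))).
have EX i : \int[P]_w X i w = 0.
  rewrite RintTZ; last by apply: bounded_mfunB; exact: bs.
  by rewrite RintTB ?(score_mean L) ?subrr ?mulr0//; exact: bs.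
have XB i w : `|X i w| <= 2 * `|c|.
  rewrite normrM mulrC ler_wpM2r// (le_trans (ler_normB _ _))//.
  by rewrite -[2]/(1 + 1) lerD// (score_le1 L).
have E12 i : \int[P]_w (score b (lab b (alpha i) w) * score (~~ b) (lab (~~ b) (beta i) w)) = 0.
  apply: (@indep_centered _ _ _ P nat nat (lab b (alpha i)) (lab (~~ b) (beta i))
    (score b) (fun _ => score (~~ b)) 1 1).
  - apply: (@depends_indep _ _ _ P lab p L (maxn (alpha i) (beta i)).+1 _ _ _ _ _ _ _ _ _
      (@label_depends _ _ lab b _) (@label_depends _ _ lab (~~ b) _)).
    + by move=> b' k /andP[_ /eqP ->]; lia.
    + by move=> b' k /andP[_ /eqP ->]; lia.
    + by move=> b' k /andP[/eqP -> _]; case: (b).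
  - exact: (label_discrete L).
  - by move=> w; exact: (score_le1 L).
  - by move=> _ w; exact: (score_le1 L).
  - by move=> _; exact: (score_mean L).
have EX2 i : \int[P]_w (X i w ^+ 2) = c ^+ 2 * total_var.
  transitivity (\int[P]_w (c ^+ 2 * (score b (lab b (alpha i) w) ^+ 2 +
      score (~~ b) (lab (~~ b) (beta i) w) ^+ 2 -
      2 * (score b (lab b (alpha i) w) * score (~~ b) (lab (~~ b) (beta i) w))))).
    by apply: eq_Rintegral => w _; rewrite /X; ring.
  have b2 b' k : bounded_mfun (fun w => score b' (lab b' k w) ^+ 2).
    exact: (bounded_mfunM (bs b' k) (bs b' k)).
  have b12 : bounded_mfun (fun w => score b (lab b (alpha i) w) * score (~~ b) (lab (~~ b) (beta i) w)).
    exact: bounded_mfunM.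
  have bb : bounded_mfun (fun w => score b (lab b (alpha i) w) ^+ 2 +
      score (~~ b) (lab (~~ b) (beta i) w) ^+ 2) by exact: bounded_mfunD.
  rewrite RintTZ; last by apply: bounded_mfunB => //; exact: bounded_mfunZ.
  rewrite RintTB//; last exact: bounded_mfunZ.
  rewrite RintTD// RintTZ// E12 mulr0 subr0 !(score_var_mean L) /total_var.
  by case: (b) => //=; rewrite [in RHS]addrC.
have dep i N' : depends_on lab (fun b' k => has (fun j => k == if b' == b then alpha j else beta j) (iota N' i))
   (fun w => \sum_(j < i) X (N' + j)%N w).
  move=> w w' E; apply: eq_bigr => j _; rewrite /X.
  have jn : (N' + j)%N \in iota N' i by rewrite mem_iota leq_addr ltn_add2l ltn_ord.
  congr (c * (score _ _ - score _ _)); apply: E; apply/hasP; exists (N' + j)%N => //=.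
    by rewrite eqxx.
  by case: (b).
have indep i : (i < N)%N -> indep_rv P (fun w => \sum_(j < i) X j w) (X i).
  move=> iN.
  pose K' := (\max_(k < N.+1) maxn (alpha k) (beta k)).+1.
  have HK k : (k <= N)%N -> (alpha k < K')%N /\ (beta k < K')%N.
    move=> kN; have := @leq_bigmax_cond _ xpredT (fun k : 'I_N.+1 => maxn (alpha k) (beta k)) (inord k) isT.
    by rewrite inordK// geq_max !ltnS => /andP[].
  have d1 := dep i 0%N; have := dep 1%N i.
  under [X in depends_on _ _ X]eq_fun do rewrite big_ord1 addn0.
  move=> d2; apply: (depends_indep L (N := K') _ _ _ d1 d2).
  - move=> b' k /hasP[j]; rewrite mem_iota /= => ji /eqP ->.
    by have [] := HK j (ltnW (ltn_trans ji iN)); case: ifP.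
  - move=> b' k /hasP[j]; rewrite mem_iota => /andP[ij ji] /eqP ->.
    have jN : (j <= N)%N by lia.
    by have [] := HK j jN; case: ifP.
  - move=> b' k /hasP[j]; rewrite mem_iota => ji /eqP ->.
    apply/hasPn => j'; rewrite mem_iota => /andP[ij' ji'].
    have jj : j != j' by lia.
    apply: contraNneq jj; case: ifP => _.
      by move/ia => ->//; rewrite inE; lia.
    by move/ib => ->//; rewrite inE; lia.
under eq_Rintegral do rewrite mulr_sumr.
have v0 : 0 <= c ^+ 2 * total_var by rewrite mulr_ge0 ?sqr_ge0 ?total_var_ge0.
apply: (lindeberg v0 bX) => //.
- move=> i g iN lg; have [[M gM] _] := lg.
  by apply: (indep i iN (fun u v => g (u + v)) M) => w w'.
- move=> i iN s; apply: taylor3_expectation => //.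
  by case: (bX i).
Qed.

End ustat_and_lindeberg.

(** * Smooth test functions *)

Section smooth_steps.
Context {R : realType}.
Implicit Types (f g : R -> R).

Definition cube_pos (x : R) : R := (Num.max x 0) ^+ 3.

(** When x and x + y lie on the same side of 0 the remainder is exactly y^3 or 0. Otherwise |x + y|
    <= |y|, and the remainder is still at most |y|^3. *)
Lemma taylor3_cube_pos : taylor3 1 cube_pos.
Proof.
move=> x; exists (3 * Num.max x 0 ^+ 2), (3 * Num.max x 0) => y.
rewrite mul1r /cube_pos -normrX.
have [x0|x0] := leP 0 x; have [xy0|xy0] := leP 0 (x + y).
- by rewrite le_eqVlt; apply/orP; left; apply/eqP; congr `|_|; ring.
- have y0 : y <= 0 by lra.
  rewrite expr0n /= -normrN (ler0_norm (_ : y ^+ 3 <= 0)); last first.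
    by rewrite exprn_odd_le0.
  have H : 0 <= - (x + y) ^+ 3 by rewrite oppr_ge0 exprn_odd_le0// ltW.
  have H2 : - (x + y) ^+ 3 <= - y ^+ 3.
    rewrite lerN2 -subr_ge0.
    have -> : (x + y) ^+ 3 - y ^+ 3 = x * (x ^+ 2 + 3 * x * y + 3 * y ^+ 2) by ring.
    by apply: mulr_ge0 => //; nra.
  have -> : - (0 - (x ^+ 3 + 3 * x ^+ 2 * y + 3 * x * y ^+ 2)) = (x + y) ^+ 3 - y ^+ 3 by ring.
  by rewrite ger0_norm; lra.
- rewrite !expr0n /= !(mulr0, mul0r) !addr0 subr0.
  have y0 : 0 <= y by lra.
  rewrite !ger0_norm ?exprn_ge0// lerXn2r ?nnegrE//; lra.
- by rewrite !expr0n /= !(mulr0, mul0r) !addr0 subr0 normr0.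
Qed.

Lemma taylor3_cst c : taylor3 0 (fun _ : R => c).
Proof. by move=> x; exists 0, 0 => y; rewrite !mul0r !addr0 subrr normr0. Qed.

Lemma taylor3D K1 K2 f g : taylor3 K1 f -> taylor3 K2 g ->
  taylor3 (K1 + K2) (fun x => f x + g x).
Proof.
move=> tf tg x; have [a [b H]] := tf x; have [a' [b' H']] := tg x.
exists (a + a'), (b + b') => y; rewrite [leRHS]mulrDl.
apply: (le_trans _ (lerD (H y) (H' y))); apply: (le_trans _ (ler_normD _ _)).
by rewrite le_eqVlt; apply/orP; left; apply/eqP; congr `|_|; ring.
Qed.

Lemma taylor3Z K c f : taylor3 K f -> taylor3 (`|c| * K) (fun x => c * f x).
Proof.
move=> tf x; have [a [b H]] := tf x.
exists (c * a), (c * b) => y; rewrite -[leRHS]mulrA.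
apply: (le_trans _ (ler_wpM2l (normr_ge0 c) (H y))); rewrite -normrM.
by rewrite le_eqVlt; apply/orP; left; apply/eqP; congr `|_|; ring.
Qed.

Lemma taylor3_affine K c s f : taylor3 K f -> taylor3 (K * `|c| ^+ 3) (fun x => f (c * x + s)).
Proof.
move=> tf x; have [a [b H]] := tf (c * x + s).
exists (a * c), (b * c ^+ 2) => y.
have := H (c * y); rewrite normrM [(`|c| * `|y|) ^+ 3]exprMn [K * (_ * _)]mulrA.
apply: le_trans; rewrite le_eqVlt; apply/orP; left; apply/eqP; congr `|_|.
by rewrite mulrDr addrAC; ring.
Qed.

Lemma lip_bounded_cst c : lip_bounded (fun _ : R => c).
Proof.
split; first by exists `|c|.
by exists 0 => // x y; rewrite subrr normr0 mul0r.
Qed.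

Lemma lip_boundedD f g : lip_bounded f -> lip_bounded g -> lip_bounded (fun x => f x + g x).
Proof.
move=> [[M fM] [L L0 fL]] [[N gN] [K K0 gK]]; split.
  by exists (M + N) => x; rewrite (le_trans (ler_normD _ _))// lerD.
exists (L + K) => [|x y]; first exact: addr_ge0.
rewrite mulrDl opprD addrACA (le_trans (ler_normD _ _))//.
by apply: lerD.
Qed.

Lemma lip_boundedZ c f : lip_bounded f -> lip_bounded (fun x => c * f x).
Proof.
move=> [[M fM] [L L0 fL]]; split.
  by exists (`|c| * M) => x; rewrite normrM ler_wpM2l.
exists (`|c| * L) => [|x y]; first exact: mulr_ge0.
by rewrite -mulrBr normrM -mulrA ler_wpM2l.
Qed.

Lemma lip_bounded_affine c s f : lip_bounded f -> lip_bounded (fun x => f (c * x + s)).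
Proof.
move=> [[M fM] [L L0 fL]]; split; first by exists M.
exists (L * `|c|) => [|x y]; first exact: mulr_ge0.
by rewrite (le_trans (fL _ _))// opprD addrACA subrr addr0 -mulrBr normrM mulrA.
Qed.

(* Integral of the quadratic B-spline on [0, 3]: a C^2 step with Lipschitz second derivative. *)
Definition spline_step (x : R) : R :=
  6^-1 * cube_pos x + (- 2^-1 * cube_pos (1 * x + -1) +
    (2^-1 * cube_pos (1 * x + -2) + - 6^-1 * cube_pos (1 * x + -3))).

Lemma taylor3_spline_step : exists2 K, 0 <= K & taylor3 K spline_step.
Proof.
have t3 := taylor3_cube_pos.
eexists; last first.
  apply: taylor3D; first exact: taylor3Z.
  apply: taylor3D; first by apply: taylor3Z; exact: taylor3_affine.
  by apply: taylor3D; apply: taylor3Z; exact: taylor3_affine.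
by rewrite !addr_ge0// !mulr_ge0.
Qed.

Lemma spline_stepE x :
  [/\ (x <= 0 -> spline_step x = 0),
      (0 <= x <= 1 -> spline_step x = x ^+ 3 / 6),
      (1 <= x <= 2 -> spline_step x = (x ^+ 3 - 3 * (x - 1) ^+ 3) / 6),
      (2 <= x <= 3 -> spline_step x = 1 - (3 - x) ^+ 3 / 6) &
      (3 <= x -> spline_step x = 1)].
Proof.
have pos (y : R) : 0 <= y -> cube_pos y = y ^+ 3 by move=> y0; rewrite /cube_pos max_l.
have neg (y : R) : y <= 0 -> cube_pos y = 0.
  by move=> y0; rewrite /cube_pos max_r// expr0n.
split=> [x0|/andP[x0 x1]|/andP[x0 x1]|/andP[x0 x1]|x0]; rewrite /spline_step.
- by rewrite !neg; lra.
- by rewrite (pos x)// !neg; lra.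
- by rewrite (pos x) ?(pos (1 * x + -1)) ?neg; try lra; field.
- by rewrite (pos x) ?(pos (1 * x + -1)) ?(pos (1 * x + -2)) ?neg; try lra; field.
- by rewrite !pos; try lra; field.
Qed.

Lemma spline_step01 x : 0 <= spline_step x <= 1.
Proof.
have [H1 H2 H3 H4 H5] := spline_stepE x.
have [x0|x0] := leP x 0; first by rewrite H1//; lra.
have [x1|x1] := leP x 1.
  have x01 : 0 <= x <= 1 by lra.
  have := exprn_ge0 3 (ltW x0); have := exprn_ile1 3 (ltW x0) x1.
  by rewrite H2//; lra.
have [x2|x2] := leP x 2.
  have x12 : 1 <= x <= 2 by lra.
  rewrite H3//; set t := x - 1; have t0 : 0 <= t by rewrite /t; lra.
  have t1 : t <= 1 by rewrite /t; lra.
  have -> : x = 1 + t by rewrite /t; ring.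
  have t2 : 0 <= t ^+ 2 by exact: sqr_ge0.
  have t21 : t ^+ 2 <= 1 by exact: exprn_ile1.
  have t3 : 0 <= t ^+ 3 by exact: exprn_ge0.
  have t31 : t ^+ 3 <= t ^+ 2 by rewrite exprS ler_piMl.
  have -> : (1 + t) ^+ 3 = 1 + 3 * t + 3 * t ^+ 2 + t ^+ 3 by ring.
  have t4 : 0 <= (1 - t ^+ 2) * (1 - t) by rewrite mulr_ge0 ?subr_ge0.
  have t5 : (1 - t ^+ 2) * (1 - t) = 1 - t - t ^+ 2 + t ^+ 3 by ring.
  by lra.
have [x3|x3] := leP x 3.
  have x23 : 2 <= x <= 3 by lra.
  have t0 : 0 <= 3 - x by lra.
  have t1 : 3 - x <= 1 by lra.
  have := exprn_ge0 3 t0; have := exprn_ile1 3 t0 t1.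
  by rewrite H4//; lra.
by rewrite (H5 (ltW x3)) ler01 lexx.
Qed.

Lemma cube_lip (u v : R) : 0 <= u <= 3 -> 0 <= v <= 3 -> `|u ^+ 3 - v ^+ 3| <= 27 * `|u - v|.
Proof.
move=> /andP[u0 u3] /andP[v0 v3].
have -> : u ^+ 3 - v ^+ 3 = (u ^+ 2 + u * v + v ^+ 2) * (u - v) by ring.
rewrite normrM ler_wpM2r// ger0_norm; last by rewrite !addr_ge0 ?sqr_ge0 ?mulr_ge0.
by nra.
Qed.

Lemma spline_step_lip : lip_bounded spline_step.
Proof.
split.
  by exists 1 => x; have /andP[s0 s1] := spline_step01 x; rewrite ger0_norm.
(* The spline is constant outside [0, 3], so its argument can be clamped to this interval, where
   cubes have Lipschitz constant 27. *)
pose cl (x : R) := Num.min 3 (Num.max x 0).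
have cl03 x : 0 <= cl x <= 3.
  by rewrite /cl le_min le_max lexx orbT ge_min lexx !andbT.
have clE x : spline_step x = spline_step (cl x).
  have [H1 _ _ _ H5] := spline_stepE x; have [G1 _ _ _ G5] := spline_stepE (cl x).
  have [x0|x0] := leP x 0.
    have clx : cl x = 0 by rewrite /cl max_r// min_r.
    by rewrite H1// G1 ?clx.
  have [x3|x3] := leP 3 x.
    have clx : cl x = 3 by rewrite /cl max_l ?ltW// min_l.
    by rewrite H5// G5 ?clx.
  by rewrite /cl max_l ?ltW// min_r ?ltW.
have max_lip (x y : R) : `|Num.max x 0 - Num.max y 0| <= `|x - y|.
  have := ler_norm (x - y); have := ler_norm (y - x); rewrite (distrC y) => N1 N2.
  have [?|?] := leP x 0; have [?|?] := leP y 0;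
    by rewrite ler_norml; apply/andP; split; lra.
have min_lip (x y : R) : `|Num.min 3 x - Num.min 3 y| <= `|x - y|.
  have := ler_norm (x - y); have := ler_norm (y - x); rewrite (distrC y) => N1 N2.
  have [?|?] := leP 3 x; have [?|?] := leP 3 y;
    by rewrite ler_norml; apply/andP; split; lra.
have cllip x y : `|cl x - cl y| <= `|x - y|.
  exact: le_trans (min_lip _ _) (max_lip _ _).
have cp (j : R) u v : 0 <= j -> 0 <= u <= 3 -> 0 <= v <= 3 ->
  `|cube_pos (u - j) - cube_pos (v - j)| <= 27 * `|u - v|.
  move=> j0 /andP[u0 u3] /andP[v0 v3]; rewrite /cube_pos.
  have mx z : z <= 3 -> 0 <= Num.max (z - j) 0 <= 3.
    by move=> z3; rewrite le_max lexx orbT ge_max /=; apply/andP; split; lra.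
  apply: le_trans (cube_lip (mx _ u3) (mx _ v3)) _.
  rewrite ler_wpM2l// (le_trans (max_lip _ _))// opprD addrACA subrr.
  by rewrite addr0.
(* 36 = 27 (1/6 + 1/2 + 1/2 + 1/6), from the four coefficients of the spline. *)
exists 36 => // x y; rewrite clE (clE y).
apply: (@le_trans _ _ (36 * `|cl x - cl y|)); last by rewrite ler_wpM2l.
have := cp 0 _ _ (lexx _) (cl03 x) (cl03 y); have := cp 1 _ _ ler01 (cl03 x) (cl03 y).
have := cp 2 _ _ (ler0n _ _) (cl03 x) (cl03 y); have := cp 3 _ _ (ler0n _ _) (cl03 x) (cl03 y).
rewrite /spline_step !mul1r !subr0 !ler_norml.
move=> /andP[? ?] /andP[? ?] /andP[? ?] /andP[? ?].
by apply/andP; split; lra.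
Qed.

End smooth_steps.

Section smooth_approximation.
Context {R : realType}.
Implicit Types (f psi : R -> R).

Definition smooth_step (a e x : R) : R := spline_step (3 / e * x + - (3 / e * a)).

Lemma smooth_step01 a e x : 0 <= smooth_step a e x <= 1.
Proof. exact: spline_step01. Qed.

Lemma smooth_step_lip a e : lip_bounded (smooth_step a e).
Proof. exact: lip_bounded_affine spline_step_lip. Qed.

Lemma smooth_step_taylor a e : exists2 K, 0 <= K & taylor3 K (smooth_step a e).
Proof.
have [K K0 tK] := @taylor3_spline_step R.
exists (K * `|3 / e| ^+ 3); first by rewrite mulr_ge0// exprn_ge0.
exact: taylor3_affine.
Qed.

Lemma smooth_step0 a e x : 0 < e -> x <= a -> smooth_step a e x = 0.
Proof.
move=> e0 xa; have [H _ _ _ _] := spline_stepE (3 / e * x + - (3 / e * a)).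
by apply: H; rewrite subr_le0 ler_wpM2l// divr_ge0// ltW.
Qed.

Lemma smooth_step1 a e x : 0 < e -> a + e <= x -> smooth_step a e x = 1.
Proof.
move=> e0 xa; have [_ _ _ _ H] := spline_stepE (3 / e * x + - (3 / e * a)).
apply: H; rewrite -mulrBr mulrAC ler_pdivlMr// ler_wpM2l//; lra.
Qed.

(** One step of height psi(t + del) - psi(t) is added per cell. Inside a cell F stays between two
    values of psi at neighbouring nodes, so it is off by at most eta for the variation of psi and
    eta for the step. *)
Lemma smooth_interpolation psi (t0 del eta : R) (m : nat) : 0 < del -> 0 <= eta ->
  (forall x y, `|x - y| <= del -> `|psi x - psi y| <= eta) ->
  exists F, [/\ lip_bounded F, (exists2 K, 0 <= K & taylor3 K F),
    (forall x, x <= t0 -> F x = psi t0),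
    (forall x, t0 + m%:R * del <= x -> F x = psi (t0 + m%:R * del)) &
    (forall x, t0 <= x -> x <= t0 + m%:R * del -> `|psi x - F x| <= 2 * eta)].
Proof.
move=> del0 eta0 Hpsi; elim: m => [|m [F [lF [K K0 tF] F0 F1 Fm]]].
  exists (fun=> psi t0); split => //.
  - exact: lip_bounded_cst.
  - by exists 0 => //; exact: taylor3_cst.
  - by move=> x _; rewrite mul0r addr0.
  - move=> x x0; rewrite mul0r addr0 => x1.
    have -> : x = t0 by apply/eqP; rewrite eq_le x0 x1.
    by rewrite subrr normr0 mulr_ge0.
set t := t0 + m%:R * del in F1 Fm.
have tS : t0 + m.+1%:R * del = t + del by rewrite -natr1 mulrDl mul1r addrA.
have t0t : t0 <= t by rewrite /t lerDl mulr_ge0// ltW.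
rewrite tS.
exists (fun x => F x + (psi (t + del) - psi t) * smooth_step t del x); split.
- by apply: lip_boundedD => //; apply: lip_boundedZ; exact: smooth_step_lip.
- have [K' K'0 tK'] := smooth_step_taylor t del.
  exists (K + `|psi (t + del) - psi t| * K'); first by rewrite addr_ge0// mulr_ge0.
  by apply: taylor3D => //; exact: taylor3Z.
- by move=> x x0; rewrite F0// smooth_step0 ?mulr0 ?addr0// (le_trans x0).
- move=> x x0; rewrite smooth_step1// mulr1 F1; last by rewrite (le_trans _ x0)// lerDl ltW.
  by rewrite subrKC.
- move=> x x0 x1; have [xt|/ltW xt] := leP x t.
    by rewrite smooth_step0// mulr0 addr0 Fm.
  rewrite F1// opprD addrA (le_trans (ler_normB _ _))//.
  have -> : 2 * eta = eta + eta by ring.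
  rewrite lerD//.
    by apply: Hpsi; rewrite ger0_norm; lra.
  have /andP[s0 s1] := smooth_step01 t del x.
  rewrite normrM (ger0_norm s0) -[leRHS]mulr1 ler_pM//.
  by apply: Hpsi; rewrite addrAC subrr add0r ger0_norm// ltW.
Qed.

(** F is constant outside a bounded interval, so uniform closeness is out of reach there; the weight
    1 + x^2 absorbs the bound 2 far away and costs only a second moment when integrated. *)
Lemma smooth_approximation psi (eta : R) : 0 < eta -> (forall x, `|psi x| <= 1) ->
  (forall e, 0 < e -> exists2 del, 0 < del &
     forall x y, `|x - y| <= del -> `|psi x - psi y| <= e) ->
  exists F, [/\ lip_bounded F, (exists2 K, 0 <= K & taylor3 K F) &
    forall x, `|psi x - F x| <= eta * (1 + x ^+ 2)].
Proof.
move=> eta0 psi1 uc; have [del del0 Hdel] := uc (eta / 2) (divr_gt0 eta0 (ltr0n _ 2)).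
(* Chosen so that eta A >= 2 and A >= 1, whence eta (1 + x^2) >= 2 as soon as |x| >= A. *)
pose A := 1 + 2 / eta.
have A1 : 1 <= A by rewrite lerDl divr_ge0// ltW.
have A2 x : A ^+ 2 <= x ^+ 2 -> 2 <= eta * (1 + x ^+ 2).
  move=> Ax; have : 2 <= eta * A by rewrite /A mulrDr mulr1 mulrCA divff ?gt_eqF// mulr1 lerDr ltW.
  move=> H; rewrite (le_trans H)// ler_wpM2l ?(ltW eta0)//.
  have : A <= A ^+ 2 by rewrite expr2 ler_peMl// (le_trans _ A1).
  lra.
pose m := (Num.truncn (2 * A / del)).+1.
have mA : 2 * A <= m%:R * del.
  by rewrite -ler_pdivrMr// ltW// truncnS_gt.
have e20 : 0 <= eta / 2 by rewrite divr_ge0// ltW.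
have [F [lF tF F0 F1 Fm]] := @smooth_interpolation psi (- A) del (eta / 2) m del0 e20 Hdel.
exists F; split => // x.
have two y : `|psi x - psi y| <= 2.
  by rewrite (le_trans (ler_normB _ _))// -[2]/(1 + 1) lerD.
have [xA|/ltW xA] := leP x (- A).
  rewrite F0// (le_trans (two _))// A2// -(sqrrN x) lerXn2r ?nnegrE; lra.
have [Ax|/ltW Ax] := leP (- A + m%:R * del) x.
  rewrite F1// (le_trans (two _))// A2// lerXn2r ?nnegrE; lra.
rewrite (le_trans (Fm _ xA Ax))//.
by have := sqr_ge0 x; nra.
Qed.

End smooth_approximation.

(** * Control of a Lipschitz path from its values on a grid *)

Section grid.
Context {R : realType}.

Lemma grid_lipschitz (F : nat -> R) (N x0 g J : nat) (l t : R) : (0 < g)%N -> 0 <= l ->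
  (forall x y, (x <= N)%N -> (y <= N)%N -> `|F x - F y| <= l * `|x%:R - y%:R|) ->
  (x0 + J * g <= N)%N -> (J * g <= x0)%N ->
  (forall j, (j <= J)%N -> `|F (x0 + j * g)%N| <= t /\ `|F (x0 - j * g)%N| <= t) ->
  forall x, (x <= x0 + J * g)%N -> (x0 - J * g <= x)%N -> `|F x| <= t + l * g%:R.
Proof.
move=> g0 l0 FL JN Jx Ft x xu xl.
have close y : (y <= N)%N -> `|F y| <= t -> `|x%:R - y%:R| <= g%:R :> R ->
    `|F x| <= t + l * g%:R.
  move=> yN Fy xy; rewrite -(subrK (F y) (F x)) addrC (le_trans (ler_normD _ _))// lerD//.
  by rewrite (le_trans (FL _ _ _ yN))// ?ler_wpM2l//; lia.
have natdist a b c : (a <= b)%N -> (b <= a + c)%N -> `|a%:R - b%:R| <= c%:R :> R.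
  by move=> ab bc; rewrite distrC -natrB// normr_nat ler_nat leq_subLR.
have [xx0|xx0] := leqP x0 x.
  (* Rounding towards the centre x0 keeps the grid point inside the controlled range. *)
  pose j := ((x - x0) %/ g)%N.
  have jJ : (j <= J)%N by rewrite -(mulnK J g0) leq_div2r// leq_subLR.
  have E : (x = x0 + j * g + (x - x0) %% g)%N by rewrite -addnA -divn_eq subnKC.
  have xg : ((x - x0) %% g < g)%N by rewrite ltn_mod.
  have [Fj _] := Ft j jJ; apply: close Fj _.
    by rewrite (leq_trans _ JN)// leq_add2l leq_mul2r jJ orbT.
  by rewrite distrC; apply: natdist; lia.
pose j := ((x0 - x) %/ g)%N.
have jJ : (j <= J)%N by rewrite -(mulnK J g0) leq_div2r//; lia.
have E : (x0 - x = j * g + (x0 - x) %% g)%N by rewrite -divn_eq.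
have xg : ((x0 - x) %% g < g)%N by rewrite ltn_mod.
have jg : (j * g <= J * g)%N by rewrite leq_mul2r jJ orbT.
have [_ Fj] := Ft j jJ; apply: close Fj _; first by lia.
by apply: natdist; lia.
Qed.

End grid.

(** * Balanced reading paths *)

Lemma window_le (x y h b : nat) :
  (x <= h + b)%N -> (y <= b)%N -> (2 * b <= h)%N -> (x + y <= 2 * h)%N.
Proof. by lia. Qed.

Lemma window_ge (x y h b : nat) :
  (h - b <= x)%N -> (y <= b)%N -> (2 * b <= h)%N -> (y <= x)%N.
Proof. by lia. Qed.

Lemma window_dist (x y h b r : nat) :
  (h - b <= x)%N -> (x <= h + b)%N -> (r <= x + y)%N -> (x - y <= r)%N ->
  (y <= b)%N -> (r <= h + 2 * b)%N /\ (h <= r + 2 * b)%N.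
Proof. by lia. Qed.

Section balanced_path.
Context {R : realType}.
Variables (mu : R) (X Y : nat -> R) (U : nat -> nat -> R) (h b : nat).
Hypotheses (mu0 : 0 < mu) (mu1 : mu <= 1).
Hypothesis X_lip : forall x y, `|X x - X y| <= `|x%:R - y%:R|.
Hypothesis Y_lip : forall x y, `|Y x - Y y| <= `|x%:R - y%:R|.
Hypothesis X_mono : forall x y, (x <= y)%N -> X x + mu * x%:R <= X y + mu * y%:R.
Hypothesis Y_mono : forall x y, (x <= y)%N -> Y x + mu * x%:R <= Y y + mu * y%:R.
Hypothesis bh : (2 * b <= h)%N.

(* [X] and [Y] are the centred score walks of R and S, [U] the degenerate part of the
   match count. [excess x] is what reading [x] R-records and [2 h - x] S-records, instead
   of [h] each, adds to [X + Y]. At the greedy count [x], [late_gap x] cancels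
   [2 mu (x - h - drift)] up to an error of 1. *)
Definition hoeffding_matches (m n : nat) : R :=
  mu * m%:R * n%:R + n%:R * X m + m%:R * Y n + U m n.

Definition excess (x : nat) : R := X x - X h + (Y (2 * h - x) - Y h).

Definition late_gap (x : nat) : R :=
  (X x - X (h - 2 * b)) - (Y (2 * h - x) - Y (h - 2 * b)).

Definition drift : R := (Y (h - 2 * b) - X (h - 2 * b)) / (2 * mu).

(* Prediction, from the labels read before time [2 (h - 2 b)], of the number of
   R-records the greedy policy has read at time [2 h]. *)
Definition predicted : nat :=
  minn (h + b) (maxn (h - b) (Num.truncn (h%:R + drift))).

Lemma predicted_bounds : (h - b <= predicted <= h + b)%N.
Proof. by rewrite /predicted; lia. Qed.

(** The bound on the drift makes the clamping inactive; what remains is the error of rounding down,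
    which lies between -1 and 0. *)
Lemma predicted_drift : `|drift| < b%:R - 1 ->
  -1 <= predicted%:R - h%:R - drift <= 0.
Proof.
rewrite ltr_norml => /andP[d1 d2].
have bh' : b%:R <= h%:R :> R by rewrite ler_nat; lia.
have hd0 : 0 <= h%:R + drift by lra.
have hi := truncn_le (h%:R + drift); rewrite hd0 in hi.
have lo := truncnS_gt (h%:R + drift).
have E : predicted = Num.truncn (h%:R + drift).
  rewrite /predicted.
  have : (Num.truncn (h%:R + drift) <= h + b)%N.
    rewrite -(ler_nat R) natrD; lra.
  have : (h - b <= Num.truncn (h%:R + drift))%N.
    rewrite -ltnS -(ltr_nat R) natrB; last by lia.
    lra.
  by lia.
rewrite E -natr1 in lo *; lra.
Qed.

Lemma excess_lip x y : (x <= 2 * h)%N -> (y <= 2 * h)%N ->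
  `|excess x - excess y| <= 2 * `|x%:R - y%:R|.
Proof.
move=> xh yh; rewrite /excess.
have -> : X x - X h + (Y (2 * h - x) - Y h) - (X y - X h + (Y (2 * h - y) - Y h)) =
  (X x - X y) + (Y (2 * h - x) - Y (2 * h - y)) by ring.
rewrite (le_trans (ler_normD _ _))// mulr_natl mulr2n lerD//.
rewrite (le_trans (Y_lip _ _))// distrC.
by have -> : (2 * h - y)%:R - (2 * h - x)%:R = x%:R - y%:R :> R; rewrite ?natrB//; ring.
Qed.

Variable (r : nat).
Hypothesis r2h : (r <= 2 * h)%N.
Hypothesis balanced :
  `|(X r + mu * r%:R) - (Y (2 * h - r) + mu * (2 * h - r)%:R)| <= 1.

(** Exact form of Gamma_R - Gamma_S after reading x and 2h - x records: labels before h - 2b enter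
    only through the drift, the others only through [late_gap]. *)
Lemma late_gapE x : (x <= 2 * h)%N ->
  X x + mu * x%:R - (Y (2 * h - x) + mu * (2 * h - x)%:R) =
  2 * mu * (x%:R - h%:R - drift) + late_gap x.
Proof.
move=> xh; rewrite natrB// natrM /late_gap /drift; field.
by rewrite gt_eqF.
Qed.

(** Gamma_R - Gamma_S increases with the number x of R-records. At [predicted + y] it exceeds 2 mu
    (y - 1) - mu y, hence 1, by the assumption on y; symmetrically it is below -1 at
    [predicted - y]. A balanced r therefore lies between the two points. *)
Lemma balanced_localization (y : nat) : (y <= b)%N -> 2 * mu + 1 <= mu * y%:R ->
  `|drift| < b%:R - 1 ->
  `|late_gap (predicted + y)| < mu * y%:R ->
  `|late_gap (predicted - y)| < mu * y%:R ->
  (r <= predicted + y)%N /\ (predicted - y <= r)%N.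
Proof.
move=> yb ymu db Vp Vm; have /andP[pl pu] := predicted_bounds.
have /andP[d1 d2] := predicted_drift db.
move: balanced; rewrite ler_norml => /andP[B1 B2].
split; rewrite leqNgt; apply/negP => H.
- have := X_mono (ltnW H).
  have yle : (2 * h - r <= 2 * h - (predicted + y))%N by rewrite leq_sub2l// ltnW.
  have := Y_mono yle.
  have pyh : (predicted + y <= 2 * h)%N by exact: window_le pu yb bh.
  have := late_gapE pyh; rewrite natrD; move: Vp; rewrite ltr_norml => /andP[V1 V2].
  move=> E H1 H2.
  have : 2 * mu * (-1 + y%:R) <= 2 * mu * (predicted%:R + y%:R - h%:R - drift).
    by apply: ler_wpM2l; [rewrite mulr_ge0// ltW|lra].
  lra.
- have := X_mono (ltnW H).
  have yle : (2 * h - (predicted - y) <= 2 * h - r)%N by rewrite leq_sub2l// ltnW.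
  have := Y_mono yle.
  have pyh : (predicted - y <= 2 * h)%N.
    by rewrite (leq_trans (leq_subr _ _))// (leq_trans (leq_addr y _))//; exact: window_le pu yb bh.
  have yp : (y <= predicted)%N by exact: window_ge pl yb bh.
  have := late_gapE pyh; move: Vm; rewrite ltr_norml => /andP[V1 V2].
  rewrite [in X in _ = X](natrB _ yp); set c := 2 * mu * _.
  have cle : c <= - (2 * (mu * y%:R)).
    have -> : - (2 * (mu * y%:R)) = 2 * mu * (- y%:R) by ring.
    by apply: ler_wpM2l; [rewrite mulr_ge0// ltW|lra].
  move=> E H1 H2; have : -1 <= c + late_gap (predicted - y).
    by rewrite -E (le_trans B1)// lerB.
  have z1 : 1 <= mu * y%:R by rewrite (le_trans _ ymu)// lerDr mulr_ge0// ltW.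
  have zE : - (2 * (mu * y%:R)) + mu * y%:R = - (mu * y%:R) by ring.
  have := ler_ltD cle V2; rewrite zE => lt1 le1.
  by have := lt_le_trans (le_lt_trans le1 lt1) (_ : - (mu * y%:R) <= -1); rewrite lerN2 ltxx => /(_ z1).
Qed.

(** With delta = r - h, unequal counts cost -mu delta^2 and the linear terms leave -delta (X r - Y
    (2h - r)). Balance says that X r - Y (2h - r) is -2 mu delta up to 1, so the two combine to mu
    delta^2 + O(|delta|), which is small against h^(5/4). *)
Lemma hoeffding_difference :
  `|hoeffding_matches r (2 * h - r) - hoeffding_matches h h - h%:R * excess r| <=
  mu * (r%:R - h%:R) ^+ 2 + `|r%:R - h%:R| + `|U r (2 * h - r)| + `|U h h|.
Proof.
pose E := (Y (2 * h - r) + mu * (2 * h - r)%:R) - (X r + mu * r%:R).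
have E1 : `|E| <= 1 by rewrite distrC.
have -> : hoeffding_matches r (2 * h - r) - hoeffding_matches h h - h%:R * excess r =
  mu * (r%:R - h%:R) ^+ 2 + (r%:R - h%:R) * E + U r (2 * h - r) - U h h.
  by rewrite /hoeffding_matches /excess /E natrB// natrM; ring.
rewrite (le_trans (ler_normB _ _))// lerD// (le_trans (ler_normD _ _))// lerD//.
rewrite (le_trans (ler_normD _ _))// lerD//.
  by rewrite ger0_norm// mulr_ge0 ?sqr_ge0// ltW.
by rewrite normrM ler_piMr.
Qed.

(** Localization places r within q^5 of the prediction and within 2 q^9 of h. The grid bound is used
    once around the prediction, for [excess], and once around h, for U, whose larger Lipschitz
    constant 8 h is still affordable at mesh q^3. *)
Lemma balanced_comparison (q : nat) (tT tU : R) : (0 < q)%N ->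
  b = (q ^ 9)%N -> 2 * mu + 1 <= mu * (q ^ 5)%:R ->
  (forall x y, (x <= 2 * h)%N -> (y <= 2 * h)%N ->
    `|U x (2 * h - x) - U y (2 * h - y)| <= 8 * h%:R * `|x%:R - y%:R|) ->
  `|drift| < b%:R - 1 ->
  `|late_gap (predicted + q ^ 5)| < mu * (q ^ 5)%:R ->
  `|late_gap (predicted - q ^ 5)| < mu * (q ^ 5)%:R ->
  (forall j, (j <= q ^ 2)%N ->
    `|excess (predicted + j * q ^ 3) - excess predicted| <= tT /\
    `|excess (predicted - j * q ^ 3) - excess predicted| <= tT) ->
  (forall j, (j <= 2 * q ^ 6)%N ->
    `|U (h + j * q ^ 3) (2 * h - (h + j * q ^ 3))| <= tU /\
    `|U (h - j * q ^ 3) (2 * h - (h - j * q ^ 3))| <= tU) ->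
  `|hoeffding_matches r (2 * h - r) - hoeffding_matches h h - h%:R * excess predicted| <=
  4 * q%:R ^+ 18 + 2 * q%:R ^+ 9 + h%:R * (tT + 2 * q%:R ^+ 3) +
    (2 * tU + 8 * h%:R * q%:R ^+ 3).
Proof.
move=> q0 bE ymu U_lip db Vp Vm HT HU.
have g0 : (0 < q ^ 3)%N by rewrite expn_gt0 q0.
have E5 : (q ^ 2 * q ^ 3 = q ^ 5)%N by rewrite -expnD.
have E9 : (2 * q ^ 6 * q ^ 3 = 2 * b)%N by rewrite bE -mulnA -expnD.
have y59 : (q ^ 5 <= b)%N by rewrite bE leq_pexp2l.
have [ru rl] := balanced_localization y59 ymu db Vp Vm.
have /andP[pl pu] := predicted_bounds.
have rh : `|r%:R - h%:R| <= (2 * b)%:R :> R.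
  have [r1' r2'] := window_dist pl pu ru rl y59.
  have r1 : r%:R <= h%:R + (2 * b)%:R :> R by rewrite -natrD ler_nat.
  have r2 : h%:R <= r%:R + (2 * b)%:R :> R by rewrite -natrD ler_nat.
  by rewrite ler_norml; apply/andP; split; lra.
have HT' : `|excess r - excess predicted| <= tT + 2 * (q ^ 3)%:R.
  apply: (@grid_lipschitz R (fun x => excess x - excess predicted) (2 * h) predicted (q ^ 3) (q ^ 2) 2 tT g0 (ler0n _ _)).
  - by move=> x y xh yh; rewrite opprB addrA subrK; exact: excess_lip.
  - by rewrite E5; exact: window_le pu y59 bh.
  - by rewrite E5; exact: window_ge pl y59 bh.
  - exact: HT.
  - by rewrite E5.
  - by rewrite E5.
have l0 : 0 <= 8 * h%:R :> R by rewrite mulr_ge0.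
have HU' : `|U r (2 * h - r)| <= tU + 8 * h%:R * (q ^ 3)%:R.
  apply: (@grid_lipschitz R (fun x => U x (2 * h - x)) (2 * h) h (q ^ 3) (2 * q ^ 6) _ _ g0 l0 U_lip).
  - by rewrite E9 (mulSn 1 h) mul1n leq_add2l.
  - by rewrite E9.
  - exact: HU.
  - by rewrite E9; have [] := window_dist pl pu ru rl y59.
  - by rewrite E9 leq_subLR addnC; have [] := window_dist pl pu ru rl y59.
have HU0 : `|U h h| <= tU.
  have [+ _] := HU 0%N isT; rewrite mul0n addn0.
  by rewrite mulSn mul1n addnK.
have -> : hoeffding_matches r (2 * h - r) - hoeffding_matches h h - h%:R * excess predicted =
  (hoeffding_matches r (2 * h - r) - hoeffding_matches h h - h%:R * excess r) +
  h%:R * (excess r - excess predicted) by ring.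
apply: (le_trans (ler_normD _ _)).
have h1 := hoeffding_difference.
have h2 : `|h%:R * (excess r - excess predicted)| <= h%:R * (tT + 2 * q%:R ^+ 3).
  by rewrite normrM normr_nat ler_wpM2l// -natrX.
have h3 : mu * (r%:R - h%:R) ^+ 2 <= 4 * q%:R ^+ 18.
  apply: (@le_trans _ _ (1 * ((2 * b)%:R) ^+ 2)).
    apply: ler_pM => //; [exact: ltW|exact: sqr_ge0|].
    by rewrite -real_normK ?num_real// lerXn2r ?nnegrE.
  by rewrite mul1r natrM exprMn bE natrX -exprM (_ : 2%:R ^+ 2 = 4 :> R)//; ring.
have h4 : `|r%:R - h%:R| <= 2 * q%:R ^+ 9 :> R.
  by rewrite (le_trans rh)// natrM bE natrX.
rewrite natrX in HU'.
lra.
Qed.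

End balanced_path.

(** * Probability of the bad event *)

Section union_bound.
Context d (T : measurableType d) (R : realType) (P : probability T R).

Lemma bool_bounded_mfun (b : T -> bool) : discrete_rv b ->
  bounded_mfun (fun w => (b w)%:R : R).
Proof.
move=> db; split; first exact/discrete_rv_mfun/(discrete_rv_comp (fun x : bool => x%:R : R)).
by exists 1 => w; case: (b w); rewrite ?normr1 ?normr0.
Qed.

Lemma prb_or (b1 b2 : T -> bool) : discrete_rv b1 -> discrete_rv b2 ->
  prb P (fun w => b1 w || b2 w) <= prb P b1 + prb P b2.
Proof.
move=> d1 d2; rewrite /prb -RintTD; [|exact: bool_bounded_mfun|exact: bool_bounded_mfun].
apply: le_RintT.
- by apply: bool_bounded_mfun; exact: discrete_rv_comp2.
- by apply: bounded_mfunD; exact: bool_bounded_mfun.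
- by move=> w; case: (b1 w); case: (b2 w); rewrite /= ?addr0 ?add0r// lerDl.
Qed.

Lemma has_discrete (B : nat -> T -> bool) (s : seq nat) : (forall j, discrete_rv (B j)) ->
  discrete_rv (fun w => has (B ^~ w) s).
Proof.
move=> dB; elim: s => [|j s IH] /=; first exact: discrete_rv_cst.
exact: discrete_rv_comp2.
Qed.

Lemma prb_has (B : nat -> T -> bool) (s : seq nat) (c : R) : (forall j, discrete_rv (B j)) ->
  (forall j, j \in s -> prb P (B j) <= c) ->
  prb P (fun w => has (B ^~ w) s) <= (size s)%:R * c.
Proof.
move=> dB; elim: s => [_|j s IH Hc] /=.
  by rewrite mul0r /prb /= RintT_cst.
apply: le_trans (prb_or (dB j) (has_discrete _ dB)) _.
rewrite -natr1 mulrDl mul1r addrC lerD//.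
  by apply: IH => i si; apply: Hc; rewrite inE si orbT.
by apply: Hc; rewrite inE eqxx.
Qed.

End union_bound.

(** * Late statistics evaluated at the predicted index *)

Section random_index.
Context d (T : measurableType d) (R : realType) (P : probability T R).
Variables (p : bool -> nat -> R) (lab : bool -> nat -> T -> nat).
Hypothesis L : iid_labels P lab p.
Variables (h b : nat).
Hypothesis bh : (2 * b <= h)%N.
Notation m := (label_mean p).
Hypothesis m0 : 0 < m.

Definition walk_at (s : bool) (w : T) : nat -> R := fun k => walk p lab s k w.

Definition pred_at (w : T) : nat :=
  predicted m (walk_at true w) (walk_at false w) h b.

Definition excess_at (x : nat) (w : T) : R := excess (walk_at true w) (walk_at false w) h x.

Definition late_gap_at (x : nat) (w : T) : R :=
  late_gap (walk_at true w) (walk_at false w) h b x.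

Definition drift_at (w : T) : R := drift m (walk_at true w) (walk_at false w) h b.

(** The cut is at h - 2b while the prediction is clamped to [h - b, h + b]: points at distance up to
    b from the prediction still involve late labels only. *)
Let early (_ : bool) (j : nat) := (j < h - 2 * b)%N.
Let late (_ : bool) (j : nat) := (h - 2 * b <= j < 2 * h)%N.

Lemma drift_depends : depends_on lab early drift_at.
Proof.
move=> w w' E; rewrite /drift_at /drift /walk_at.
by rewrite (@walk_depends _ _ _ p lab false _ w w')// (@walk_depends _ _ _ p lab true _ w w').
Qed.

Lemma pred_depends : depends_on lab early pred_at.
Proof.
move=> w w' E; have := drift_depends E; rewrite /drift_at => {}E.
by rewrite /pred_at /predicted E.
Qed.

Let early_lt (s : bool) j : early s j -> (j < 2 * h)%N.
Proof. by rewrite /early; lia. Qed.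

Let late_lt (s : bool) j : late s j -> (j < 2 * h)%N.
Proof. by rewrite /late; lia. Qed.

Let early_late (s : bool) j : early s j -> ~~ late s j.
Proof. by rewrite /early /late; lia. Qed.

Let win x := (h - 2 * b <= x <= h + 2 * b)%N.

Lemma late_gap_depends x : win x -> depends_on lab late (late_gap_at x).
Proof.
move=> wx w w' E; rewrite /late_gap_at /late_gap /walk_at.
congr (_ - _).
  by apply: (@walk_dist_depends _ _ _ p lab (h - 2 * b) (2 * h) true x (h - 2 * b) _ _ w w' E);
    move: wx bh; rewrite /win; lia.
by apply: (@walk_dist_depends _ _ _ p lab (h - 2 * b) (2 * h) false (2 * h - x) (h - 2 * b) _ _ w w' E);
  move: wx bh; rewrite /win; lia.
Qed.

Lemma excess_depends x : win x -> depends_on lab late (excess_at x).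
Proof.
move=> wx w w' E; rewrite /excess_at /excess /walk_at.
congr (_ + _).
  by apply: (@walk_dist_depends _ _ _ p lab (h - 2 * b) (2 * h) true x h _ _ w w' E);
    move: wx bh; rewrite /win; lia.
by apply: (@walk_dist_depends _ _ _ p lab (h - 2 * b) (2 * h) false (2 * h - x) h _ _ w w' E);
  move: wx bh; rewrite /win; lia.
Qed.

Lemma pred_discrete : discrete_rv pred_at.
Proof. exact: (depends_discrete L early_lt pred_depends). Qed.

Lemma drift_discrete : discrete_rv drift_at.
Proof. exact: (depends_discrete L early_lt drift_depends). Qed.

Lemma pred_indep (V : Type) (G : T -> V) : depends_on lab late G -> indep_rv P pred_at G.
Proof. by move=> dG; exact: (depends_indep L early_lt late_lt early_late pred_depends dG). Qed.

Lemma late_discrete (V : Type) (G : T -> V) : depends_on lab late G -> discrete_rv G.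
Proof. by move=> dG; exact: (depends_discrete L late_lt dG). Qed.

Let winb x := (h - b <= x <= h + b)%N.

(* Conditionally on the (early) prediction, a late statistic indexed by it keeps its law. *)
Lemma prb_random_index (Z : nat -> T -> R) (t c : R) : 0 < t ->
  (forall x, winb x -> depends_on lab late (Z x)) ->
  (forall x, winb x -> bounded_mfun (Z x)) ->
  (forall x, winb x -> \int[P]_w (Z x w ^+ 2) <= c) ->
  prb P (fun w => t <= `|Z (pred_at w) w|) <= c / t ^+ 2.
Proof.
move=> t0 dZ bZ Zc.
(* The whole path x -> Z x w, cut off outside the window, is a single late random element. It is
   independent of the prediction, which may then be frozen. *)
pose G w (x : nat) : R := if winb x then Z x w else 0.
have dG : depends_on lab late G.
  move=> w w' E; apply/funext => x; rewrite /G; case: ifP => // wx.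
  by apply: dZ.
have predw w : winb (pred_at w).
  by have /andP[_ m1] := label_mean01 L; exact: predicted_bounds.
rewrite /prb (_ : (fun w => _) = (fun w => (t <= `|G w (pred_at w)|)%R%:R)); last first.
  by apply/funext => w; rewrite /G predw.
apply: (@indep_rv_le _ _ _ P nat (nat -> R) pred_at G
   (fun x (g : nat -> R) => (t <= `|g x|)%R%:R) 1).
- exact: pred_indep.
- exact: pred_discrete.
- exact: late_discrete.
- by move=> w w'; case: (t <= _); rewrite ?normr1 ?normr0.
- move=> w; rewrite /G predw.
  have H := predw w; set x := pred_at w in H *.
  apply: le_trans (chebyshev_le P t0 (bZ _ H) (late_discrete (dZ _ H))) _.
  by apply: ler_wpM2r; [rewrite invr_ge0 exprn_ge0// ltW|exact: Zc].
Qed.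

Lemma walk_dist_bounded s k l : bounded_mfun (fun w => walk p lab s k w - walk p lab s l w).
Proof. by apply: bounded_mfunB; exact: (walk_bounded L). Qed.

Lemma sum_sqr_moment (A B : T -> R) (x y : R) : bounded_mfun A -> bounded_mfun B ->
  \int[P]_w (A w ^+ 2) <= x -> \int[P]_w (B w ^+ 2) <= y ->
  \int[P]_w ((A w + B w) ^+ 2) <= 2 * x + 2 * y.
Proof.
move=> bA bB Ax By.
have bA2 : bounded_mfun (fun w => A w ^+ 2) by exact: bounded_mfunM.
have bB2 : bounded_mfun (fun w => B w ^+ 2) by exact: bounded_mfunM.
have bAB := bounded_mfunD bA bB.
apply: (@le_trans _ _ (\int[P]_w (2 * A w ^+ 2 + 2 * B w ^+ 2))).
  apply: le_RintT.
  - exact: (bounded_mfunM bAB bAB).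
  - by apply: bounded_mfunD; exact: bounded_mfunZ.
  - by move=> w; have := sqr_ge0 (A w - B w); nra.
rewrite RintTD; [|exact: bounded_mfunZ|exact: bounded_mfunZ].
by rewrite !RintTZ// lerD// ler_wpM2l.
Qed.

Lemma late_gap_bounded x : bounded_mfun (late_gap_at x).
Proof. by apply: bounded_mfunB; exact: walk_dist_bounded. Qed.

Lemma excess_bounded x : bounded_mfun (excess_at x).
Proof. by apply: bounded_mfunD; exact: walk_dist_bounded. Qed.

Lemma excess_dist_bounded x y : bounded_mfun (fun w => excess_at x w - excess_at y w).
Proof. by apply: bounded_mfunB; exact: excess_bounded. Qed.

(** The two walk increments together span exactly 4b labels, and the square of their difference
    costs a factor 2. *)
Lemma late_gap_moment x : win x -> \int[P]_w (late_gap_at x w ^+ 2) <= 8 * b%:R.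
Proof.
move=> /andP[x1 x2]; rewrite /late_gap_at /late_gap.
have E k l : (l <= k)%N -> \int[P]_w ((walk p lab true k w - walk p lab true l w) ^+ 2) <= (k - l)%:R.
  by move=> lk; apply: le_trans (walk_dist_moment L _ _ _) _; rewrite -natrB// normr_nat.
have bN : bounded_mfun (fun w => - (walk p lab false (2 * h - x) w - walk p lab false (h - 2 * b) w)).
  have := bounded_mfunZ (-1) (walk_dist_bounded false (2 * h - x) (h - 2 * b)).
  by under eq_fun do rewrite mulN1r.
apply: le_trans (sum_sqr_moment (walk_dist_bounded true x (h - 2 * b)) bN
  (walk_dist_moment L true _ _) _) _.
  under eq_Rintegral do rewrite sqrrN.
  exact: (walk_dist_moment L false).
have e1 : (h - 2 * b <= 2 * h - x)%N by lia.
rewrite -!natrB// !normr_nat -mulrDr -natrD -!natrM ler_nat.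
by lia.
Qed.

Lemma excess_dist_moment x y : (x <= 2 * h)%N -> (y <= 2 * h)%N ->
  \int[P]_w ((excess_at x w - excess_at y w) ^+ 2) <= 4 * `|x%:R - y%:R|.
Proof.
move=> xh yh.
have E w : excess_at x w - excess_at y w =
  (walk p lab true x w - walk p lab true y w) +
  (walk p lab false (2 * h - x) w - walk p lab false (2 * h - y) w).
  by rewrite /excess_at /excess /walk_at; ring.
under eq_Rintegral do rewrite E.
apply: le_trans (sum_sqr_moment (walk_dist_bounded _ _ _) (walk_dist_bounded _ _ _)
  (walk_dist_moment L true _ _) (walk_dist_moment L false _ _)) _.
have -> : (2 * h - x)%:R - (2 * h - y)%:R = y%:R - x%:R :> R by rewrite ?natrB//; ring.
by rewrite (distrC y%:R); lra.
Qed.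

Lemma walk_gap_moment k :
  \int[P]_w ((walk p lab false k w - walk p lab true k w) ^+ 2) <= 4 * k%:R.
Proof.
have bN : bounded_mfun (fun w => - walk p lab true k w).
  have := bounded_mfunZ (-1) (walk_bounded L true k).
  by under eq_fun do rewrite mulN1r.
have H s : \int[P]_w (walk p lab s k w ^+ 2) <= k%:R.
  have := walk_dist_moment L s k 0; rewrite subr0 normr_nat.
  by under eq_Rintegral do rewrite walk0 subr0.
apply: le_trans (sum_sqr_moment (walk_bounded L false k) bN (H _) _) _.
  by under eq_Rintegral do rewrite sqrrN; exact: H.
lra.
Qed.

Lemma drift_moment : \int[P]_w (drift_at w ^+ 2) <= h%:R / m ^+ 2.
Proof.
rewrite /drift_at /drift /walk_at.
under eq_Rintegral do rewrite expr_div_n mulrC.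
have bg : bounded_mfun (fun w => walk p lab false (h - 2 * b) w - walk p lab true (h - 2 * b) w).
  by apply: bounded_mfunB; exact: (walk_bounded L).
rewrite RintTZ; last exact: (bounded_mfunM bg bg).
have m2 : 0 < (2 * m) ^+ 2 by rewrite exprn_gt0// mulr_gt0.
rewrite mulrC ler_pdivrMr//.
apply: le_trans (walk_gap_moment _) _.
have -> : h%:R / m ^+ 2 * (2 * m) ^+ 2 = 4 * h%:R by field; rewrite gt_eqF.
by rewrite ler_wpM2l// ler_nat leq_subr.
Qed.

Lemma drift_bounded : bounded_mfun drift_at.
Proof.
have := bounded_mfunZ (2 * m)^-1 (bounded_mfunB (walk_bounded L false (h - 2 * b))
  (walk_bounded L true (h - 2 * b))).
by under eq_fun do rewrite mulrC.
Qed.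

End random_index.

(** The countable type that encodes [Z x] varies with x, so the encoding of the composite takes
    values in the sigma type of all of them, which is again countable. *)
Lemma discrete_rv_index d (T : measurableType d) (U : Type) (F : T -> nat)
    (Z : nat -> T -> U) :
  discrete_rv F -> (forall x, discrete_rv (Z x)) -> discrete_rv (fun w => Z (F w) w).
Proof.
move=> dF dZ.
pose I x : countType := projT1 (cid (dZ x)).
pose X x : T -> I x := projT1 (cid (projT2 (cid (dZ x)))).
pose g x : I x -> U := projT1 (cid (projT2 (cid (projT2 (cid (dZ x)))))).
have XP x : fibers_measurable (X x) /\ forall w, Z x w = g x (X x w).
  exact: projT2 (cid (projT2 (cid (projT2 (cid (dZ x)))))).
exists {x : nat & I x}, (fun w => Tagged I (X (F w) w)), (fun u => g (tag u) (tagged u)).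
split; last by move=> w; case: (XP (F w)).
move=> [x i].
rewrite (_ : mkset _ = (F @^-1` [set x]) `&` [set w | X x w = i]).
  by apply: measurableI; [exact: discrete_rv_preimage|case: (XP x)].
apply/seteqP; split => w /=.
  move=> E; have Fx : F w = x by case: E.
  by split => //; move: E; rewrite -> Fx => /eqP; rewrite -tag_eqE /tag_eq /= eqxx tagged_asE => /eqP.
by move=> [Fx Xi]; rewrite -> Fx; rewrite Xi.
Qed.

Section bad_event.
Context d (T : measurableType d) (R : realType) (P : probability T R).
Variables (p : bool -> nat -> R) (lab : bool -> nat -> T -> nat).
Hypothesis L : iid_labels P lab p.
Notation m := (label_mean p).
Hypothesis m0 : 0 < m.
Variables (h q : nat) (eps : R).
Hypotheses (q2 : (2 <= q)%N) (qh : (2 * q ^ 9 <= h)%N) (eps0 : 0 < eps).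
Notation ustat := (match_ustat p lab).
Notation pred := (pred_at p lab h (q ^ 9)).
Notation exc := (excess_at p lab h).
Notation gap := (late_gap_at p lab h (q ^ 9)).
Notation drift := (drift_at p lab h (q ^ 9)).

(* Scales, with [q] about [h^(1/16)]: the greedy R-count stays within [q ^ 9] of [h] and
   within [q ^ 5] of its prediction, and paths are controlled on a grid of mesh [q ^ 3]. *)
Definition bad_drift w := (q ^ 9)%:R - 1 <= `|drift w|.
Definition bad_gap_up w := m * (q ^ 5)%:R <= `|gap (pred w + q ^ 5)%N w|.
Definition bad_gap_down w := m * (q ^ 5)%:R <= `|gap (pred w - q ^ 5)%N w|.
Definition bad_excess_up j w :=
  eps * q%:R ^+ 4 <= `|exc (pred w + j * q ^ 3)%N w - exc (pred w) w|.
Definition bad_excess_down j w :=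
  eps * q%:R ^+ 4 <= `|exc (pred w - j * q ^ 3)%N w - exc (pred w) w|.
Definition bad_ustat_up j w :=
  eps * q%:R ^+ 4 * h%:R <= `|ustat (h + j * q ^ 3)%N (2 * h - (h + j * q ^ 3))%N w|.
Definition bad_ustat_down j w :=
  eps * q%:R ^+ 4 * h%:R <= `|ustat (h - j * q ^ 3)%N (2 * h - (h - j * q ^ 3))%N w|.

Definition bad_event w : bool :=
  (bad_drift w || (bad_gap_up w || bad_gap_down w)) ||
  ((has (bad_excess_up ^~ w) (iota 0 (q ^ 2).+1) ||
    has (bad_excess_down ^~ w) (iota 0 (q ^ 2).+1)) ||
   (has (bad_ustat_up ^~ w) (iota 0 (2 * q ^ 6).+1) ||
    has (bad_ustat_down ^~ w) (iota 0 (2 * q ^ 6).+1))).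

Let dw s k : discrete_rv (fun w => walk_at p lab s w k).
Proof. exact: (walk_discrete L). Qed.

Lemma excess_discrete x : discrete_rv (exc x).
Proof.
apply: (discrete_rv_comp2 (fun a b : R => a + b)); apply: (discrete_rv_comp2 (fun a b : R => a - b));
  exact: dw.
Qed.

Lemma late_gap_discrete x : discrete_rv (gap x).
Proof.
apply: (discrete_rv_comp2 (fun a b : R => a - b)); apply: (discrete_rv_comp2 (fun a b : R => a - b));
  exact: dw.
Qed.

Let dpred : discrete_rv pred. Proof. by apply: (pred_discrete L). Qed.

Let ddrift : discrete_rv drift. Proof. by apply: (drift_discrete L). Qed.

Let bdrift : bounded_mfun drift. Proof. by apply: (drift_bounded L). Qed.

Let dle (t : R) (Z : T -> R) : discrete_rv Z -> discrete_rv (fun w => t <= `|Z w|).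
Proof. exact: (discrete_rv_comp (fun z => t <= `|z|)). Qed.

Let d1 : discrete_rv bad_drift.
Proof. exact: dle. Qed.

Let dgap (f : nat -> nat) : discrete_rv (fun w => gap (f (pred w)) w).
Proof.
apply: (@discrete_rv_index _ _ _ (fun w => f (pred w)) gap); last exact: late_gap_discrete.
exact: discrete_rv_comp.
Qed.

Let dexc (f : nat -> nat) : discrete_rv (fun w => exc (f (pred w)) w - exc (pred w) w).
Proof.
apply: (discrete_rv_comp2 (fun a b : R => a - b)).
  apply: (@discrete_rv_index _ _ _ (fun w => f (pred w)) exc); last exact: excess_discrete.
  exact: discrete_rv_comp.
by apply: (@discrete_rv_index _ _ _ pred exc) => //; exact: excess_discrete.
Qed.

Let d2 : discrete_rv bad_gap_up.
Proof. by apply: dle; exact: (dgap (fun x => x + q ^ 5)%N). Qed.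
Let d3 : discrete_rv bad_gap_down.
Proof. by apply: dle; exact: (dgap (fun x => x - q ^ 5)%N). Qed.
Let d4 j : discrete_rv (bad_excess_up j).
Proof. by apply: dle; exact: (dexc (fun x => x + j * q ^ 3)%N). Qed.
Let d5 j : discrete_rv (bad_excess_down j).
Proof. by apply: dle; exact: (dexc (fun x => x - j * q ^ 3)%N). Qed.
Let d6 j : discrete_rv (bad_ustat_up j).
Proof. by apply: dle; exact: (ustat_discrete L). Qed.
Let d7 j : discrete_rv (bad_ustat_down j).
Proof. by apply: dle; exact: (ustat_discrete L). Qed.

Lemma bad_event_discrete : discrete_rv bad_event.
Proof.
have or (a b : T -> bool) : discrete_rv a -> discrete_rv b -> discrete_rv (fun w => a w || b w).
  exact: (discrete_rv_comp2 orb).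
apply: (or); first by apply: (or) => //; exact: (or).
by apply: (or); apply: (or); exact: has_discrete.
Qed.

Let Q0 : 0 < q%:R :> R. Proof. by rewrite ltr0n; lia. Qed.
Let QN : q%:R != 0 :> R. Proof. by rewrite gt_eqF. Qed.
Let Q1 : 1 <= q%:R :> R. Proof. by rewrite ler1n; lia. Qed.
Let mN : m != 0. Proof. by rewrite gt_eqF. Qed.
Let h0 : 0 < h%:R :> R.
Proof. by rewrite ltr0n (leq_trans _ qh)// muln_gt0 expn_gt0; lia. Qed.

(** The second moment of the drift is O(q^16), against a squared threshold of at least q^18 / 4. B
    compares h with q^16, as q is only an integer part of the sixteenth root. *)
Lemma prb_bad_drift (B : R) : h%:R <= B * q%:R ^+ 16 ->
  prb P bad_drift <= (4 * B / m ^+ 2) / q%:R.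
Proof.
move=> hB.
have b2 : 2 <= (q ^ 9)%:R :> R.
  by rewrite (ler_nat R 2) (leq_trans q2)// -{1}(expn1 q) leq_pexp2l//; lia.
have b1 : 0 < (q ^ 9)%:R - 1 :> R by lra.
apply: le_trans (chebyshev_le P b1 bdrift ddrift) _.
rewrite ler_pdivrMr ?exprn_gt0//.
apply: le_trans (drift_moment L h (q ^ 9) m0) _.
have B0 : 0 <= B.
  by rewrite -(pmulr_lge0 _ (exprn_gt0 16 Q0)) (le_trans _ hB)// ltW.
have E : (q ^ 9)%:R / 2 <= (q ^ 9)%:R - 1 :> R by lra.
apply: (@le_trans _ _ (4 * B / m ^+ 2 / q%:R * ((q ^ 9)%:R / 2) ^+ 2)); last first.
  apply: ler_wpM2l.
    by rewrite divr_ge0 ?(ltW Q0)// divr_ge0 ?exprn_ge0 ?(ltW m0)// mulr_ge0.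
  by rewrite lerXn2r// nnegrE; lra.
have -> : 4 * B / m ^+ 2 / q%:R * ((q ^ 9)%:R / 2) ^+ 2 = (B * q%:R ^+ 17) / m ^+ 2.
  by rewrite natrX; field; rewrite QN mN.
rewrite ler_wpM2r ?invr_ge0 ?exprn_ge0 ?(ltW m0)// (le_trans hB)// ler_wpM2l//.
by rewrite ler_weXn2l.
Qed.

Let win9 x : (h - q ^ 9 <= x <= h + q ^ 9)%N -> forall y, (y <= q ^ 9)%N ->
  (h - 2 * q ^ 9 <= x + y <= h + 2 * q ^ 9)%N /\ (h - 2 * q ^ 9 <= x - y <= h + 2 * q ^ 9)%N.
Proof. by move: (q ^ 9)%N => b; lia. Qed.

Let y59 : (q ^ 5 <= q ^ 9)%N. Proof. by rewrite leq_pexp2l//; lia. Qed.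

Lemma prb_bad_gap : prb P bad_gap_up <= 8 / m ^+ 2 / q%:R /\
  prb P bad_gap_down <= 8 / m ^+ 2 / q%:R.
Proof.
have t0 : 0 < m * (q ^ 5)%:R by rewrite mulr_gt0// natrX exprn_gt0.
have -> : 8 / m ^+ 2 / q%:R = 8 * (q ^ 9)%:R / (m * (q ^ 5)%:R) ^+ 2.
  by rewrite !natrX; field; rewrite QN mN.
split.
- apply: (prb_random_index L qh m0 (Z := fun x w => gap (x + q ^ 5)%N w) t0).
  + by move=> x wx; have [H _] := win9 wx y59; by apply: late_gap_depends.
  + by move=> x wx; by apply: (late_gap_bounded L).
  + by move=> x wx; have [H _] := win9 wx y59; by apply: (late_gap_moment L).
- apply: (prb_random_index L qh m0 (Z := fun x w => gap (x - q ^ 5)%N w) t0).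
  + by move=> x wx; have [_ H] := win9 wx y59; by apply: late_gap_depends.
  + by move=> x wx; by apply: (late_gap_bounded L).
  + by move=> x wx; have [_ H] := win9 wx y59; by apply: (late_gap_moment L).
Qed.

Let jg j : (j <= q ^ 2)%N -> (j * q ^ 3 <= q ^ 9)%N.
Proof.
move=> jq; rewrite (leq_trans (leq_mul jq (leqnn _)))// -expnD leq_pexp2l//; lia.
Qed.

Let size_q2 : ((q ^ 2).+1%:R : R) <= 2 * q%:R ^+ 2.
Proof.
have : 1 <= q%:R ^+ 2 :> R by rewrite exprn_ege1.
by rewrite -natr1 natrX; lra.
Qed.

Let win_two x : (h - 2 * q ^ 9 <= x <= h + 2 * q ^ 9)%N -> (x <= 2 * h)%N.
Proof. by move: qh; move: (q ^ 9)%N => b; lia. Qed.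

(** At most 2 q^2 grid points, each with second moment at most 4 q^5 against the squared threshold
    eps^2 q^8. *)
Lemma prb_bad_excess :
  prb P (fun w => has (bad_excess_up ^~ w) (iota 0 (q ^ 2).+1)) <= 8 / eps ^+ 2 / q%:R /\
  prb P (fun w => has (bad_excess_down ^~ w) (iota 0 (q ^ 2).+1)) <= 8 / eps ^+ 2 / q%:R.
Proof.
have t0 : 0 < eps * q%:R ^+ 4 by rewrite mulr_gt0// exprn_gt0.
pose c : R := 4 * q%:R ^+ 5 / (eps * q%:R ^+ 4) ^+ 2.
have c0 : 0 <= c by rewrite divr_ge0 ?exprn_ge0 ?mulr_ge0 ?exprn_ge0 ?ltW.
have cE : (size (iota 0 (q ^ 2).+1))%:R * c <= 8 / eps ^+ 2 / q%:R.
  rewrite size_iota (le_trans (ler_wpM2r c0 size_q2))// le_eqVlt; apply/orP; left; apply/eqP.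
  by rewrite /c; field; rewrite QN gt_eqF.
have dist x y j : (j <= q ^ 2)%N -> `|x%:R - y%:R| = (j * q ^ 3)%:R :> R ->
    4 * `|x%:R - y%:R| <= 4 * q%:R ^+ 5 :> R.
  by move=> jq ->; rewrite ler_wpM2l// -natrX ler_nat (leq_trans (leq_mul jq (leqnn _)))// -expnD.
have w0 x : (h - q ^ 9 <= x <= h + q ^ 9)%N -> (h - 2 * q ^ 9 <= x <= h + 2 * q ^ 9)%N.
  by move=> wx; have [+ _] := win9 wx (leq0n _); rewrite addn0.
split.
- apply: le_trans (prb_has d4 _) cE => j; rewrite mem_iota add0n ltnS => /andP[_ jq].
  apply: (prb_random_index L qh m0 (Z := fun x w => exc (x + j * q ^ 3)%N w - exc x w) t0).
  + move=> x wx w w' E; have [H _] := win9 wx (jg jq).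
    by rewrite (excess_depends qh m0 H E) (excess_depends qh m0 (w0 _ wx) E).
  + by move=> x wx; by apply: (excess_dist_bounded L).
  + move=> x wx; have [H _] := win9 wx (jg jq).
    apply: le_trans (_ : _ <= 4 * `|_%:R - _%:R|) _; first by apply: (excess_dist_moment L) => //; apply: win_two => //; exact: w0.
    by apply: (dist _ _ _ jq); rewrite natrD addrAC subrr add0r normr_nat.
- apply: le_trans (prb_has d5 _) cE => j; rewrite mem_iota add0n ltnS => /andP[_ jq].
  apply: (prb_random_index L qh m0 (Z := fun x w => exc (x - j * q ^ 3)%N w - exc x w) t0).
  + move=> x wx w w' E; have [_ H] := win9 wx (jg jq).
    by rewrite (excess_depends qh m0 H E) (excess_depends qh m0 (w0 _ wx) E).
  + by move=> x wx; by apply: (excess_dist_bounded L).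
  + move=> x wx; have [_ H] := win9 wx (jg jq).
    apply: le_trans (_ : _ <= 4 * `|_%:R - _%:R|) _; first by apply: (excess_dist_moment L) => //; apply: win_two => //; exact: w0.
    have jx : (j * q ^ 3 <= x)%N.
      by case/andP: wx => wx _; exact: window_ge wx (jg jq) qh.
    by apply: (dist _ _ _ jq); rewrite natrB// addrAC subrr add0r normrN normr_nat.
Qed.

(** Chebyshev gives 64 / (eps^2 q^8) at each point, and there are at most 3 q^6 points: the total is
    192 / (eps^2 q^2), relaxed to the common rate 1 / q. *)
Lemma prb_bad_ustat :
  prb P (fun w => has (bad_ustat_up ^~ w) (iota 0 (2 * q ^ 6).+1)) <= 192 / eps ^+ 2 / q%:R /\
  prb P (fun w => has (bad_ustat_down ^~ w) (iota 0 (2 * q ^ 6).+1)) <= 192 / eps ^+ 2 / q%:R.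
Proof.
have t0 : 0 < eps * q%:R ^+ 4 * h%:R by rewrite !mulr_gt0// exprn_gt0.
pose c : R := 16 * (2 * h%:R * (2 * h%:R)) / (eps * q%:R ^+ 4 * h%:R) ^+ 2.
have c0 : 0 <= c by rewrite divr_ge0 ?exprn_ge0 ?mulr_ge0 ?exprn_ge0 ?ltW.
have cE : (size (iota 0 (2 * q ^ 6).+1))%:R * c <= 192 / eps ^+ 2 / q%:R.
  have sz : ((2 * q ^ 6).+1%:R : R) <= 3 * q%:R ^+ 6.
    have : 1 <= q%:R ^+ 6 :> R by rewrite exprn_ege1.
    by rewrite -natr1 natrM natrX; lra.
  rewrite size_iota (le_trans (ler_wpM2r c0 sz))//.
  have -> : 3 * q%:R ^+ 6 * c = 192 / eps ^+ 2 / q%:R / q%:R.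
    by rewrite /c; field; rewrite QN !gt_eqF.
  rewrite ler_pdivrMr// ler_peMr// !divr_ge0 ?exprn_ge0 ?ltW//.
have U x y : (x <= 2 * h)%N -> (y <= 2 * h)%N -> prb P (fun w => eps * q%:R ^+ 4 * h%:R <= `|ustat x y w|) <= c.
  move=> xh yh; apply: le_trans (chebyshev_le P t0 (ustat_bounded L x y) (ustat_discrete L x y)) _.
  apply: ler_wpM2r; first by rewrite invr_ge0 exprn_ge0// ltW.
  apply: le_trans (ustat_moment L x y) _.
  by rewrite ler_wpM2l// ler_pM// -natrM ler_nat.
have j6 j : (j <= 2 * q ^ 6)%N -> (h + j * q ^ 3 <= 2 * h)%N.
  move=> jq; have H : (j * q ^ 3 <= 2 * q ^ 9)%N.
    by rewrite (leq_trans (leq_mul jq (leqnn _)))// -mulnA -expnD.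
  by rewrite (mulSn 1 h) mul1n leq_add2l (leq_trans H).
split.
- apply: le_trans (prb_has d6 _) cE => j; rewrite mem_iota add0n ltnS => /andP[_ jq].
  by apply: U; [exact: j6|exact: leq_subr].
- apply: le_trans (prb_has d7 _) cE => j; rewrite mem_iota add0n ltnS => /andP[_ jq].
  apply: U; last exact: leq_subr.
  by rewrite (leq_trans (leq_subr _ _))// (mulSn 1 h) leq_addr.
Qed.

Lemma prb_bad_event (B : R) : h%:R <= B * q%:R ^+ 16 ->
  prb P bad_event <= (4 * B / m ^+ 2 + 16 / m ^+ 2 + 400 / eps ^+ 2) / q%:R.
Proof.
move=> hB; have P1 := prb_bad_drift hB.
have [P2 P3] := prb_bad_gap; have [P4 P5] := prb_bad_excess; have [P6 P7] := prb_bad_ustat.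
have dor (a b : T -> bool) : discrete_rv a -> discrete_rv b -> discrete_rv (fun w => a w || b w).
  exact: (discrete_rv_comp2 orb).
have h4 := has_discrete (iota 0 (q ^ 2).+1) d4.
have h5 := has_discrete (iota 0 (q ^ 2).+1) d5.
have h6 := has_discrete (iota 0 (2 * q ^ 6).+1) d6.
have h7 := has_discrete (iota 0 (2 * q ^ 6).+1) d7.
have H23 := prb_or P d2 d3.
have H123 := prb_or P d1 (dor _ _ d2 d3).
have H45 := prb_or P h4 h5.
have H67 := prb_or P h6 h7.
have H4567 := prb_or P (dor _ _ h4 h5) (dor _ _ h6 h7).
have H := prb_or P (dor _ _ d1 (dor _ _ d2 d3)) (dor _ _ (dor _ _ h4 h5) (dor _ _ h6 h7)).
apply: le_trans H _.
have -> : (4 * B / m ^+ 2 + 16 / m ^+ 2 + 400 / eps ^+ 2) / q%:R =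
  4 * B / m ^+ 2 / q%:R + (8 / m ^+ 2 / q%:R + 8 / m ^+ 2 / q%:R) +
  (8 / eps ^+ 2 / q%:R + 8 / eps ^+ 2 / q%:R + (192 / eps ^+ 2 / q%:R + 192 / eps ^+ 2 / q%:R)).
  by ring.
by lra.
Qed.

End bad_event.

(** * Limit law *)

Lemma sqrtr_dist (R : realType) (u v : R) : 0 <= u -> 0 <= v ->
  `|Num.sqrt u - Num.sqrt v| <= Num.sqrt `|u - v|.
Proof.
wlog uv : u v / v <= u => [H u0 v0|u0 v0].
  have [|/ltW] := leP v u; first by move=> ?; exact: H.
  by move=> ?; rewrite distrC (distrC u); exact: H.
rewrite ger0_norm ?subr_ge0 ?ler_wsqrtr// ger0_norm ?subr_ge0//.
have s0 : 0 <= Num.sqrt u - Num.sqrt v by rewrite subr_ge0 ler_wsqrtr.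
rewrite -[leLHS](ger0_norm s0) -sqrtr_sqr ler_wsqrtr//.
have := sqr_sqrtr u0; have := sqr_sqrtr v0.
have : Num.sqrt v <= Num.sqrt u by rewrite ler_wsqrtr.
by have := sqrtr_ge0 v; nra.
Qed.

Lemma sum_ord_sub (R : zmodType) (F : nat -> R) (k l : nat) : (k <= l)%N ->
  \sum_(i < l) F i - \sum_(i < k) F i = \sum_(i < l - k) F (k + i)%N.
Proof.
move=> kl; have [e ->] : exists e, l = (k + e)%N by exists (l - k)%N; rewrite subnKC.
have E : \sum_(i < k + e) F i = \sum_(i < k) F i + \sum_(i < e) F (k + i)%N.
  by rewrite big_split_ord.
by rewrite addKn E addrC addKr.
Qed.

Section smoothing_profile.
Context {R : realType}.
Variable f : R -> R.
Hypotheses (lf : lip_bounded f) (f1 : forall x, `|f x| <= 1).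
Notation gam := (@normal_prob R 0 1).

(* The limit of E f(sqrt(|D|) N) as a function of the signed scale [x]. *)
Definition profile (x : R) : R := gsmooth `|x| f 0.

Lemma profile_le1 x : `|profile x| <= 1.
Proof.
apply: (@RintT_norm_le _ _ _ gam) => [|y]; last exact: f1.
by apply: lip_bounded_comp => //; apply: measurable_funD => //; exact: gsmooth_arg_mfun.
Qed.

(** The profile sees x through sqrt |x|, so it is Holder continuous of exponent 1/2 and no better in
    general at 0; hence the square in the choice of [del]. *)
Lemma profile_uniform e : 0 < e -> exists2 del, 0 < del &
  forall x y, `|x - y| <= del -> `|profile x - profile y| <= e.
Proof.
move=> e0; have [_ [Lf L0 fL]] := lf.
have L1 : 0 < Lf + 1 by rewrite ltr_wpDl.
exists ((e / (Lf + 1)) ^+ 2); first by rewrite exprn_gt0// divr_gt0.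
move=> x y xy; rewrite (le_trans (gsmooth_dist _ _ _ lf fL L0))//.
have : `|Num.sqrt `|x| - Num.sqrt `|y| | <= e / (Lf + 1).
  rewrite (le_trans (sqrtr_dist (normr_ge0 _) (normr_ge0 _)))//.
  have q0 : 0 <= e / (Lf + 1) by rewrite divr_ge0// ltW.
  have -> : e / (Lf + 1) = Num.sqrt ((e / (Lf + 1)) ^+ 2) by rewrite sqrtr_sqr ger0_norm.
  apply: ler_wsqrtr.
  exact: le_trans (ler_dist_dist _ _) xy.
rewrite ler_pdivlMr// => H.
by have := normr_ge0 (Num.sqrt `|x| - Num.sqrt `|y|); nra.
Qed.

Lemma modulus_continuous (psi : R -> R) :
  (forall e, 0 < e -> exists2 del, 0 < del &
     forall x y, `|x - y| <= del -> `|psi x - psi y| <= e) -> continuous psi.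
Proof.
move=> uc x; apply/cvgrPdist_le => e e0.
have [del del0 H] := uc e e0; near=> y; apply: H.
by near: y; apply: cvgr_dist_le => //; exact: cvg_id.
Unshelve. all: by end_near. Qed.

Lemma uniform_continuous_mfun (psi : R -> R) : (forall x, `|psi x| <= 1) ->
  (forall e, 0 < e -> exists2 del, 0 < del &
     forall x y, `|x - y| <= del -> `|psi x - psi y| <= e) -> bounded_mfun psi.
Proof.
move=> psi1 uc; split; last by exists 1.
by apply: continuous_measurable_fun; exact: modulus_continuous.
Qed.

Lemma gsmooth_approx (psi F : R -> R) (eta v : R) : bounded_mfun psi -> lip_bounded F ->
  0 <= v -> (forall x, `|psi x - F x| <= eta * (1 + x ^+ 2)) ->
  `|gsmooth v psi 0 - gsmooth v F 0| <= eta * (1 + v).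
Proof.
move=> bpsi lF v0 H.
have iq : gam.-integrable setT (EFin \o (fun y : R => y ^+ 2)).
  by apply: (@gaussian_integrable_poly _ _ 1) => // y; exact: norm_expr_le4.
have i1 : gam.-integrable setT (EFin \o (fun y : R => eta)).
  exact: (@finite_measure_integrable_cst _ _ _ gam).
have i2 : gam.-integrable setT (EFin \o (fun y : R => eta * v * y ^+ 2)).
  exact: integrable_EFinZ.
have -> : eta * (1 + v) = \int[gam]_y (eta + eta * v * y ^+ 2).
  rewrite (@RintegralD _ _ _ gam)// (RintT_cst gam) (@RintegralZl _ _ _ gam)// gaussian_var.
  by rewrite mulr1 mulrDr mulr1.
apply: Rint_dist_le.
- apply: bounded_mfun_gaussian; case: bpsi => mpsi [M psiM]; split; last by exists M.
  by apply: measurableT_comp => //; apply: measurable_funD => //; exact: gsmooth_arg_mfun.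
- apply: bounded_mfun_gaussian; apply: lip_bounded_comp => //.
  by apply: measurable_funD => //; exact: gsmooth_arg_mfun.
- exact: integrable_EFinD.
- move=> y; rewrite add0r (le_trans (H _))// exprMn sqr_sqrtr//.
  by rewrite mulrDr mulr1 mulrA.
Qed.

End smoothing_profile.

Section excess_limit.
Context d (T : measurableType d) (R : realType) (P : probability T R).
Variables (p : bool -> nat -> R) (lab : bool -> nat -> T -> nat).
Hypothesis L : iid_labels P lab p.
Notation m := (label_mean p).
Hypothesis m0 : 0 < m.
Notation ustat := (match_ustat p lab).
Notation sig2 := (total_var p).
Notation k3 := (gaussian_abs3 R).

Lemma walk_mono s w x y : (x <= y)%N ->
  walk_at p lab s w x + m * x%:R <= walk_at p lab s w y + m * y%:R.
Proof.
move=> xy; rewrite /walk_at -(subnKC xy) walkD natrD mulrDr addrACA lerDl.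
rewrite mulr_natr -[X in _ *+ X](card_ord (y - x)) -sumr_const -big_split /=.
by apply: sumr_ge0 => i _; rewrite /score subrK; exact: (law_ge0 L).
Qed.

Lemma ustat_row_lip k l n w : (k <= l)%N ->
  `|ustat l n w - ustat k n w| <= 4 * ((l - k)%:R * n%:R).
Proof.
move=> kl; rewrite /match_ustat (@sum_ord_sub R (fun i => \sum_(j < n) match_kernel p (lab true i w) (lab false j w)))//.
rewrite (le_trans (ler_norm_sum _ _ _))//.
have -> : 4 * ((l - k)%:R * n%:R) = \sum_(i < l - k) (4 * n%:R) :> R.
  by rewrite sumr_const card_ord -[RHS]mulr_natl mulrCA.
apply: ler_sum => i _; rewrite (le_trans (ler_norm_sum _ _ _))//.
rewrite mulr_natr -[X in _ <= _ *+ X](card_ord n) -sumr_const; apply: ler_sum => j _.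
exact: (match_kernel_le L).
Qed.

Lemma ustat_col_lip k n l w : (n <= l)%N ->
  `|ustat k l w - ustat k n w| <= 4 * (k%:R * (l - n)%:R).
Proof.
move=> nl; rewrite /match_ustat -sumrB (le_trans (ler_norm_sum _ _ _))//.
rewrite mulrCA mulr_natl -[X in _ <= _ *+ X](card_ord k) -sumr_const; apply: ler_sum => i _.
rewrite (@sum_ord_sub R (fun j => match_kernel p (lab true i w) (lab false j w)))// (le_trans (ler_norm_sum _ _ _))//.
rewrite mulr_natr -[X in _ <= _ *+ X](card_ord (l - n)) -sumr_const; apply: ler_sum => j _.
exact: (match_kernel_le L).
Qed.

(** Passing from (x, 2h - x) to (y, 2h - y) changes |y - x| rows and as many columns, of total
    length at most 2h per unit step, and every entry is at most 4. *)
Lemma ustat_diag_lip h w x y : (x <= 2 * h)%N -> (y <= 2 * h)%N ->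
  `|ustat x (2 * h - x) w - ustat y (2 * h - y) w| <= 8 * h%:R * `|x%:R - y%:R|.
Proof.
wlog xy : x y / (x <= y)%N => [H xh yh|xh yh].
  have [|/ltnW] := leqP x y; first by move=> ?; exact: H.
  by move=> ?; rewrite distrC (distrC x%:R); exact: H.
have cl : (2 * h - y <= 2 * h - x)%N by rewrite leq_sub2l.
have H1 := ustat_row_lip (2 * h - y) w xy.
have H2 := ustat_col_lip x w cl.
have -> : ustat x (2 * h - x) w - ustat y (2 * h - y) w =
  (ustat x (2 * h - x) w - ustat x (2 * h - y) w) -
  (ustat y (2 * h - y) w - ustat x (2 * h - y) w) by ring.
rewrite (le_trans (ler_normB _ _))// (le_trans (lerD H2 H1))//.
rewrite distrC -(natrB _ xy) normr_nat.
have -> : (2 * h - x - (2 * h - y) = y - x)%N by lia.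
rewrite -mulrDr -!natrM -natrD -!natrM ler_nat.
have : (x * (y - x) + (y - x) * (2 * h - y) <= 2 * h * (y - x))%N.
  by rewrite mulnC -mulnDr mulnC leq_mul2r; apply/orP; right; lia.
by lia.
Qed.

Lemma good_comparison (h q r : nat) (eps : R) w : (2 <= q)%N -> (2 * q ^ 9 <= h)%N ->
  2 * m + 1 <= m * (q ^ 5)%:R -> (r <= 2 * h)%N ->
  `|(walk_at p lab true w r + m * r%:R) -
    (walk_at p lab false w (2 * h - r) + m * (2 * h - r)%:R)| <= 1 ->
  ~~ bad_event p lab h q eps w ->
  `|hoeffding_matches m (walk_at p lab true w) (walk_at p lab false w)
       (fun x y => ustat x y w) r (2 * h - r) -
    hoeffding_matches m (walk_at p lab true w) (walk_at p lab false w)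
       (fun x y => ustat x y w) h h -
    h%:R * excess_at p lab h (pred_at p lab h (q ^ 9) w) w| <=
  4 * q%:R ^+ 18 + 2 * q%:R ^+ 9 + h%:R * (eps * q%:R ^+ 4 + 2 * q%:R ^+ 3) +
    (2 * (eps * q%:R ^+ 4 * h%:R) + 8 * h%:R * q%:R ^+ 3).
Proof.
move=> q2 qh ymu r2h bal; rewrite /bad_event => /norP[/norP[g1 /norP[g2 g3]] /norP[/norP[k4 k5] /norP[k6 k7]]].
have g4 := elimT seq.hasPn k4; have g5 := elimT seq.hasPn k5.
have g6 := elimT seq.hasPn k6; have g7 := elimT seq.hasPn k7.
have /andP[_ m1] := label_mean01 L.
apply: (@balanced_comparison R m (walk_at p lab true w) (walk_at p lab false w)
  (fun x y => ustat x y w) h (q ^ 9) m0 m1 _ _ _ _ qh r r2h bal q) => //.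
- by move=> x y; exact: (walk_dist_le L).
- by move=> x y; exact: (walk_dist_le L).
- by move=> x y; exact: walk_mono.
- by move=> x y; exact: walk_mono.
- by lia.
- by move=> x y; exact: ustat_diag_lip.
- by rewrite ltNge.
- by rewrite ltNge.
- by rewrite ltNge.
- move=> j jq; split; apply: ltW; rewrite ltNge.
    by apply: g4; rewrite mem_iota add0n ltnS.
  by apply: g5; rewrite mem_iota add0n ltnS.
- move=> j jq; split; apply: ltW; rewrite ltNge.
    by apply: g6; rewrite mem_iota add0n ltnS.
  by apply: g7; rewrite mem_iota add0n ltnS.
Qed.

(** Moving away from h, each record gained from one source is a record given up from the other, so
    the excess is a sum of |x - h| pairs. The two sides of h exchange the roles of the sources. *)
Lemma excess_sumE h x w : (x <= 2 * h)%N ->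
  excess_at p lab h x w = if (h <= x)%N then
    \sum_(i < x - h) (score p true (lab true (h + i) w) - score p (~~ true) (lab (~~ true) (2 * h - x + i) w))
  else
    \sum_(i < h - x) (score p false (lab false (h + i) w) - score p (~~ false) (lab (~~ false) (x + i) w)).
Proof.
move=> xh; rewrite /excess_at /excess /walk_at /walk.
have sub s k l : (k <= l)%N -> \sum_(j < l) score p s (lab s j w) - \sum_(j < k) score p s (lab s j w) =
    \sum_(i < l - k) score p s (lab s (k + i) w).
  exact: (@sum_ord_sub R (fun j => score p s (lab s j w))).
case: leqP => hx; rewrite [RHS]sumrB.
  rewrite (sub true _ _ hx).
  have -> : \sum_(j < 2 * h - x) score p false (lab false j w) - \sum_(j < h) score p false (lab false j w) =
      - \sum_(i < h - (2 * h - x)) score p false (lab false (2 * h - x + i) w).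
    by rewrite -sub ?opprB//; lia.
  by have -> : (h - (2 * h - x) = x - h)%N by lia.
rewrite addrC (sub false); last by lia.
have -> : \sum_(j < x) score p true (lab true j w) - \sum_(j < h) score p true (lab true j w) =
    - \sum_(i < h - x) score p true (lab true (x + i) w).
  by rewrite -sub ?opprB// ltnW.
by have -> : (2 * h - x - h = h - x)%N by lia.
Qed.

Lemma excess_lindeberg h x c K f : (x <= 2 * h)%N -> lip_bounded f -> taylor3 K f -> 0 <= K ->
  `|\int[P]_w f (c * excess_at p lab h x w) -
    gsmooth (`|x%:R - h%:R| * (c ^+ 2 * sig2)) f 0| <=
  `|x%:R - h%:R| * (K * (1 + k3) * (2 * `|c|) ^+ 3).
Proof.
move=> xh lf tf K0.
under eq_Rintegral do rewrite excess_sumE//.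
case: leqP => hx.
  rewrite -natrB// normr_nat.
  apply: (paired_lindeberg L true (alpha := fun i => (h + i)%N) (beta := fun i => (2 * h - x + i)%N)) => //.
  - by move=> i j _ _ /addnI.
  - by move=> i j _ _ /addnI.
have hx' : (x <= h)%N by exact: ltnW.
rewrite (distrC x%:R) -natrB// normr_nat.
apply: (paired_lindeberg L false (alpha := fun i => (h + i)%N) (beta := fun i => (x + i)%N)) => //.
- by move=> i j _ _ /addnI.
- by move=> i j _ _ /addnI.
Qed.

Section at_scale.
Variables (h q : nat) (f : R -> R) (K Lf c : R).
Hypotheses (qh : (2 * q ^ 9 <= h)%N) (lf : lip_bounded f) (f1 : forall x, `|f x| <= 1).
Hypotheses (K0 : 0 <= K) (tf : taylor3 K f) (c0 : 0 <= c) (Lf0 : 0 <= Lf).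
Hypothesis fL : forall x y, `|f x - f y| <= Lf * `|x - y|.
Notation pred := (pred_at p lab h (q ^ 9)).
Notation exc := (excess_at p lab h).
Notation drift := (drift_at p lab h (q ^ 9)).

Let pred_win w : (h - q ^ 9 <= pred w <= h + q ^ 9)%N.
Proof. by have /andP[_ m1] := label_mean01 L; exact: predicted_bounds. Qed.

Let dpred : discrete_rv pred. Proof. by apply: (pred_discrete L). Qed.

Let excess_pred_dist w : `|(pred w)%:R - h%:R| <= q%:R ^+ 9 :> R.
Proof.
rewrite -natrX; have /andP[] := pred_win w; move: (q ^ 9)%N (pred w) => b x x1 x2.
have x1' : h%:R <= x%:R + b%:R :> R by rewrite -natrD ler_nat; lia.
have x2' : x%:R <= h%:R + b%:R :> R by rewrite -natrD ler_nat; lia.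
by rewrite ler_norml; apply/andP; split; lra.
Qed.

Let smooth_pred_bounded (g : R -> R) (F : T -> R) : discrete_rv F ->
  bounded_mfun (fun w => gsmooth (g (F w)) f 0).
Proof.
move=> dF; split; first exact/discrete_rv_mfun/(discrete_rv_comp (fun x => gsmooth (g x) f 0)).
exists 1 => w; apply: (@RintT_norm_le _ _ _ (@normal_prob R 0 1)) => [|y]; last exact: f1.
by apply: lip_bounded_comp => //; apply: measurable_funD => //; exact: gsmooth_arg_mfun.
Qed.

(** The prediction is frozen by independence; the excess at a fixed index is then a sum of at most
    q^9 pairs, each replaced at cubic cost. *)
Lemma excess_pred_smooth :
  `|\int[P]_w f (c * exc (pred w) w) -
    \int[P]_w gsmooth (`|(pred w)%:R - h%:R| * (c ^+ 2 * sig2)) f 0| <=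
  q%:R ^+ 9 * (K * (1 + k3) * (2 * `|c|) ^+ 3).
Proof.
pose win x := (h - q ^ 9 <= x <= h + q ^ 9)%N.
have win2 x : win x -> (h - 2 * q ^ 9 <= x <= h + 2 * q ^ 9)%N.
  by rewrite /win; move: (q ^ 9)%N => b; lia.
have win3 x : win x -> (x <= 2 * h)%N.
  by move: qh; rewrite /win; move: (q ^ 9)%N => b; lia.
pose G w (x : nat) : R := if win x then exc x w else 0.
have dG : depends_on lab (fun _ j => h - 2 * q ^ 9 <= j < 2 * h)%N G.
  move=> w w' E; apply/funext => x; rewrite /G; case: ifP => // wx.
  exact: (excess_depends qh m0 (win2 _ wx) E).
have -> : \int[P]_w f (c * exc (pred w) w) = \int[P]_w f (c * G w (pred w)).
  by apply: eq_Rintegral => w _; rewrite /G /win pred_win.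
rewrite (pred_indep L qh m0 dG (H := fun x (g : nat -> R) => f (c * g x)) (M := 1)); last by move=> w w'; exact: f1.
have dGs : discrete_rv G by apply: (late_discrete L qh m0 dG).
apply: RintT_dist_cst.
- split; last first.
    exists 1 => w; apply: RintT_norm_le => // ; split; last by exists 1.
    apply: discrete_rv_mfun.
    exact: (discrete_rv_comp (fun g : nat -> R => f (c * g (pred w))) dGs).
  apply: discrete_rv_mfun.
  exact: (discrete_rv_comp (fun x => \int[P]_w' f (c * G w' x)) dpred).
- exact: (smooth_pred_bounded (fun x => `|x - h%:R| * (c ^+ 2 * sig2))
    (discrete_rv_comp (fun x : nat => x%:R : R) dpred)).
- move=> w; rewrite /G /win pred_win.
  apply: le_trans (excess_lindeberg c (win3 _ (pred_win w)) lf tf K0) _.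
  apply: ler_wpM2r; last exact: excess_pred_dist.
  by rewrite mulr_ge0 ?exprn_ge0 ?mulr_ge0 ?addr_ge0 ?gaussian_abs3_ge0.
Qed.

(** Off the bad event the prediction is the drift rounded to within 1, so the two variances differ
    by at most [c ^+ 2 * sig2] and their roots by [c * sqrt sig2]. On the bad event the values of f
    differ by at most 2. *)
Lemma pred_drift_smooth :
  `|\int[P]_w gsmooth (`|(pred w)%:R - h%:R| * (c ^+ 2 * sig2)) f 0 -
    \int[P]_w gsmooth (`|drift w| * (c ^+ 2 * sig2)) f 0| <=
  Lf * (c * Num.sqrt sig2) + 2 * prb P (bad_drift p lab h q).
Proof.
have dd : discrete_rv drift by apply: (drift_discrete L).
have s0 : 0 <= sig2 := total_var_ge0 L.
have db : discrete_rv (bad_drift p lab h q).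
  exact: (discrete_rv_comp (fun z => (q ^ 9)%:R - 1 <= `|z|) dd).
have bb := bool_bounded_mfun R db.
have -> : Lf * (c * Num.sqrt sig2) + 2 * prb P (bad_drift p lab h q) =
  \int[P]_w (Lf * (c * Num.sqrt sig2) + 2 * (bad_drift p lab h q w)%:R).
  by rewrite RintTD ?RintT_cst ?RintTZ//; [exact: bounded_mfun_cst|exact: bounded_mfunZ].
have B1 := smooth_pred_bounded (fun x => `|x - h%:R| * (c ^+ 2 * sig2))
    (discrete_rv_comp (fun x : nat => x%:R : R) dpred).
have B2 := smooth_pred_bounded (fun x => `|x| * (c ^+ 2 * sig2)) dd.
apply: RintT_dist_le => //.
  by apply: bounded_mfunD; [exact: bounded_mfun_cst|exact: bounded_mfunZ].
move=> w; have c1 : 0 <= Lf * (c * Num.sqrt sig2) by rewrite !mulr_ge0 ?sqrtr_ge0.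
case: (boolP (bad_drift p lab h q w)) => [_|good].
  rewrite mulr1 (le_trans (ler_normB _ _))// -[leLHS]add0r lerD//.
  have le1 v : `|gsmooth v f 0| <= 1.
    apply: (@RintT_norm_le _ _ _ (@normal_prob R 0 1)) => [|y]; last exact: f1.
    by apply: lip_bounded_comp => //; apply: measurable_funD => //; exact: gsmooth_arg_mfun.
  by rewrite -[2]/(1 + 1) lerD.
rewrite mulr0 addr0 (le_trans (gsmooth_dist _ _ _ lf fL Lf0))// ler_wpM2l//.
have c2s : 0 <= c ^+ 2 * sig2 by rewrite mulr_ge0 ?exprn_ge0.
rewrite (le_trans (sqrtr_dist _ _))// ?mulr_ge0//.
have -> : c * Num.sqrt sig2 = Num.sqrt (c ^+ 2 * sig2).
  by rewrite sqrtrM ?exprn_ge0// sqrtr_sqr ger0_norm.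
rewrite ler_wsqrtr// -mulrBl normrM (ger0_norm c2s) ler_piMl//.
have /andP[_ m1] := label_mean01 L.
have gd : `|drift w| < (q ^ 9)%:R - 1 by rewrite ltNge.
have /andP[d1 d2] := predicted_drift m0 m1 qh gd.
rewrite (le_trans (ler_dist_dist _ _))// -/(pred w) ler_norml.
by move: d1 d2; rewrite -/(pred w) -/(drift w) => d1 d2; apply/andP; split; lra.
Qed.

End at_scale.

(** psi lacks a Taylor remainder, so it is traded for F before the Gaussian replacement and
    recovered after it. Both trades cost eta times a second moment; the third term changes the
    variance to its limit. *)
Lemma paired_clt (a v eta : R) (N : nat) (psi F : R -> R) (K LF : R) :
  bounded_mfun psi -> lip_bounded F -> taylor3 K F -> 0 <= K -> 0 <= LF -> 0 <= eta -> 0 <= v ->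
  (forall x y, `|F x - F y| <= LF * `|x - y|) ->
  (forall x, `|psi x - F x| <= eta * (1 + x ^+ 2)) ->
  `|\int[P]_w psi (a * (walk p lab false N w - walk p lab true N w)) - gsmooth v psi 0| <=
  eta * (1 + a ^+ 2 * (4 * N%:R)) + N%:R * (K * (1 + k3) * (2 * `|a|) ^+ 3) +
  LF * `|Num.sqrt (N%:R * (a ^+ 2 * sig2)) - Num.sqrt v| + eta * (1 + v).
Proof.
move=> bpsi lF tF K0 LF0 eta0 v0 FL H.
pose S w := walk p lab false N w - walk p lab true N w.
have bS : bounded_mfun S by apply: bounded_mfunB; exact: (walk_bounded L).
have baS : bounded_mfun (fun w => a * S w) by exact: bounded_mfunZ.
have bq := bounded_mfunM baS baS.
have bF : bounded_mfun (fun w => F (a * S w)) by apply: lip_bounded_comp => //; case: baS.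
have bP : bounded_mfun (fun w => psi (a * S w)).
  case: bpsi => mpsi [M psiM]; split; last by exists M.
  by apply: measurableT_comp => //; case: baS.
have H1 : `|\int[P]_w psi (a * S w) - \int[P]_w F (a * S w)| <= eta * (1 + a ^+ 2 * (4 * N%:R)).
  apply: (@le_trans _ _ (\int[P]_w (eta + eta * (a * S w * (a * S w))))).
    apply: RintT_dist_le => //.
      by apply: bounded_mfunD; [exact: bounded_mfun_cst|exact: bounded_mfunZ].
    by move=> w; rewrite (le_trans (H _))// mulrDr mulr1 expr2.
  rewrite RintTD ?RintT_cst ?RintTZ//; [|exact: bounded_mfun_cst|exact: bounded_mfunZ].
  rewrite mulrDr mulr1 lerD2l ler_wpM2l//.
  under eq_Rintegral do rewrite -expr2 exprMn.
  rewrite RintTZ; last exact: (bounded_mfunM bS bS).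
  by rewrite ler_wpM2l ?sqr_ge0//; exact: (walk_gap_moment L).
have H2 : `|\int[P]_w F (a * S w) - gsmooth (N%:R * (a ^+ 2 * sig2)) F 0| <=
    N%:R * (K * (1 + k3) * (2 * `|a|) ^+ 3).
  have := paired_lindeberg L false (alpha := id) (beta := id) a (N := N).
  have idi : {in gtn N &, injective (@id nat)} by [].
  move=> /(_ K F idi idi lF tF K0).
  have E w : S w = \sum_(i < N) (score p false (lab false (id i) w) -
      score p (~~ false) (lab (~~ false) (id i) w)) by rewrite [RHS]sumrB.
  by under eq_Rintegral do rewrite -E.
have sv : 0 <= N%:R * (a ^+ 2 * sig2).
  by rewrite mulr_ge0// mulr_ge0 ?sqr_ge0//; exact: (total_var_ge0 L).
have H3 := gsmooth_dist (N%:R * (a ^+ 2 * sig2)) v 0 lF FL LF0.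
have H4 := gsmooth_approx bpsi lF v0 H.
move: H1 H2 H3 H4.
set e1 := \int[P]_w psi _; set e2 := \int[P]_w F _.
set g1 := gsmooth _ F 0; set g2 := gsmooth v F 0; set g3 := gsmooth v psi 0.
move=> H1 H2 H3; rewrite distrC => H4.
have -> : e1 - g3 = (e1 - e2) + (e2 - g1) + (g1 - g2) + (g2 - g3) by ring.
do 3![apply: (le_trans (ler_normD _ _)); apply: lerD => //].
Qed.

End excess_limit.

Lemma root16_exists (h : nat) : exists q, (q ^ 16 <= h < q.+1 ^ 16)%N.
Proof.
have ex : exists q, (q ^ 16 <= h)%N by exists 0%N.
have ub q : (q ^ 16 <= h)%N -> (q <= h)%N.
  by apply: leq_trans; rewrite -{1}(expn1 q); case: q => // q; rewrite leq_pexp2l.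
case: (ex_maxnP ex ub) => q qh qmax; exists q; rewrite qh /= ltnNge.
by apply/negP => /qmax; rewrite ltnn.
Qed.

Lemma twice_pow9_le (q h : nat) : (2 <= q)%N -> (q ^ 16 <= h)%N -> (2 * q ^ 9 <= h)%N.
Proof.
move=> q2 qh; have q0 : (0 < q)%N by apply: leq_trans q2.
have e : (q ^ 10 <= q ^ 16)%N by apply: (@leq_pexp2l q 10 16 q0).
have e' : (2 * q ^ 9 <= q ^ 10)%N by rewrite (expnS q 9) leq_mul2r q2 orbT.
exact: leq_trans e' (leq_trans e qh).
Qed.

Lemma half_bounds n : (2 * n./2 <= n <= 2 * n./2 + 1)%N.
Proof. by have := odd_double_half n; case: (odd n); lia. Qed.

Lemma pow16_half_gt0 q n : (2 <= q)%N -> (q ^ 16 <= n./2)%N -> (0 < n)%N.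
Proof.
move=> q2; have : (0 < q ^ 16)%N by rewrite expn_gt0 (leq_trans _ q2).
by move: (q ^ 16)%N => k k0; have := half_bounds n; lia.
Qed.

Lemma pow16_half_le q n : (q ^ 16 <= n./2)%N -> (q ^ 16 <= n)%N.
Proof. by move: (q ^ 16)%N => k; have := half_bounds n; lia. Qed.

Lemma div_nat_small (R : realType) (C e : R) : 0 <= C -> 0 < e ->
  exists q0 : nat, forall q, (q0 <= q)%N -> (0 < q)%N -> C / q%:R <= e.
Proof.
move=> C0 e0; exists (Num.truncn (C / e)).+1 => q q0q q0.
rewrite ler_pdivrMr ?ltr0n// mulrC -ler_pdivrMr//.
by rewrite ltW// (lt_le_trans (truncnS_gt _))// ler_nat.
Qed.

(** * Orders of magnitude of the normalisation n^(5/4) *)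

Section five_quarters.
Context {R : realType}.

Definition norm54 (n : nat) : R := n%:R `^ (5%:R / 4%:R).

Lemma norm54_gt0 n : (0 < n)%N -> 0 < norm54 n.
Proof. by move=> n0; rewrite powR_gt0// ltr0n. Qed.

(** All later estimates pass through this fourth power, which turns the real exponent into integer
    powers. *)
Lemma norm54_pow4 n : norm54 n ^+ 4 = n%:R ^+ 5.
Proof.
rewrite /norm54 -powR_mulrn ?powR_ge0// -powRrM.
have -> : 5%:R / 4%:R * 4%:R = 5%:R :> R by field.
by rewrite powR_mulrn.
Qed.

Lemma norm54_ge (n q : nat) : (q ^ 16 <= n)%N -> n%:R * q%:R ^+ 4 <= norm54 n.
Proof.
move=> qn; rewrite -(@ler_pXn2r _ 4)// ?nnegrE ?mulr_ge0 ?exprn_ge0 ?powR_ge0//.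
rewrite norm54_pow4 exprMn -exprM [leRHS]exprS mulrC ler_wpM2r ?exprn_ge0//.
by rewrite -natrX ler_nat.
Qed.

(** With x = h / n close to 1/2 and e = 2 q^9 / n, the ratio is (x - e) x^4, close to x^5 and so to
    1/32. This is the factor 32 in 128 = 4 * 32 of the limiting variance. *)
Lemma half_ratio (n h q : nat) : (0 < q)%N -> (q ^ 16 <= h)%N -> (2 * h <= n <= 2 * h + 1)%N ->
  (2 * q ^ 9 <= h)%N ->
  `|(h - 2 * q ^ 9)%:R * h%:R ^+ 4 / n%:R ^+ 5 - 32^-1| <= 2 / q%:R :> R.
Proof.
move=> q0 qh /andP[hn nh] q9h.
have Q0 : 0 < q%:R :> R by rewrite ltr0n.
have qn : (q <= n)%N.
  rewrite (leq_trans _ hn)// (leq_trans _ (leq_pmull _ _))// (leq_trans _ qh)//.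
  by rewrite -{1}(expn1 q) leq_pexp2l.
have n0 : 0 < n%:R :> R by rewrite ltr0n (leq_trans q0).
pose x : R := h%:R / n%:R; pose e : R := 2 * q%:R ^+ 9 / n%:R.
have E : (h - 2 * q ^ 9)%:R * h%:R ^+ 4 / n%:R ^+ 5 = (x - e) * x ^+ 4.
  by rewrite natrB// natrM natrX /x /e; field; rewrite gt_eqF.
rewrite E.
have x0 : 0 <= x by rewrite divr_ge0.
have hn' : 2 * h%:R <= n%:R :> R by rewrite -natrM ler_nat.
have nh' : n%:R <= 2 * h%:R + 1 :> R by rewrite -natrM natr1 -addn1 ler_nat.
have nq : 1 <= q%:R^-1 * n%:R :> R by rewrite ler_pdivlMl// mulr1 ler_nat.
have x1 : x <= 1 / 2 by rewrite /x ler_pdivrMr//; lra.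
have x2 : 1 / 2 - q%:R^-1 <= x by rewrite /x ler_pdivlMr//; lra.
have e0 : 0 <= e by rewrite divr_ge0 ?mulr_ge0 ?exprn_ge0.
have e1 : e <= q%:R^-1.
  rewrite /e ler_pdivrMr// ler_pdivlMl// mulrCA -exprS (le_trans _ hn')// ler_wpM2l//.
  by rewrite -natrX ler_nat (leq_trans _ qh)// leq_pexp2l.
have x4 : 0 <= x ^+ 4 <= 1.
  by rewrite exprn_ge0//= exprn_ile1//; lra.
have x5 : x ^+ 5 = x * x ^+ 4 by rewrite exprS.
have [x50 x51] : 0 <= 32^-1 - x ^+ 5 /\ 32^-1 - x ^+ 5 <= 1 / 2 - x.
  (* For x <= 1/2 each term of the second factor is at most 1/16, so the difference is bounded by
     1/2 - x. *)
  have -> : 32^-1 - x ^+ 5 = (1 / 2 - x) * (1 / 16 + x / 8 + x ^+ 2 / 4 + x ^+ 3 / 2 + x ^+ 4) by field.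
  have b2 : 0 <= x ^+ 2 <= 1 / 4 by rewrite exprn_ge0//= expr2; nra.
  have b3 : 0 <= x ^+ 3 <= 1 / 8.
    by rewrite exprn_ge0//= exprS; case/andP: b2 => ? ?; nra.
  have b4 : 0 <= x ^+ 4 <= 1 / 16.
    by rewrite exprn_ge0//= exprS; case/andP: b3 => ? ?; nra.
  have S0 : 0 <= 1 / 16 + x / 8 + x ^+ 2 / 4 + x ^+ 3 / 2 + x ^+ 4 <= 1.
    by case/andP: b2 => ? ?; case/andP: b3 => ? ?; case/andP: b4 => ? ?; apply/andP; split; lra.
  case/andP: S0 => ? ?; split; first by rewrite mulr_ge0//; lra.
  by rewrite ler_piMr//; lra.
case/andP: x4 => x40 x41.
have ex4 : 0 <= e * x ^+ 4 <= e by rewrite mulr_ge0//= ler_piMr.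
case/andP: ex4 => ? ?.
rewrite mulrBl -x5 ler_norml; apply/andP; split; lra.
Qed.

End five_quarters.

(** Error bookkeeping over bare variables, so that [lra] is not given the actual integrals. *)
Lemma regroup_errors (R : realDomainType)
    (t1 t2 y4 b1 x2 x3 b3 y1 y2 y3 B1 X2 X3 B3 Y1 Y2 Y3 : R) :
  b1 <= B1 -> x2 <= X2 -> x3 <= X3 -> b3 <= B3 -> y1 <= Y1 -> y2 <= Y2 -> y3 <= Y3 ->
  t1 + t2 + 2 * b1 + x2 + (x3 + 2 * b3) + (y1 + y2 + y3 + y4) <=
  t1 + (Y1 + y4) + (t2 + 2 * B1 + X2 + X3 + 2 * B3 + Y2) + Y3.
Proof. by move=> ? ? ? ? ? ? ?; lra. Qed.

(** * Expectations of smooth test functions *)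

Section test_limit.
Context d (T : measurableType d) (R : realType) (P : probability T R).
Variables (p : bool -> nat -> R) (lab : bool -> nat -> T -> nat).
Hypothesis L : iid_labels P lab p.
Notation m := (label_mean p).
Hypothesis m0 : 0 < m.
Notation sig2 := (total_var p).
Notation k3 := (gaussian_abs3 R).
Variable D : nat -> T -> R.
Hypothesis dD : forall n, discrete_rv (D n).
Hypothesis D_good : forall n q (eps : R) w, 0 < eps -> (2 <= q)%N ->
  (2 * q ^ 9 <= n./2)%N -> 2 * m + 1 <= m * (q ^ 5)%:R -> (q ^ 16 <= n./2)%N ->
  ~~ bad_event p lab n./2 q eps w ->
  `|D n w - (n./2)%:R / norm54 n * excess_at p lab n./2 (pred_at p lab n./2 (q ^ 9) w) w|
  <= 2 * eps + 10 / q%:R.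

Definition limit_var : R := sig2 ^+ 3 / (128 * m ^+ 2).

Lemma limit_var_ge0 : 0 <= limit_var.
Proof.
by rewrite divr_ge0 ?exprn_ge0 ?mulr_ge0 ?exprn_ge0 ?(total_var_ge0 L)// ltW.
Qed.

Section one_step.
Variables (n q : nat) (f F : R -> R) (K Lf KF LF eps eta B : R).
Let h := n./2.
Let Q : R := q%:R.
Hypotheses (q2 : (2 <= q)%N) (qh : (q ^ 16 <= h)%N) (ymu : 2 * m + 1 <= m * (q ^ 5)%:R).
Hypothesis hB : h%:R <= B * Q ^+ 16.
Hypotheses (lf : lip_bounded f) (f1 : forall x, `|f x| <= 1) (K0 : 0 <= K) (tf : taylor3 K f).
Hypotheses (Lf0 : 0 <= Lf) (fL : forall x y, `|f x - f y| <= Lf * `|x - y|).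
Hypotheses (lF : lip_bounded F) (KF0 : 0 <= KF) (tF : taylor3 KF F).
Hypotheses (LF0 : 0 <= LF) (FL : forall x y, `|F x - F y| <= LF * `|x - y|).
Hypotheses (eps0 : 0 < eps) (eta0 : 0 <= eta) (B0 : 0 <= B).
Hypothesis HF : forall x, `|profile f x - F x| <= eta * (1 + x ^+ 2).

(** c scales the excess, and a turns the difference of the early walks into the conditional variance
    [c ^+ 2 * sig2 * drift], up to sign. A is the size of a in units of q^(-8). *)
Let c : R := h%:R / norm54 n.
Let a : R := c ^+ 2 * sig2 / (2 * m).
Let A : R := sig2 / (2 * m).
Let N := (h - 2 * q ^ 9)%N.

Let Q0 : 0 < Q. Proof. by rewrite ltr0n (leq_trans _ q2). Qed.
Let Q1 : 1 <= Q. Proof. by rewrite ler1n (leq_trans _ q2). Qed.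
Let s0 : 0 <= sig2. Proof. exact: (total_var_ge0 L). Qed.

Let q9h : (2 * q ^ 9 <= h)%N.
Proof. exact: twice_pow9_le. Qed.

Let nh : (2 * h <= n <= 2 * h + 1)%N.
Proof. exact: half_bounds. Qed.

Let n0 : (0 < n)%N. Proof. exact: pow16_half_gt0 q2 qh. Qed.

Let c0 : 0 <= c. Proof. by rewrite divr_ge0// ltW// norm54_gt0. Qed.

Let cQ : c <= Q^-1 ^+ 4.
Proof.
rewrite /c ler_pdivrMr ?norm54_gt0// exprVn ler_pdivlMl ?exprn_gt0//.
apply: le_trans (norm54_ge (pow16_half_le qh)).
rewrite mulrC; apply: ler_wpM2r; first by rewrite exprn_ge0// ltW.
rewrite ler_nat; case/andP: nh => hn _; apply: leq_trans hn.
exact: leq_pmull.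
Qed.

Let A0 : 0 <= A. Proof. by rewrite divr_ge0// mulr_ge0// ltW. Qed.

Let a0 : 0 <= a.
Proof. by rewrite /a; apply: divr_ge0; apply: mulr_ge0; rewrite ?exprn_ge0 ?(ltW m0). Qed.

Let aQ : a <= A * Q^-1 ^+ 8.
Proof.
rewrite /a /A -mulrA mulrC ler_wpM2l// -[8%N]/(4 * 2)%N exprM.
by rewrite lerXn2r ?nnegrE ?exprn_ge0 ?invr_ge0 ?(ltW Q0).
Qed.

Let NB : N%:R <= B * Q ^+ 16.
Proof. by rewrite (le_trans _ hB)// ler_nat leq_subr. Qed.

Let iQ k : (0 < k)%N -> Q^-1 ^+ k <= Q^-1.
Proof.
by case: k => // k _; rewrite exprS ler_piMr ?invr_ge0 ?(ltW Q0)// exprn_ile1 ?invr_ge0 ?(ltW Q0)// invf_le1.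
Qed.

Let iQ0 : 0 <= Q^-1. Proof. by rewrite invr_ge0 ltW. Qed.

(** The signed conditional variance is itself a scaled walk of variance N a^2 sig2, that is sig2^3 /
    (4 m^2) times the ratio of [half_ratio]. *)
Let H_var : `|N%:R * (a ^+ 2 * sig2) - limit_var| <= (sig2 ^+ 3 / (4 * m ^+ 2)) * (2 / Q).
Proof.
have q00 : (0 < q)%N by apply: leq_trans q2.
have := @half_ratio R n h q q00 qh nh q9h; rewrite -/N => H.
have -> : N%:R * (a ^+ 2 * sig2) - limit_var =
  (sig2 ^+ 3 / (4 * m ^+ 2)) * (N%:R * h%:R ^+ 4 / n%:R ^+ 5 - 32^-1).
  rewrite -norm54_pow4 /a /c /limit_var; field.
  by rewrite !gt_eqF// norm54_gt0.
rewrite normrM ger0_norm; last by rewrite divr_ge0 ?exprn_ge0 ?mulr_ge0 ?exprn_ge0// ltW.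
by rewrite ler_wpM2l// divr_ge0 ?exprn_ge0 ?mulr_ge0 ?exprn_ge0// ltW.
Qed.

(** The bound telescopes over four replacements: the gap by the scaled excess at the prediction, off
    the bad event; the excess by a Gaussian given the prediction; the prediction by the drift; and
    the drift by a Gaussian. *)
Lemma test_limit_step :
  `|\int[P]_w f (D n w) - gsmooth limit_var (profile f) 0| <=
  2 * Lf * eps + eta * (2 + 4 * B * A ^+ 2 + limit_var) +
  (10 * Lf + 2 * (4 * B / m ^+ 2 + 16 / m ^+ 2 + 400 / eps ^+ 2) +
   8 * K * (1 + k3) + Lf * Num.sqrt sig2 + 2 * (4 * B / m ^+ 2) +
   8 * KF * (1 + k3) * B * A ^+ 3) / Q +
  LF * Num.sqrt ((2 * (sig2 ^+ 3 / (4 * m ^+ 2))) / Q).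
Proof.
pose pr := pred_at p lab h (q ^ 9).
pose Z w := c * excess_at p lab h (pr w) w.
have dpr : discrete_rv pr by apply: (pred_discrete L).
have dZ : discrete_rv Z.
  apply: (discrete_rv_comp (fun x => c * x)).
  by apply: (@discrete_rv_index _ _ _ pr (excess_at p lab h)) => // x; exact: (excess_discrete L).
have dbad : discrete_rv (bad_event p lab h q eps) by apply: (bad_event_discrete L).
have bf (X : T -> R) : discrete_rv X -> bounded_mfun (fun w => f (X w)).
  by move=> dX; apply: lip_bounded_comp => //; exact: discrete_rv_mfun.
have bbad := bool_bounded_mfun R dbad.
have T1 : `|\int[P]_w f (D n w) - \int[P]_w f (Z w)| <=
    Lf * (2 * eps + 10 / Q) + 2 * prb P (bad_event p lab h q eps).
  have -> : Lf * (2 * eps + 10 / Q) + 2 * prb P (bad_event p lab h q eps) =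
     \int[P]_w (Lf * (2 * eps + 10 / Q) + 2 * (bad_event p lab h q eps w)%:R).
    by rewrite RintTD ?RintT_cst ?RintTZ//; [exact: bounded_mfun_cst|exact: bounded_mfunZ].
  apply: RintT_dist_le; [exact: bf|exact: bf| |].
    by apply: bounded_mfunD; [exact: bounded_mfun_cst|exact: bounded_mfunZ].
  have e0 : 0 <= Lf * (2 * eps + 10 / Q).
    by rewrite mulr_ge0// addr_ge0 ?mulr_ge0 ?divr_ge0 ?(ltW eps0) ?(ltW Q0).
  move=> w; case: (boolP (bad_event p lab h q eps w)) => [_|good].
    rewrite mulr1 (le_trans (ler_normB _ _))// -[leLHS]add0r lerD//.
    by rewrite -[2]/(1 + 1) lerD.
  rewrite mulr0 addr0 (le_trans (fL _ _))// ler_wpM2l//.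
  exact: D_good.
have P1 := prb_bad_event L m0 q2 q9h eps0 hB.
have T2 := excess_pred_smooth L m0 q9h lf f1 K0 tf (c := c).
have T3 := pred_drift_smooth L m0 q9h lf f1 c0 Lf0 fL.
have P2 := prb_bad_drift L m0 q2 q9h eps0 hB.
have := paired_clt L a N (uniform_continuous_mfun (profile_le1 lf f1) (profile_uniform lf))
  lF tF KF0 LF0 eta0 limit_var_ge0 FL HF.
rewrite (_ : \int[P]_w profile f _ = \int[P]_w gsmooth (`|drift_at p lab h (q ^ 9) w| * (c ^+ 2 * sig2)) f 0); last first.
  apply: eq_Rintegral => w _; rewrite /profile.
  have c2 : 0 <= c ^+ 2 * sig2 by rewrite mulr_ge0 ?exprn_ge0.
  suff -> : a * (walk p lab false N w - walk p lab true N w) =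
    drift_at p lab h (q ^ 9) w * (c ^+ 2 * sig2) by rewrite normrM (ger0_norm c2).
  by rewrite /a /drift_at /drift /walk_at -/N; field; rewrite gt_eqF.
move=> T4.
have E4 : a ^+ 2 * (4 * N%:R) <= 4 * B * A ^+ 2.
  have a2 : a ^+ 2 <= (A * Q^-1 ^+ 8) ^+ 2.
    by rewrite lerXn2r ?nnegrE// mulr_ge0// exprn_ge0.
  apply: (@le_trans _ _ ((A * Q^-1 ^+ 8) ^+ 2 * (4 * (B * Q ^+ 16)))).
    apply: ler_pM => //; [exact: exprn_ge0|exact: ler_wpM2l].
  by rewrite le_eqVlt; apply/orP; left; apply/eqP; field; rewrite gt_eqF.
have E5 : N%:R * (KF * (1 + k3) * (2 * `|a|) ^+ 3) <= 8 * KF * (1 + k3) * B * A ^+ 3 / Q.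
  have k0 : 0 <= KF * (1 + k3) by rewrite mulr_ge0// addr_ge0// gaussian_abs3_ge0.
  have a3 : (2 * `|a|) ^+ 3 <= (2 * (A * Q^-1 ^+ 8)) ^+ 3.
    rewrite (ger0_norm a0); apply: lerXn2r; last exact: ler_wpM2l.
      by rewrite nnegrE mulr_ge0.
    by rewrite nnegrE mulr_ge0// mulr_ge0// exprn_ge0.
  apply: (@le_trans _ _ (B * Q ^+ 16 * (KF * (1 + k3) * (2 * (A * Q^-1 ^+ 8)) ^+ 3))).
    apply: ler_pM => //; first by rewrite mulr_ge0// exprn_ge0// mulr_ge0.
    exact: ler_wpM2l.
  have -> : B * Q ^+ 16 * (KF * (1 + k3) * (2 * (A * Q^-1 ^+ 8)) ^+ 3) =
    8 * KF * (1 + k3) * B * A ^+ 3 * (Q^-1 ^+ 8) by field; rewrite gt_eqF.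
  apply: ler_wpM2l; last exact: iQ.
  by rewrite mulr_ge0 ?exprn_ge0// mulr_ge0// -mulrA mulr_ge0.
have E6 : LF * `|Num.sqrt (N%:R * (a ^+ 2 * sig2)) - Num.sqrt limit_var| <=
    LF * Num.sqrt ((2 * (sig2 ^+ 3 / (4 * m ^+ 2))) / Q).
  rewrite ler_wpM2l//; apply: le_trans (sqrtr_dist _ limit_var_ge0) _.
    by rewrite mulr_ge0// mulr_ge0 ?exprn_ge0.
  rewrite ler_wsqrtr// (le_trans H_var)// le_eqVlt; apply/orP; left; apply/eqP.
  by field; rewrite !gt_eqF.
have E2 : q%:R ^+ 9 * (K * (1 + k3) * (2 * `|c|) ^+ 3) <= 8 * K * (1 + k3) / Q.
  have k0 : 0 <= K * (1 + k3) by rewrite mulr_ge0// addr_ge0// gaussian_abs3_ge0.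
  have c3 : (2 * `|c|) ^+ 3 <= (2 * Q^-1 ^+ 4) ^+ 3.
    rewrite (ger0_norm c0); apply: lerXn2r; last exact: ler_wpM2l.
      by rewrite nnegrE mulr_ge0.
    by rewrite nnegrE mulr_ge0// exprn_ge0.
  apply: (@le_trans _ _ (Q ^+ 9 * (K * (1 + k3) * (2 * Q^-1 ^+ 4) ^+ 3))).
    by apply: ler_wpM2l; [rewrite exprn_ge0// ltW|exact: ler_wpM2l].
  have -> : Q ^+ 9 * (K * (1 + k3) * (2 * Q^-1 ^+ 4) ^+ 3) = 8 * K * (1 + k3) * (Q^-1 ^+ 3).
    by field; rewrite gt_eqF.
  apply: ler_wpM2l; last exact: iQ.
  by rewrite -mulrA mulr_ge0.
have E3 : Lf * (c * Num.sqrt sig2) <= Lf * Num.sqrt sig2 / Q.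
  rewrite mulrCA mulrC ler_wpM2l ?mulr_ge0 ?sqrtr_ge0//.
  by rewrite (le_trans cQ)// iQ.
have E7 : eta * (1 + a ^+ 2 * (4 * N%:R)) <= eta * (1 + 4 * B * A ^+ 2).
  by rewrite ler_wpM2l// lerD2l.
move: T1 T2 T3 T4; rewrite -/pr.
set i1 := \int[P]_w f (D n w).
set i2 := \int[P]_w f (Z w).
set i3 := \int[P]_w gsmooth (`|(pr w)%:R - h%:R| * (c ^+ 2 * sig2)) f 0.
set i4 := \int[P]_w gsmooth (`|drift_at p lab h (q ^ 9) w| * (c ^+ 2 * sig2)) f 0.
set i5 := gsmooth limit_var (profile f) 0.
move=> T1 T2 T3 T4.
have -> : i1 - i5 = (i1 - i2) + (i2 - i3) + (i3 - i4) + (i4 - i5) by ring.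
have tri : `|(i1 - i2) + (i2 - i3) + (i3 - i4) + (i4 - i5)| <=
   `|i1 - i2| + `|i2 - i3| + `|i3 - i4| + `|i4 - i5|.
  by do 2![apply: (le_trans (ler_normD _ _)); apply: lerD => //]; exact: ler_normD.
apply: (le_trans tri).
have -> : (10 * Lf + 2 * (4 * B / m ^+ 2 + 16 / m ^+ 2 + 400 / eps ^+ 2) +
   8 * K * (1 + k3) + Lf * Num.sqrt sig2 + 2 * (4 * B / m ^+ 2) +
   8 * KF * (1 + k3) * B * A ^+ 3) / Q =
   Lf * (10 / Q) + 2 * ((4 * B / m ^+ 2 + 16 / m ^+ 2 + 400 / eps ^+ 2) / Q) +
   8 * K * (1 + k3) / Q + Lf * Num.sqrt sig2 / Q + 2 * (4 * B / m ^+ 2 / Q) +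
   8 * KF * (1 + k3) * B * A ^+ 3 / Q by ring.
have -> : eta * (2 + 4 * B * A ^+ 2 + limit_var) = eta * (1 + 4 * B * A ^+ 2) + eta * (1 + limit_var) by ring.
have e1 : Lf * (2 * eps + 10 / Q) = 2 * Lf * eps + Lf * (10 / Q) by ring.
rewrite e1 in T1.
apply: (le_trans (lerD (lerD (lerD T1 (T2 0 c0 (lexx 0))) T3) T4)).
by apply: regroup_errors.
Qed.

End one_step.

End test_limit.

Lemma pow5_large (R : realFieldType) (m : R) (q : nat) : 0 < m -> (0 < q)%N ->
  (2 * m + 1) / m / q%:R <= 1 -> 2 * m + 1 <= m * (q ^ 5)%:R.
Proof.
move=> m0 q0; have Q0 : 0 < q%:R :> R by rewrite ltr0n.
rewrite ler_pdivrMr// mul1r ler_pdivrMr// => H; apply: (le_trans H).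
rewrite mulrC; apply: ler_wpM2l; first exact: ltW.
by rewrite ler_nat -{1}(expn1 q); apply: (@leq_pexp2l q 1 5 q0).
Qed.

Lemma root16_upper (R : realFieldType) (h q : nat) : (0 < q)%N -> (h < q.+1 ^ 16)%N ->
  h%:R <= 2 ^+ 16 * q%:R ^+ 16 :> R.
Proof.
move=> q0 /ltnW hq; rewrite -exprMn; apply: (@le_trans _ _ (q.+1%:R ^+ 16)).
  by rewrite -natrX ler_nat.
apply: lerXn2r; rewrite ?nnegrE ?mulr_ge0//.
by rewrite -natrM ler_nat; lia.
Qed.

Lemma root16_ge (n q0 q : nat) :
  (2 * q0 ^ 16 <= n)%N -> (n./2 < q.+1 ^ 16)%N -> (q0 <= q)%N.
Proof.
move=> q0n hq; rewrite -ltnS -(@ltn_exp2r _ _ 16)//; apply: leq_ltn_trans hq.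
by move: q0n; move: (q0 ^ 16)%N => k; have := half_bounds n; lia.
Qed.

Section test_limit.
Context d (T : measurableType d) (R : realType) (P : probability T R).
Variables (p : bool -> nat -> R) (lab : bool -> nat -> T -> nat).
Hypothesis L : iid_labels P lab p.
Notation m := (label_mean p).
Hypothesis m0 : 0 < m.
Notation sig2 := (total_var p).
Notation k3 := (gaussian_abs3 R).
Variable D : nat -> T -> R.
Hypothesis dD : forall n, discrete_rv (D n).
Hypothesis D_good : forall n q (eps : R) w, 0 < eps -> (2 <= q)%N ->
  (2 * q ^ 9 <= n./2)%N -> 2 * m + 1 <= m * (q ^ 5)%:R -> (q ^ 16 <= n./2)%N ->
  ~~ bad_event p lab n./2 q eps w ->
  `|D n w - (n./2)%:R / norm54 n * excess_at p lab n./2 (pred_at p lab n./2 (q ^ 9) w) w|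
  <= 2 * eps + 10 / q%:R.

Lemma test_limit (f : R -> R) (K : R) :
  lip_bounded f -> (forall x, `|f x| <= 1) -> 0 <= K -> taylor3 K f ->
  (fun n => \int[P]_w f (D n w)) @ \oo --> gsmooth (limit_var p) (profile f) 0.
Proof.
move=> lf f1 K0 tf; apply/cvgrPdist_le => e e0.
have [_ [Lf Lf0 fL]] := lf.
have lv0 := limit_var_ge0 L m0.
have s0 := total_var_ge0 L.
(* From h < (q + 1)^16 <= (2 q)^16. *)
pose B : R := 2 ^+ 16; pose A : R := sig2 / (2 * m).
have B0 : 0 <= B by rewrite exprn_ge0.
have A0 : 0 <= A by rewrite divr_ge0// mulr_ge0// ltW.
(* Order of choices: eps and eta are fixed first, as their terms do not decay with q; eta determines
   F, hence KF and LF; only then is q taken large. *)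
pose eps := e / (8 * (Lf + 1)).
have Lf1 : 0 < Lf + 1 by rewrite ltr_wpDl.
have eps0 : 0 < eps by rewrite divr_gt0// mulr_gt0.
have eps_small : 2 * Lf * eps <= e / 4.
  have -> : e / 4 = 2 * (Lf + 1) * eps by rewrite /eps; field; rewrite gt_eqF.
  by rewrite ler_wpM2r ?(ltW eps0)// ler_wpM2l// lerDl.
pose V := 2 + 4 * B * A ^+ 2 + limit_var p.
have V0 : 0 < V.
  by rewrite /V -addrA ltr_pwDl// addr_ge0// mulr_ge0 ?exprn_ge0// mulr_ge0.
pose eta := e / (4 * V).
have eta0 : 0 < eta by rewrite divr_gt0// mulr_gt0.
have eta_small : eta * V = e / 4 by rewrite /eta; field; rewrite gt_eqF.
have [F [lF [KF KF0 tF] HF]] :=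
  smooth_approximation eta0 (profile_le1 lf f1) (profile_uniform lf).
have [_ [LF LF0 FL]] := lF.
pose C := 10 * Lf + 2 * (4 * B / m ^+ 2 + 16 / m ^+ 2 + 400 / eps ^+ 2) +
   8 * K * (1 + k3) + Lf * Num.sqrt sig2 + 2 * (4 * B / m ^+ 2) +
   8 * KF * (1 + k3) * B * A ^+ 3.
have k1 : 0 <= 1 + k3 by rewrite addr_ge0// gaussian_abs3_ge0.
have m2 : 0 <= m ^+ 2 by rewrite exprn_ge0// ltW.
have C0 : 0 <= C.
  have C1 : 0 <= 4 * B / m ^+ 2 by rewrite divr_ge0// mulr_ge0.
  have C2 : 0 <= 16 / m ^+ 2 by rewrite divr_ge0.
  have C3 : 0 <= 400 / eps ^+ 2 by apply: divr_ge0; [exact: ler0n|exact/exprn_ge0/ltW].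
  have C4 : 0 <= 8 * K * (1 + k3) by apply: mulr_ge0 => //; exact: mulr_ge0.
  have C5 : 0 <= Lf * Num.sqrt sig2 by rewrite mulr_ge0// sqrtr_ge0.
  have C6 : 0 <= 8 * KF * (1 + k3) * B * A ^+ 3.
    by apply: mulr_ge0; [do 3![apply: mulr_ge0 => //]|exact: exprn_ge0].
  rewrite /C; apply: addr_ge0 C6.
  apply: addr_ge0; last by apply: mulr_ge0 C1.
  apply: addr_ge0 C5; apply: addr_ge0 C4.
  apply: addr_ge0; first by apply: mulr_ge0 Lf0.
  by apply: mulr_ge0 (ler0n _ 2) _; apply: addr_ge0 C3; exact: addr_ge0.
pose C2 := 2 * (sig2 ^+ 3 / (4 * m ^+ 2)).
have C20 : 0 <= C2 by rewrite mulr_ge0// divr_ge0 ?exprn_ge0// mulr_ge0.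
pose del := e / (4 * (LF + 1)).
have LF1 : 0 < LF + 1 by rewrite ltr_wpDl.
have del0 : 0 < del by rewrite divr_gt0// mulr_gt0.
have e40 : 0 < e / 4 by rewrite divr_gt0.
have [q1 Hq1] := div_nat_small C0 e40.
have [q2 Hq2] := div_nat_small C20 (exprn_gt0 2 del0).
have m10 : 0 <= (2 * m + 1) / m by rewrite divr_ge0 ?addr_ge0 ?mulr_ge0// ltW.
have [q3 Hq3] := div_nat_small m10 (ltr01 : 0 < 1 :> R).
pose q0 := maxn 2 (maxn q1 (maxn q2 q3)).
near=> n.
have [q /andP[qh hq]] := root16_exists n./2.
have q0q : (q0 <= q)%N.
  apply: (root16_ge _ hq); near: n; exact: nbhs_infty_ge.
move: q0q; rewrite !geq_max => /and4P[q2' q1q q2q q3q].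
have q00 : (0 < q)%N by apply: leq_trans q2'.
have ymu := pow5_large m0 q00 (Hq3 _ q3q q00).
have hB := @root16_upper R _ _ q00 hq.
rewrite distrC.
apply: le_trans (test_limit_step L m0 dD D_good q2' qh ymu hB lf f1 K0 tf Lf0 fL
  lF KF0 tF LF0 FL eps0 (ltW eta0) B0 HF) _.
have -> : e = e / 4 + e / 4 + e / 4 + e / 4 by field.
apply: lerD; first apply: lerD.
- by apply: lerD => //; rewrite -eta_small.
- exact: Hq1.
- have -> : e / 4 = (LF + 1) * del by rewrite /del; field; rewrite gt_eqF.
  apply: ler_pM => //; first by rewrite lerDl.
  have <- : Num.sqrt (del ^+ 2) = del by rewrite sqrtr_sqr ger0_norm// ltW.
  by apply: ler_wsqrtr; exact: Hq2.
Unshelve. all: by end_near. Qed.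

End test_limit.

Lemma bounded_cvg_Rint d (T : measurableType d) (R : realType) (P : probability T R)
    (f_ : nat -> T -> R) (f : T -> R) (c : R) :
  (forall n, measurable_fun setT (f_ n)) -> (forall n x, `|f_ n x| <= c) ->
  (forall x, f_ ^~ x @ \oo --> f x) ->
  (fun n => \int[P]_x f_ n x) @ \oo --> \int[P]_x f x.
Proof.
move=> mf fc cf.
have mlim : measurable_fun setT f.
  by apply: (measurable_fun_cvg mf) => x _; exact: cf.
have fc' x : `|f x| <= c.
  by apply: (ler_cvg_to (cvg_norm (cf x)) (cvg_cst c)); exact: nearW.
have bf : bounded_mfun f by split=> //; exists c.
apply: fine_cvg; rewrite fineK; last first.
  by apply: integrable_fin_num => //; exact: bounded_mfun_integrable.
apply: (@dominated_cvg _ _ _ P setT measurableT (fun n x => (f_ n x)%:E) _ (fun=> c%:E)).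
- by move=> n; exact/measurable_EFinP.
- by move=> x _; apply: cvg_EFin; [exact: nearW|exact: cf].
- by [].
- exact: (@finite_measure_integrable_cst _ _ _ P).
- by move=> n x _; rewrite abse_EFin lee_fin.
Qed.

(** * Identification of the limit as a scale mixture *)

Section scale_mixture.
Context {R : realType}.
Notation gam := (@normal_prob R 0 1).

Lemma Rint_normal_scale (s : R) (f : R -> R) : 0 < s -> continuous f ->
  (forall x, 0 <= f x) ->
  \int[gam]_y f (0 + s * y) = \int[@normal_prob R 0 s]_u f u.
Proof.
move=> s0 cf f0; have mf : measurable_fun setT f by exact: continuous_measurable_fun.
by rewrite /Rintegral (ge0_integral_normal_affine 0 s0 cf f0) (ge0_integral_normal_prob _ _ mf f0).
Qed.

Lemma normal_prob_set1 (m s x : R) : normal_prob m s [set x] = 0%E.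
Proof.
by move/null_content_dominatesP: (normal_prob_dominates m s); apply => //;
  exact: lebesgue_measure_set1.
Qed.

Definition mixture (v : R) (A : set R) : R :=
  \int[@normal_prob R 0 (Num.sqrt v)]_w fine (@normal_prob R 0 (Num.sqrt `|w|) A).

Lemma Rint_indic_normal (s : R) (A : set R) : measurable A ->
  \int[@normal_prob R 0 s]_u \1_A u = fine (normal_prob 0 s A).
Proof. by move=> mA; rewrite /Rintegral integral_indic// setIT. Qed.

Section nice_limit.
Variables (v : R) (f_ : nat -> R -> R) (A : set R).
Hypotheses (v0 : 0 < v) (mA : measurable A).
Hypotheses (lf : forall n, lip_bounded (f_ n)) (f01 : forall n x, 0 <= f_ n x <= 1).
Hypothesis cf : forall x, f_ ^~ x @ \oo --> (\1_A x : R).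

Let f1 n x : `|f_ n x| <= 1.
Proof. by have /andP[a b] := f01 n x; rewrite ger0_norm. Qed.

Let cont_f n : continuous (f_ n). Proof. exact: lip_bounded_continuous. Qed.

Let profile_cvg (w : R) : w != 0 ->
  (fun n => profile (f_ n) w) @ \oo --> fine (@normal_prob R 0 (Num.sqrt `|w|) A).
Proof.
move=> w0; rewrite -Rint_indic_normal//.
rewrite (_ : (fun n => _) = (fun n => \int[@normal_prob R 0 (Num.sqrt `|w|)]_u f_ n u)); last first.
  apply/funext => n; rewrite -Rint_normal_scale//; first by rewrite sqrtr_gt0 normr_gt0.
  by move=> x; case/andP: (f01 n x).
apply: (@bounded_cvg_Rint _ _ _ _ _ _ 1) => //.
by move=> n; exact: continuous_measurable_fun.
Qed.

(** At w = 0 the profile is f(0), while [normal_prob 0 0] need not be the point mass at 0, so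
    convergence may fail there. The value is replaced at this point, which has measure 0 for the
    outer normal law. *)
Let patched n (w : R) : R :=
  if w == 0 then fine (@normal_prob R 0 (Num.sqrt `|w|) A) else profile (f_ n) w.

Let profile_mfun n : bounded_mfun (profile (f_ n)).
Proof. exact: (uniform_continuous_mfun (profile_le1 (lf n) (f1 n)) (profile_uniform (lf n))). Qed.

Let measurable_eq0 : measurable_fun setT (fun w : R => w == 0).
Proof.
by apply: measurable_fun_eqr.
Qed.

Let patched_mfun n : measurable_fun setT (patched n).
Proof.
have -> : patched n = (fun w : R => if w == 0 then fine (@normal_prob R 0 (Num.sqrt `|(0 : R)|) A)
    else profile (f_ n) w).
  by apply/funext => w; rewrite /patched; case: (eqVneq w 0) => [->|].
by apply: measurable_fun_ifT => //; exact: (profile_mfun n).1.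
Qed.

Let patched_le1 n w : `|patched n w| <= 1.
Proof.
rewrite /patched; case: ifP => _; last exact: profile_le1.
rewrite -Rint_indic_normal//; apply: RintT_norm_le.
  by split; [exact: measurable_indic|exists 1 => x; rewrite indicE ger0_norm ?lern1 ?leq_b1].
by move=> x; rewrite indicE ger0_norm ?lern1 ?leq_b1.
Qed.

(** The integrand of the mixture is measurable as the pointwise limit of the patched profiles. *)
Lemma mixture_mfun : bounded_mfun (fun w : R => fine (@normal_prob R 0 (Num.sqrt `|w|) A)).
Proof.
split; last first.
  exists 1 => w; rewrite -Rint_indic_normal//; apply: RintT_norm_le.
    by split; [exact: measurable_indic|exists 1 => x; rewrite indicE ger0_norm ?lern1 ?leq_b1].
  by move=> x; rewrite indicE ger0_norm ?lern1 ?leq_b1.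
apply: (measurable_fun_cvg patched_mfun) => w _; rewrite /patched.
by case: eqVneq => [->|w0]; [exact: cvg_cst|exact: profile_cvg].
Qed.

Lemma mixture_cvg : (fun n => gsmooth v (profile (f_ n)) 0) @ \oo --> mixture v A.
Proof.
rewrite (_ : (fun n => _) = (fun n => \int[@normal_prob R 0 (Num.sqrt v)]_w patched n w : R)).
  apply: (@bounded_cvg_Rint _ _ _ _ _ _ 1) => // w; rewrite /patched.
  by case: eqVneq => [->|w0]; [exact: cvg_cst|exact: profile_cvg].
apply/funext => n.
have profile0 x : 0 <= profile (f_ n) x.
  by apply: RintT_ge0 => y; case/andP: (f01 n (0 + Num.sqrt `|x| * y)).
rewrite /gsmooth Rint_normal_scale ?sqrtr_gt0//; last first.
  by apply: modulus_continuous; exact: profile_uniform (lf n).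
congr fine; apply: ae_eq_integral => //.
- by apply/measurable_EFinP; exact: (profile_mfun n).1.
- by apply/measurable_EFinP; exact: patched_mfun.
- exists [set 0]; split => //; first exact: normal_prob_set1.
  move=> w /= /not_implyP[_] H; apply: contrapT => w0; apply: H.
  by rewrite /patched ifF//; apply/eqP.
Qed.

End nice_limit.

End scale_mixture.

Lemma prb_measure d (T : measurableType d) (R : realType) (P : probability T R) (b : T -> bool) :
  discrete_rv b -> P [set w | b w] = (prb P b)%:E.
Proof.
move=> db; have mb := discrete_rv_bool db.
have -> : prb P b = \int[P]_w \1_[set w | b w] w.
  apply: eq_Rintegral => w _; rewrite indicE; case: (boolP (b w)) => bw.
    by rewrite mem_set.
  by rewrite memNset//=; exact/negP.
rewrite /Rintegral integral_indic// setIT fineK//.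
by rewrite fin_num_measure.
Qed.

Lemma sandwich_dist (R : realFieldType) (M a b u l p e : R) :
  `|M - a| <= e / 2 -> `|M - b| <= e / 2 -> `|a - u| <= e / 2 -> `|b - l| <= e / 2 ->
  p <= u -> l <= p -> `|M - p| <= e.
Proof.
rewrite !ler_norml => /andP[? ?] /andP[? ?] /andP[? ?] /andP[? ?] ? ?.
by apply/andP; split; lra.
Qed.

(** * From smooth test functions to distribution functions *)

Section cdf_limit.
Context d (T : measurableType d) (R : realType) (P : probability T R).
Variables (X : nat -> T -> R) (v : R).
Hypotheses (dX : forall n, discrete_rv (X n)) (v0 : 0 < v).
Hypothesis X_smooth : forall (f : R -> R) K,
  lip_bounded f -> (forall x, `|f x| <= 1) -> 0 <= K -> taylor3 K f ->
  (fun n => \int[P]_w f (X n w)) @ \oo --> gsmooth v (profile f) 0.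

Let ramp (a e x : R) : R := 1 + (-1) * smooth_step a e x.

Let ramp_lip a e : lip_bounded (ramp a e).
Proof.
apply: lip_boundedD; first exact: lip_bounded_cst.
by apply: lip_boundedZ; exact: smooth_step_lip.
Qed.

Let ramp01 a e x : 0 <= ramp a e x <= 1.
Proof. by have := smooth_step01 a e x; rewrite /ramp mulN1r subr_ge0 gerBl andbC. Qed.

Let ramp_taylor a e : exists2 K, 0 <= K & taylor3 K (ramp a e).
Proof.
have [K K0 tK] := smooth_step_taylor a e.
exists (0 + `|-1| * K); first by rewrite addr_ge0// mulr_ge0.
by apply: taylor3D; [exact: taylor3_cst|exact: taylor3Z].
Qed.

Let ramp_cvg a e : (fun n => \int[P]_w ramp a e (X n w)) @ \oo --> gsmooth v (profile (ramp a e)) 0.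
Proof.
have [K K0 tK] := ramp_taylor a e.
apply: (X_smooth (ramp_lip a e) _ K0 tK) => x.
by have /andP[a0 a1] := ramp01 a e x; rewrite ger0_norm.
Qed.

Let inv_small (e : R) : 0 < e -> exists N, forall k, (N <= k)%N -> k.+1%:R^-1 <= e.
Proof.
move=> e0; have [q0 H] := div_nat_small (ler01 : 0 <= 1 :> R) e0.
by exists q0 => k /leqW q0k; rewrite -[leLHS]mul1r; exact: H.
Qed.

(** Ramps falling from 1 to 0 just to the right and just to the left of x: they sandwich the
    indicator of y <= x and converge to the closed and open half-line respectively. *)
Let upper x k := ramp x k.+1%:R^-1.
Let lower x k := ramp (x - k.+1%:R^-1) k.+1%:R^-1.

Let upper_cvg x y : (fun k => upper x k y) @ \oo --> (\1_[set y | y <= x] y : R).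
Proof.
rewrite indicE; have [yx|xy] := leP y x.
  rewrite mem_set//= (_ : (fun k => _) = cst 1); first exact: cvg_cst.
  by apply/funext => k; rewrite /upper /ramp smooth_step0// ?mulr0 ?addr0// invr_gt0.
rewrite memNset/=; last by rewrite leNgt xy.
have /inv_small[N HN] : 0 < y - x by rewrite subr_gt0.
apply: (@cvg_near_cst _ _ _ (fun k => upper x k y)).
near=> k; apply/eqP; rewrite /upper /ramp smooth_step1 ?mulr1 ?subrr ?invr_gt0//.
by rewrite addrC -lerBrDr; apply: HN; near: k; exact: nbhs_infty_ge.
Unshelve. all: by end_near. Qed.

Let lower_cvg x y : (fun k => lower x k y) @ \oo --> (\1_[set y | y < x] y : R).
Proof.
rewrite indicE; have [xy|yx] := leP x y.
  rewrite memNset/=; last by rewrite ltNge xy.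
  rewrite (_ : (fun k => _) = cst 0); first exact: cvg_cst.
  by apply/funext => k; rewrite /lower /ramp smooth_step1 ?mulr1 ?subrr ?invr_gt0// subrK.
rewrite mem_set//=.
have /inv_small[N HN] : 0 < x - y by rewrite subr_gt0.
apply: (@cvg_near_cst _ _ _ (fun k => lower x k y)).
near=> k; apply/eqP; rewrite /lower /ramp smooth_step0 ?mulr0 ?addr0 ?invr_gt0//.
by rewrite lerBrDr addrC -lerBrDr; apply: HN; near: k; exact: nbhs_infty_ge.
Unshelve. all: by end_near. Qed.

Let measurable_le (x : R) : measurable [set y : R | y <= x].
Proof. by rewrite -set_itvNyc; exact: measurable_itv. Qed.

Let measurable_lt (x : R) : measurable [set y : R | y < x].
Proof. by rewrite -set_itvNyo; exact: measurable_itv. Qed.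

(** The two limits of the sandwich agree because [normal_prob] has no atoms, whatever its second
    parameter. *)
Let mixture_lt x : mixture v [set y | y < x] = mixture v [set y : R | y <= x].
Proof.
apply: eq_Rintegral => w _; congr fine.
have -> : [set y | y <= x] = [set y | y < x] `|` [set x].
  apply/seteqP; split => y /=; rewrite le_eqVlt.
    by case/orP => [/eqP|]; [right|left].
  by case=> [->|->]; rewrite ?eqxx// orbT.
rewrite measureU//=.
- by rewrite [X in (_ + X)%E]normal_prob_set1 adde0.
- exact: measurable_lt.
- by apply/seteqP; split => y //= -[] /[swap] ->; rewrite ltxx.
Qed.

Lemma prb_cdf_limit x :
  (fun n => prb P (fun w => X n w <= x)) @ \oo --> mixture v [set y : R | y <= x].
Proof.
apply/cvgrPdist_le => e e0; have e20 : 0 < e / 2 by rewrite divr_gt0.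
have up := @mixture_cvg R v (upper x) _ v0 (measurable_le x)
  (fun k => ramp_lip _ _) (fun k => ramp01 _ _) (@upper_cvg x).
have lo := @mixture_cvg R v (lower x) _ v0 (measurable_lt x)
  (fun k => ramp_lip _ _) (fun k => ramp01 _ _) (@lower_cvg x).
rewrite mixture_lt in lo.
have [k [Hu Hl]] : exists k, `|mixture v [set y : R | y <= x] - gsmooth v (profile (upper x k)) 0| <= e / 2
    /\ `|mixture v [set y : R | y <= x] - gsmooth v (profile (lower x k)) 0| <= e / 2.
  move/cvgrPdist_le : up => /(_ _ e20) up; move/cvgrPdist_le : lo => /(_ _ e20) lo.
  by have [N _ HN] := filterI up lo; exists N; exact: (HN N (leqnn N)).
have ru : \forall n \near \oo,
    `|gsmooth v (profile (upper x k)) 0 - \int[P]_w upper x k (X n w)| <= e / 2.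
  by move/cvgrPdist_le: (@ramp_cvg x k.+1%:R^-1); exact.
have rl : \forall n \near \oo,
    `|gsmooth v (profile (lower x k)) 0 - \int[P]_w lower x k (X n w)| <= e / 2.
  by move/cvgrPdist_le: (@ramp_cvg (x - k.+1%:R^-1) k.+1%:R^-1); exact.
near=> n.
have Hu' : `|gsmooth v (profile (upper x k)) 0 - \int[P]_w upper x k (X n w)| <= e / 2.
  by near: n.
have Hl' : `|gsmooth v (profile (lower x k)) 0 - \int[P]_w lower x k (X n w)| <= e / 2.
  by near: n.
have bX : bounded_mfun (fun w => (X n w <= x)%R%:R : R).
  exact/bool_bounded_mfun/(discrete_rv_comp (fun y => y <= x)).
have bR a c : bounded_mfun (fun w => ramp a c (X n w)).
  by apply: lip_bounded_comp => //; exact: discrete_rv_mfun.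
have k0 : 0 < k.+1%:R^-1 :> R by rewrite invr_gt0.
have U : prb P (fun w => X n w <= x) <= \int[P]_w upper x k (X n w).
  apply: le_RintT => // [|w]; first exact: bR.
  have [yx|_] := boolP (X n w <= x); last by case/andP: (ramp01 x k.+1%:R^-1 (X n w)).
  by rewrite /upper /ramp smooth_step0// mulr0 addr0.
have W : \int[P]_w lower x k (X n w) <= prb P (fun w => X n w <= x).
  apply: le_RintT => // [|w]; first exact: bR.
  have [_|xy] := boolP (X n w <= x); first by case/andP: (ramp01 (x - k.+1%:R^-1) k.+1%:R^-1 (X n w)).
  by rewrite /lower /ramp smooth_step1 ?mulr1 ?subrr// subrK ltW// ltNge.
exact: (sandwich_dist Hu Hl Hu' Hl' U W).
Unshelve. all: by end_near. Qed.

Lemma cdf_limit x : (fun n => P [set w | X n w <= x]) @ \oo -->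
  (\int[@normal_prob R 0 (Num.sqrt v)]_w @normal_prob R 0 (Num.sqrt `|w|) [set y : R | (y <= x)%R])%E.
Proof.
have -> : (fun n => P [set w | X n w <= x]) = EFin \o (fun n => prb P (fun w => X n w <= x)).
  apply/funext => n /=; rewrite -prb_measure//.
  exact: (discrete_rv_comp (fun y => y <= x)).
rewrite (_ : (\int[_]_w _)%E = (mixture v [set y : R | y <= x])%:E).
  by apply: cvg_EFin; [exact: nearW|exact: prb_cdf_limit].
have bm := mixture_mfun (measurable_le x) (fun k => ramp_lip _ _) (fun k => ramp01 _ _) (@upper_cvg x).
rewrite /mixture /Rintegral fineK; last first.
  by apply: integrable_fin_num => //; exact: bounded_mfun_integrable.
apply: eq_integral => w _; rewrite fineK// fin_num_measure//.
exact: measurable_le.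
Qed.

End cdf_limit.

(** * The greedy and alternating policies *)

Definition pair_count (s t : seq nat) : nat :=
  (\sum_(i <- undup s) count_mem i s * count_mem i t)%N.

(** The sum over distinct values weighted by multiplicity is the sum over positions, which counts
    the matching pairs of records. *)
Lemma pair_countE (f g : nat -> nat) (m n : nat) :
  pair_count [seq f i | i <- iota 0 m] [seq g j | j <- iota 0 n] =
  (\sum_(i < m) \sum_(j < n) (f i == g j))%N.
Proof.
rewrite /pair_count; set s := [seq f i | i <- _]; set t := [seq g j | j <- _].
transitivity (\sum_(i <- s) count_mem i t)%N.
  rewrite -[RHS]big_undup_iterop_count; apply: eq_bigr => i _.
  by rewrite Monoid.iteropE iter_addn_0 mulnC.
rewrite /s big_map -{1}(subn0 m) -/(index_iota 0 m) big_mkord; apply: eq_bigr => i _.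
rewrite -sum1_count /t big_map -{1}(subn0 n) -/(index_iota 0 n) big_mkord big_mkcond /=.
by apply: eq_bigr => j _; rewrite eq_sym; case: (_ == _).
Qed.

(** One more record adds a single row or column of indicators, hence at most as many matches as
    records read from the other source. *)
Lemma pair_sum_succ (e : nat -> nat -> bool) (m n : nat) (c : bool) :
  (\sum_(i < m) \sum_(j < n) e i j <=
   \sum_(i < m + c) \sum_(j < n + ~~ c) e i j <=
   \sum_(i < m) \sum_(j < n) e i j + maxn m n)%N.
Proof.
have le1 (k : nat) (F : 'I_k -> bool) : (\sum_(i < k) F i <= k)%N.
  rewrite -[leqRHS]card_ord -sum1_card; apply: leq_sum => i _; exact: leq_b1.
case: c => /=; rewrite ?addn0 ?addn1.
  rewrite big_ord_recr /= leq_addr leq_add2l (leq_trans (le1 _ _))//.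
  exact: leq_maxr.
have -> : (\sum_(i < m) \sum_(j < n.+1) e i j = \sum_(i < m) \sum_(j < n) e i j + \sum_(i < m) e i n)%N.
  by rewrite -big_split /=; apply: eq_bigr => i _; rewrite big_ord_recr.
by rewrite leq_addr leq_add2l (leq_trans (le1 _ _))// leq_maxl.
Qed.

Lemma sum_affine (R : pzRingType) (n : nat) (F G : 'I_n -> R) (x z : R) :
  \sum_(j < n) (F j - x - G j - z) = \sum_(j < n) F j - n%:R * x - (\sum_(j < n) G j + n%:R * z).
Proof.
rewrite !sumrB !sumr_const card_ord (mulr_natl x n) (mulr_natl z n) opprD addrA.
by [].
Qed.

Section glue.
Context (R : realType) d (T : measurableType d) (P : probability T R).
Variables (r s : nat -> R) (LR LS : nat -> T -> nat).

Definition both_labels (b : bool) : nat -> T -> nat := if b then LR else LS.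
Definition both_laws (b : bool) : nat -> R := if b then r else s.
Notation lab := both_labels.
Notation p := both_laws.
Notation m := (label_mean p).

Lemma labels_model_iid (F0 : set (set T)) : prob_vec r -> prob_vec s ->
  labels_model P F0 LR LS r s -> iid_labels P lab p.
Proof.
move=> [_ r0 r1] [_ s0 s1] [[F00 F0C _] _ mR mS law]; split.
- by case=> j i; [exact: mR|exact: mS].
- by case.
- by case.
move=> N c; have F0T : F0 setT by rewrite -(setD0 setT); exact: F0C.
have := law setT F0T N (c true) (c false).
rewrite setTI probability_setT mul1e big_split -(pair_bigA _ (fun b (j : 'I_N) => p b (c b j)))/=.
rewrite big_bool => <-; congr (P _); apply/seteqP; split => w /= H.
  by move=> j jN; split; [exact: (H true)|exact: (H false)].
by case=> j jN; case: (H j jN).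
Qed.

Lemma hoeffding_matchesE (a b : nat) (w : T) :
  hoeffding_matches m (walk_at p lab true w) (walk_at p lab false w)
    (fun x y => match_ustat p lab x y w) a b =
  (\sum_(i < a) \sum_(j < b) (LR i w == LS j w))%N%:R.
Proof.
pose x := \sum_(i < a) score p true (LR i w); pose y := \sum_(j < b) score p false (LS j w).
pose e := \sum_(i < a) (\sum_(j < b) (LR i w == LS j w))%N%:R : R.
have row (i : 'I_a) : \sum_(j < b) match_kernel p (lab true i w) (lab false j w) =
    (\sum_(j < b) (LR i w == LS j w))%N%:R - b%:R * score p true (LR i w) - (y + b%:R * m).
  by rewrite natr_sum; exact: sum_affine.
have U : match_ustat p lab a b w = e - b%:R * x - a%:R * (y + b%:R * m).
  rewrite /match_ustat (eq_bigr _ (fun i _ => row i)) sumrB sumr_const card_ord.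
  by rewrite (mulr_natl _ a) sumrB mulr_sumr.
rewrite natr_sum -/e /hoeffding_matches /walk_at /walk -/x -/y U.
by move: (e) (x) (y) => e' x' y'; ring.
Qed.

Lemma GammaE_R k w : Gamma LR s k w = walk_at p lab true w k + m * k%:R.
Proof.
rewrite /Gamma /walk_at /walk /score /= sumrB sumr_const card_ord mulr_natr.
by rewrite subrK.
Qed.

Lemma GammaE_S k w : Gamma LS r k w = walk_at p lab false w k + m * k%:R.
Proof.
rewrite /Gamma /walk_at /walk /score /= sumrB sumr_const card_ord mulr_natr.
by rewrite subrK.
Qed.

Lemma Rcount_le (C : nat -> T -> bool) n w : (Rcount C n w <= n)%N.
Proof.
rewrite /Rcount -[leqRHS]card_ord -sum1_card; apply: leq_sum => i _; exact: leq_b1.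
Qed.

Lemma RcountS (C : nat -> T -> bool) n w : Rcount C n.+1 w = (Rcount C n w + C n w)%N.
Proof. by rewrite /Rcount big_ord_recr. Qed.

Lemma ScountS (C : nat -> T -> bool) n w : Scount C n.+1 w = (Scount C n w + ~~ C n w)%N.
Proof. by rewrite /Scount RcountS; have := Rcount_le C n w; case: (C n w) => /=; lia. Qed.

Lemma GammaS (L : nat -> T -> nat) (x : nat -> R) k (c : bool) w :
  (forall i, 0 <= x i <= 1) ->
  Gamma L x k w <= Gamma L x (k + c) w <= Gamma L x k w + c%:R.
Proof.
move=> x01; case: c; rewrite ?addn0 ?addr0 ?lexx//.
by rewrite addn1 /Gamma big_ord_recr/= lerDl lerD2l.
Qed.

(** Each record adds between 0 and 1 to the smaller of the two sums, so a gap of at most 1 stays at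
    most 1. *)
Lemma greedy_balanced (C : nat -> T -> bool) n w :
  (forall i, 0 <= r i <= 1) -> (forall i, 0 <= s i <= 1) ->
  greedy_policy r s LR LS C ->
  `|Gamma LR s (Rcount C n w) w - Gamma LS r (Scount C n w) w| <= 1.
Proof.
move=> r01 s01 greedy; elim: n => [|n IH].
  by rewrite /Scount /Rcount /Gamma !big_ord0 subr0 normr0.
have {greedy}[H1 H0] : (Gamma LR s (Rcount C n w) w < Gamma LS r (Scount C n w) w -> C n w = true) /\
    (Gamma LS r (Scount C n w) w < Gamma LR s (Rcount C n w) w -> C n w = false).
  (* At time 0 the greedy rule is not imposed, but both sums vanish and its premises are false. *)
  case: n {IH} => [|n]; last exact: greedy.
  by rewrite /Scount /Rcount /Gamma !big_ord0 ltxx.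
rewrite RcountS ScountS; move: IH H1 H0.
have := @GammaS LR s (Rcount C n w) (C n w) w s01.
have := @GammaS LS r (Scount C n w) (~~ C n w) w r01.
set x := Gamma LR s (Rcount C n w) w; set y := Gamma LS r (Scount C n w) w.
case: (C n w) => /=; rewrite ?addn0 ?addr0 => /andP[? ?] /andP[? ?] /ler_normlP[? ?] H1 H0.
  have xy : x <= y by rewrite leNgt; apply/negP => yx; have := H0 yx.
  by apply/ler_normlP; split; lra.
have xy : y <= x by rewrite leNgt; apply/negP => xy; have := H1 xy.
by apply/ler_normlP; split; lra.
Qed.

Lemma match_countE (C : nat -> T -> bool) n w :
  match_count LR LS C n w =
  (\sum_(i < Rcount C n w) \sum_(j < Scount C n w) (LR i w == LS j w))%N.
Proof. exact: (pair_countE (LR ^~ w) (LS ^~ w)). Qed.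

(** An odd n is reduced to the even time 2h: the last record creates at most 2h matches, which is
    negligible against n^(5/4). *)
Lemma match_count_half (C : nat -> T -> bool) n w :
  (match_count LR LS C (2 * n./2) w <= match_count LR LS C n w <=
   match_count LR LS C (2 * n./2) w + 2 * n./2)%N.
Proof.
rewrite mul2n -{2 3}(odd_double_half n); move: n./2.*2 => k.
case: (odd n); rewrite ?add0n ?leqnn ?leq_addr// add1n.
rewrite !match_countE RcountS ScountS.
have /andP[-> H] := pair_sum_succ (fun i j => LR i w == LS j w) (Rcount C k w) (Scount C k w) (C k w).
apply: (leq_trans H); rewrite leq_add2l geq_max Rcount_le /=; exact: leq_subr.
Qed.

End glue.

(** * Measurability of policies and match counts *)

Section policies.
Context d (T : measurableType d).
Variables (LR LS : nat -> T -> nat).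
Hypotheses (dR : forall j, discrete_rv (LR j)) (dS : forall j, discrete_rv (LS j)).

Lemma Rcount_discrete (C : nat -> T -> bool) n :
  (forall k, (k < n)%N -> discrete_rv (C k)) -> discrete_rv (Rcount C n).
Proof.
move=> dC; apply: (@discrete_rv_bigop _ _ _ 0%N addn (fun k w => C k w : nat)) => k kn.
exact: (discrete_rv_comp nat_of_bool (dC k kn)).
Qed.

Lemma first_labels_discrete (L : nat -> T -> nat) (N : T -> nat) :
  (forall j, discrete_rv (L j)) -> discrete_rv N ->
  discrete_rv (fun w => first_labels L (N w) w).
Proof.
move=> dL dN; apply: (discrete_rv_index (Z := first_labels L) dN) => k.
exact: discrete_rv_seq.
Qed.

Lemma read_history_discrete (C : nat -> T -> bool) n :
  (forall k, (k < n)%N -> discrete_rv (C k)) -> discrete_rv (read_history LR LS C n).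
Proof.
move=> dC; have dN := Rcount_discrete dC.
apply: (discrete_rv_comp2 pair); first exact: first_labels_discrete.
exact/first_labels_discrete/(discrete_rv_comp (subn n)).
Qed.

(** Strong induction: C n is measurable with respect to a history whose length is set by the earlier
    decisions, so the earlier ones must be known to be random variables first. *)
Lemma reading_policy_discrete (F0 : set (set T)) (C : nat -> T -> bool) n :
  F0 `<=` measurable -> reading_policy F0 LR LS C -> discrete_rv (C n).
Proof.
move=> F0m rp; elim/ltn_ind: n => n IH.
apply: discrete_rv_measurable_set.
have := rp n; apply: smallest_sub; first exact: sigma_algebra_measurable.
move=> A [/F0m//|[B _ <-]]; apply: discrete_rv_preimage.
exact: read_history_discrete.
Qed.

Lemma match_count_discrete (C : nat -> T -> bool) n :
  (forall k, discrete_rv (C k)) -> discrete_rv (match_count LR LS C n).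
Proof.
move=> dC; have dN : discrete_rv (Rcount C n) by exact: Rcount_discrete.
apply: (discrete_rv_comp2 pair_count (F := fun w => first_labels LR (Rcount C n w) w)
  (G := fun w => first_labels LS (Scount C n w) w)); first exact: first_labels_discrete.
by apply: first_labels_discrete => //; exact: (discrete_rv_comp (subn n)).
Qed.

End policies.

Lemma good_error (R : realType) (n h q : nat) (eps N : R) : 0 < eps -> (2 <= q)%N ->
  (q ^ 16 <= h)%N -> (2 * h <= n)%N -> n%:R * q%:R ^+ 4 <= N ->
  (2 * h%:R + (4 * q%:R ^+ 18 + 2 * q%:R ^+ 9 + h%:R * (eps * q%:R ^+ 4 + 2 * q%:R ^+ 3) +
    (2 * (eps * q%:R ^+ 4 * h%:R) + 8 * h%:R * q%:R ^+ 3))) <= N * (2 * eps + 10 / q%:R).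
Proof.
move=> eps0 q2 qh hn nN; set Q : R := q%:R; set H : R := h%:R.
have Q2 : 2 <= Q by rewrite ler_nat.
have Q0 : 0 < Q by apply: lt_le_trans Q2.
have Q1 : 1 <= Q by rewrite ler1n (leq_trans _ q2).
have HQ : Q ^+ 16 <= H by rewrite -natrX ler_nat.
have H0 : 0 <= H by [].
have p3 : 1 <= Q ^+ 3 by exact: exprn_ege1.
have HN : 2 * H * Q ^+ 4 <= N.
  apply: le_trans nN; rewrite ler_wpM2r ?exprn_ge0 ?(ltW Q0)//.
  by rewrite -natrM ler_nat.
apply: (@le_trans _ _ (2 * H * Q ^+ 4 * (2 * eps + 10 / Q))); last first.
  by apply: ler_wpM2r => //; apply: addr_ge0; [apply: mulr_ge0 | apply: divr_ge0]; rewrite ?(ltW eps0) ?(ltW Q0).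
(* All errors without eps are measured in units of H Q^3, using Q^16 <= H; they add up to at most 18
   of the 20 units available. Those with eps take 3 of 4. *)
have -> : 2 * H * Q ^+ 4 * (2 * eps + 10 / Q) = 4 * (eps * Q ^+ 4 * H) + 20 * (H * Q ^+ 3).
  by field; rewrite gt_eqF.
have e0 : 0 <= eps * Q ^+ 4 * H by rewrite !mulr_ge0// ?exprn_ge0 ?(ltW Q0) ?(ltW eps0).
have a1 : H <= H * Q ^+ 3 by rewrite ler_peMr.
have a2 : Q ^+ 18 <= H * Q ^+ 3.
  rewrite (exprD Q 16 2) ler_pM ?exprn_ge0 ?(ltW Q0)//.
  by rewrite ler_weXn2l.
have a3 : Q ^+ 9 <= H.
  by apply: le_trans HQ; rewrite ler_weXn2l.
have -> : H * (eps * Q ^+ 4 + 2 * Q ^+ 3) = eps * Q ^+ 4 * H + 2 * (H * Q ^+ 3) by ring.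
rewrite -[8 * H * _]mulrA.
move: (H * Q ^+ 3) (eps * Q ^+ 4 * H) (Q ^+ 18) (Q ^+ 9) a1 a2 a3 e0 H0 => u t x y; clear.
by move: H => z; lra.
Qed.

Lemma match_count_half_real (R : numDomainType) d (T : measurableType d)
    (LR LS : nat -> T -> nat) (C : nat -> T -> bool) n w :
  (match_count LR LS C (2 * n./2) w)%:R <= (match_count LR LS C n w)%:R :> R /\
  (match_count LR LS C n w)%:R <=
    (match_count LR LS C (2 * n./2) w)%:R + 2 * (n./2)%:R :> R.
Proof.
have /andP[lo hi] := match_count_half LR LS C n w.
by rewrite -natrM -natrD !ler_nat.
Qed.

Section main.
Context (R : realType) d (T : measurableType d) (P : probability T R).
Variables (r s : nat -> R) (LR LS : nat -> T -> nat).
Notation lab := (both_labels LR LS).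
Notation p := (both_laws r s).
Notation m := (label_mean p).
Hypothesis L : iid_labels P lab p.
Hypothesis m0 : 0 < m.
Variables (CG CA : nat -> T -> bool).
Hypothesis greedy : greedy_policy r s LR LS CG.
Hypothesis altern : forall n w, Rcount CA (2 * n) w = n.

Definition match_gap n w : R :=
  ((match_count LR LS CG n w)%:R - (match_count LR LS CA n w)%:R) / norm54 n.

Lemma match_gap_good n q (eps : R) w : 0 < eps -> (2 <= q)%N ->
  (2 * q ^ 9 <= n./2)%N -> 2 * m + 1 <= m * (q ^ 5)%:R -> (q ^ 16 <= n./2)%N ->
  ~~ bad_event p lab n./2 q eps w ->
  `|match_gap n w - (n./2)%:R / norm54 n * excess_at p lab n./2 (pred_at p lab n./2 (q ^ 9) w) w|
  <= 2 * eps + 10 / q%:R.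
Proof.
move=> eps0 q2 q9h ymu qh good.
have n0 := pow16_half_gt0 q2 qh; have N0 : 0 < norm54 n :> R by exact: norm54_gt0.
have p01 b i : 0 <= p b i <= 1 by rewrite (law_ge0 L) (law_le1 L).
have bal := @greedy_balanced R _ T r s LR LS CG (2 * n./2) w (p01 true) (p01 false) greedy.
rewrite (GammaE_R r s LR LS) (GammaE_S r s LR LS) /Scount in bal.
have G := good_comparison L m0 q2 q9h ymu (Rcount_le CG (2 * n./2) w) bal good.
rewrite !hoeffding_matchesE in G.
have EG : match_count LR LS CG (2 * n./2) w = (\sum_(i < Rcount CG (2 * n./2) w)
  \sum_(j < 2 * n./2 - Rcount CG (2 * n./2) w) (LR i w == LS j w))%N by exact: match_countE.
have EA : match_count LR LS CA (2 * n./2) w =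
    (\sum_(i < n./2) \sum_(j < n./2) (LR i w == LS j w))%N.
  by rewrite match_countE /Scount altern mul2n -addnn addnK.
rewrite -EG -EA in G.
have /andP[hn _] := half_bounds n.
have E := good_error eps0 q2 qh hn (norm54_ge (pow16_half_le qh)).
have [g1 g2] := match_count_half_real R LR LS CG n w.
have [a1 a2] := match_count_half_real R LR LS CA n w.
move: G E; rewrite /match_gap; move: (excess_at _ _ _ _ _) => x.
set B := 4 * _ + _ + _ + _; move: B => B G E.
move: g1 g2 a1 a2 G.
move: (match_count _ _ CG n w)%:R (match_count _ _ CA n w)%:R => g a.
move: (match_count _ _ CG _ w)%:R (match_count _ _ CA _ w)%:R => g' a'.
move=> g1 g2 a1 a2 G.
have -> : (g - a) / norm54 n - (n./2)%:R / norm54 n * x = (g - a - (n./2)%:R * x) / norm54 n.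
  by rewrite [RHS]mulrBl (mulrAC _ (norm54 n)^-1 x).
rewrite normrM normfV (gtr0_norm N0) ler_pdivrMr// (mulrC _ (norm54 n)). apply: le_trans E.
move: G; rewrite !ler_norml => /andP[G1 G2].
by apply/andP; split; lra.
Qed.

End main.

Theorem theorem4p2 (R : realType) (d : measure_display) (T : measurableType d)
  (P : probability T R) (r s : nat -> R) (LR LS : nat -> T -> nat)
  (F0 : set (set T)) (CG CA : nat -> T -> bool) :
  prob_vec r -> prob_vec s -> 0 < mu r s ->
  0 < Num.sqrt (varR r s) + Num.sqrt (varS r s) ->
  labels_model P F0 LR LS r s ->
  reading_policy F0 LR LS CG -> greedy_policy r s LR LS CG ->
  alternating_policy F0 CA ->
  cvg_dist P
    (fun n w => ((match_count LR LS CG n w)%:R - (match_count LR LS CA n w)%:R)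
                / (n%:R `^ (5%:R / 4%:R)))
    (mixtureF r s).
Proof.
move=> pr ps mu0 sig0 model rpG greedy [F0A altern] x _.
have L := labels_model_iid pr ps model.
have [_ F0m _ _ _] := model.
have dR j : discrete_rv (LR j) := label_discrete L true j.
have dS j : discrete_rv (LS j) := label_discrete L false j.
have dG n : discrete_rv (CG n) := reading_policy_discrete dR dS n F0m rpG.
have dA n : discrete_rv (CA n) by apply: discrete_rv_measurable_set; exact/F0m/F0A.
have dgap n : discrete_rv (match_gap R LR LS CG CA n).
  apply: (discrete_rv_comp2 (fun a b : nat => (a%:R - b%:R) / norm54 n : R));
    exact: match_count_discrete.
have m0 : 0 < label_mean (both_laws r s) := mu0.
have tv0 : 0 < total_var (both_laws r s).
  move: (score_var_ge0 L true) (score_var_ge0 L false) sig0; rewrite /total_var.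
  change (varR r s) with (score_var (both_laws r s) true).
  change (varS r s) with (score_var (both_laws r s) false).
  move: (score_var _ true) (score_var _ false) => a b a0 b0 sab.
  rewrite lt_def (addr_ge0 a0 b0) andbT paddr_eq0//.
  by apply: contraL sab => /andP[/eqP-> /eqP->]; rewrite sqrtr0 addr0 ltxx.
have v0 : 0 < limit_var (both_laws r s).
  by apply: divr_gt0; [exact: exprn_gt0|apply: mulr_gt0 => //; exact: exprn_gt0].
(* [mixtureF] and [tau2] unfold to the mixture at [limit_var], and the normalised difference to
   [match_gap], so the goals match by conversion. *)
apply: (cdf_limit dgap v0) => f K lf f1 K0 tf.
exact: (test_limit L m0 dgap (match_gap_good L m0 greedy altern) lf f1 K0 tf).
Qed.
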